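(* Let $G:\mathbb B^n\to\mathbb C^n$ be an infinitesimal generator. Suppose that $(\ast)$ the function $z\mapsto |\langle G(z),e_1\rangle|/|z_1-1|$ is bounded on every Korányi region $K(e_1,R)$, $R\ge 1$, and $(\ast\ast)$ for each $j=2,\dots,n$ the function $z\mapsto |\langle G(z),e_j\rangle|/|z_1-1|^{1/2}$ is bounded on every Korányi region $K(e_1,R)$, $R\geq 1$. Then $e_1$ is a boundary regular null point for $G$. Moreover, if $\beta\in\mathbb R$ denotes the dilation of $G$ at $e_1$, then: (1') $\langle dG_z(e_1),e_1\rangle$ and $\langle dG_z(e_h),e_k\rangle$ ($h,k=2,\dots,n$) are bounded on every Korányi region; (1'') $\langle dG_z(e_j),e_1\rangle/(1-z_1)^{1/2}$ is bounded on every Korányi region for $j=2,\dots,n$; (1''') $(1-z_1)^{1/2}\langle dG_z(e_1),e_j\rangle$ is bounded on every Korányi region for $j=2,\dots,n$; (2) $\angle_K\lim_{z\to e_1}\frac{\langle G(z),e_1\rangle}{z_1-1}=\beta$; (3) $\angle_K\lim_{z\to e_1}\langle dG_z(e_1),e_1\rangle=\beta$; (4) $\angle_K\lim_{z\to e_1}\langle dG_z(e_j),e_1\rangle=0$ for $j=2,\dots,n$.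
   Context: $\mathbb B^n$ is the open unit ball of $\mathbb C^n$, $\mathbb D$ the unit disc, $\langle z,w\rangle=\sum_j z_j\overline{w_j}$, $\{e_1,\dots,e_n\}$ the standard basis; $z=(z_1,z'')\in\mathbb C\times\mathbb C^{n-1}$. $(1-z_1)^{1/2}$ denotes the principal branch. A holomorphic map $G:\mathbb B^n\to\mathbb C^n$ is an infinitesimal generator if for every $z_0\in\mathbb B^n$ the Cauchy problem $\dot x(t)=G(x(t))$, $x(0)=z_0$, has a solution $x:[0,+\infty)\to\mathbb B^n$. Korányi region: for $R\ge1$, $K(e_1,R)=\{z\in\mathbb B^n:|1-z_1|\le\frac R2(1-\|z\|^2)\}$. Restricted $K$-limit: $\angle_K\lim_{z\to e_1}f(z)=L$ means that for every sequence $z_k\in\mathbb B^n$ with $z_k\to e_1$, $\|z_k-\langle z_k,e_1\rangle e_1\|^2/(1-|\langle z_k,e_1\rangle|^2)\to0$ and $\langle z_k,e_1\rangle\to1$ non-tangentially in $\mathbb D$, one has $f(z_k)\to L$. Let $u_{\mathbb B^n}(z)=-\frac{1-\|z\|^2}{|1-z_1|^2}$ and, for $w\in\mathbb C^n$, $d(u_{\mathbb B^n})_z\cdot w=\frac{d}{dt}\big|_{t=0}u_{\mathbb B^n}(z+tw)$ ($t$ real). The point $e_1$ is a boundary regular null point (BRNP) of the infinitesimal generator $G$ if there is $b\in\mathbb R$ with $d(u_{\mathbb B^n})_z\cdot G(z)+b\,u_{\mathbb B^n}(z)\le0$ for all $z\in\mathbb B^n$; then the dilation of $G$ at $e_1$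 is $\beta:=-\inf_{z\in\mathbb B^n}\frac{d(u_{\mathbb B^n})_z\cdot G(z)}{u_{\mathbb B^n}(z)}\in\mathbb R$. *)

(* Defs.v *)
From Stdlib Require Import Reals.
From mathcomp Require Import ssreflect ssrfun ssrbool eqtype ssrnat fintype bigop.
Open Scope R_scope.

Definition C := (R * R)%type.
Definition RtoC (r : R) : C := (r, 0).
Definition Czero : C := (0, 0).
Definition Cone : C := (1, 0).
Definition Cadd (a b : C) : C := (fst a + fst b, snd a + snd b).
Definition Copp (a : C) : C := (- fst a, - snd a).
Definition Csub (a b : C) : C := Cadd a (Copp b).
Definition Cmul (a b : C) : C :=
  (fst a * fst b - snd a * snd b, fst a * snd b + snd a * fst b).
Definition Cconj (a : C) : C := (fst a, - snd a).
Definition Cnorm2 (a : C) : R := fst a ^ 2 + snd a ^ 2.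
Definition Cmod (a : C) : R := sqrt (Cnorm2 a).
Definition Cinv (a : C) : C := (fst a / Cnorm2 a, - snd a / Cnorm2 a).
Definition Cdiv (a b : C) : C := Cmul a (Cinv b).
(* principal branch of the square root (branch cut on the negative real axis) *)
Definition Csqrt (a : C) : C :=
  (sqrt ((Cmod a + fst a) / 2),
   (if Rlt_dec (snd a) 0 then -1 else 1) * sqrt ((Cmod a - fst a) / 2)).

(* ---------- C^n, indexed by 'I_n (index 0 is the first coordinate) ---------- *)
Definition vec (n : nat) := 'I_n -> C.
Definition vadd {n} (u v : vec n) : vec n := fun i => Cadd (u i) (v i).
Definition vsub {n} (u v : vec n) : vec n := fun i => Csub (u i) (v i).
Definition vscal {n} (c : C) (v : vec n) : vec n := fun i => Cmul c (v i).
Definition vscalR {n} (t : R) (v : vec n) : vec n := vscal (RtoC t) v.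
Definition inner {n} (z w : vec n) : C :=
  \big[Cadd/Czero]_(i < n) Cmul (z i) (Cconj (w i)).
Definition vnorm2 {n} (z : vec n) : R := \big[Rplus/0]_(i < n) Cnorm2 (z i).
Definition vnorm {n} (z : vec n) : R := sqrt (vnorm2 z).
(* basis n k = e_{k+1}; so basis n 0 = e_1 *)
Definition basis (n k : nat) : vec n :=
  fun i => if nat_of_ord i == k then Cone else Czero.
Definition ball {n} (z : vec n) : Prop := vnorm2 z < 1.
Definition coord1 {n} (z : vec n) : C := inner z (basis n 0).

Definition Clinear {n} (L : vec n -> vec n) : Prop :=
  forall (a : C) (u v : vec n) (i : 'I_n),
    L (vadd (vscal a u) v) i = vadd (vscal a (L u)) (L v) i.
Definition is_cderiv {n} (G : vec n -> vec n) (z : vec n) (L : vec n -> vec n) : Prop :=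
  Clinear L /\
  forall eps, 0 < eps -> exists delta, 0 < delta /\
    forall h : vec n, ball (vadd z h) -> 0 < vnorm h < delta ->
      vnorm (vsub (vsub (G (vadd z h)) (G z)) (L h)) <= eps * vnorm h.

Definition has_deriv_on_halfline {n} (x : R -> vec n) (t : R) (v : vec n) : Prop :=
  forall eps, 0 < eps -> exists delta, 0 < delta /\
    forall s, 0 <= s -> 0 < Rabs (s - t) < delta ->
      vnorm (vsub (vsub (x s) (x t)) (vscalR (s - t) v)) <= eps * Rabs (s - t).
Definition inf_generator {n} (G : vec n -> vec n) : Prop :=
  forall z0 : vec n, ball z0 ->
    exists x : R -> vec n,
      (forall i, x 0 i = z0 i) /\
      (forall t, 0 <= t -> ball (x t)) /\
      (forall t, 0 <= t -> has_deriv_on_halfline x t (G (x t))).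

Definition Koranyi {n} (Rr : R) (z : vec n) : Prop :=
  ball z /\ Cmod (Csub Cone (coord1 z)) <= Rr / 2 * (1 - vnorm2 z).
Definition bounded_on_Koranyi {n} (f : vec n -> R) : Prop :=
  forall Rr, 1 <= Rr -> exists M, forall z : vec n, Koranyi Rr z -> Rabs (f z) <= M.

Definition nontangential (w : nat -> C) : Prop :=
  exists M, forall k, Cmod (Csub Cone (w k)) <= M * (1 - Cmod (w k)).
Definition K_lim {n} (f : vec n -> C) (L : C) : Prop :=
  forall zs : nat -> vec n,
    (forall k, ball (zs k)) ->
    Un_cv (fun k => vnorm (vsub (zs k) (basis n 0))) 0 ->
    Un_cv (fun k => vnorm2 (vsub (zs k) (vscal (coord1 (zs k)) (basis n 0)))
                     / (1 - Cnorm2 (coord1 (zs k)))) 0 ->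
    Un_cv (fun k => Cmod (Csub (coord1 (zs k)) Cone)) 0 ->
    nontangential (fun k => coord1 (zs k)) ->
    Un_cv (fun k => Cmod (Csub (f (zs k)) L)) 0.

Definition uB {n} (z : vec n) : R :=
  - (1 - vnorm2 z) / Cnorm2 (Csub Cone (coord1 z)).
Definition du_is {n} (z w : vec n) (l : R) : Prop :=
  derivable_pt_lim (fun t => uB (vadd z (vscalR t w))) 0 l.
Definition BRNP {n} (G : vec n -> vec n) : Prop :=
  exists b : R, forall z : vec n, ball z ->
    exists l, du_is z (G z) l /\ l + b * uB z <= 0.
(* beta = - inf_{z in B^n} (du_z . G(z)) / u(z) = sup_z -(du_z . G(z))/u(z) *)
Definition is_dilation {n} (G : vec n -> vec n) (beta : R) : Prop :=
  is_lub (fun y => exists (z : vec n) l, ball z /\ du_is z (G z) l /\ y = - (l / uB z)) beta.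

(* Main.v *)
(** Along a trajectory the natural quantity is [- uB]. In the Siegel model of the ball it is
    the real part of a holomorphic function with values in the right half-plane, as long as
    one stays on a fixed complex geodesic through [e_1]; off the geodesic it is smaller. So
    the flow of [G], which is holomorphic in the initial point, induces on each geodesic
    holomorphic self-maps of the half-plane starting from the identity, and the infinitesimal
    Schwarz-Pick inequality [|h'(w)| Re w <= Re h(w)] shows that
    [Re Q(x + i y) / x] is nonincreasing in [x], where [Q] is the induced field.
    Its limit as [x] tends to infinity is, by the growth hypotheses and Cauchy estimates in
    Koranyi regions, the same for every geodesic and every [y], and is minus the radial limit
    of [Re (G_1 / (z_1 - 1))]. This yields the boundary regular null point, identifies the
    dilation [beta] with that radial limit, and makes [Q(w) + beta w] on the geodesic through
    the origin a function with nonnegative real part that is [o(w)]; the latter is a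
    non-tangential limit, which Cauchy estimates spread to restricted K-limits.

    The differentiability hypothesis is pointwise, so Cauchy's estimates rest on Goursat's
    lemma; the flow is differentiated by applying Gronwall to its difference quotients. *)

From HB Require Import structures.
From Coquelicot Require Import Coquelicot.
From Stdlib Require Import Reals Lra Lia FunctionalExtensionality ClassicalEpsilon.
Require Import Defs.
From mathcomp Require Import ssreflect ssrfun ssrbool eqtype ssrnat fintype bigop.
Open Scope R_scope.
Set Implicit Arguments.
Unset Strict Implicit.
Unset Printing Implicit Defensive.

(* Two weights drive the estimates. In a Koranyi region a point may be moved by a multiple of
   [|1 - z_1|] along [e_1], but by a multiple of its square root along the other [e_j]. The growth
   hypotheses on [G] scale in the same way, and Cauchy's estimates on such discs give the four
   orders of growth of [dG]; in particular the tangential derivatives of [G_1] are small. At Siegel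
   height [x] the corresponding points of two slices are at distance of order [1 / x], so their
   values of [G_1] differ by order [x ^ (-3/2)]. The induced field divided by [x] carries [G_1] with
   a coefficient of order [x]. Hence all slices share one asymptotic rate, with an error of order
   [x ^ (-1/2)]. The infimum that defines the dilation may be approached far from the central slice.
   Monotonicity carries a nearly optimal value to infinity along its own slice, and the common rate
   transfers it to the central one. There only real parts on a ray are controlled; Schwarz-Pick,
   used as a differential inequality, extends this to moduli in sectors. *)
Declare Scope cx_scope.
Delimit Scope cx_scope with cx.
Bind Scope cx_scope with Defs.C.
Notation "a + b" := (Cadd a%cx b%cx) : cx_scope.
Notation "a - b" := (Csub a%cx b%cx) : cx_scope.
Notation "- a" := (Copp a%cx) : cx_scope.
Notation "a * b" := (Cmul a%cx b%cx) : cx_scope.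
Notation "a / b" := (Cdiv a%cx b%cx) : cx_scope.
Notation "1" := Cone : cx_scope.
Notation "0" := Czero : cx_scope.

(** * Complex arithmetic *)

Lemma C_ext (a b : C) : fst a = fst b -> snd a = snd b -> a = b.
Proof. by case: a b => [a1 a2] [b1 b2] /= -> ->. Qed.

Ltac cx_unfold :=
  rewrite /Cdiv /Cinv /Csub /Cadd /Copp /Cmul /Cconj /RtoC /Cone /Czero /Cnorm2 /=.
Ltac cx_ring := apply C_ext; cx_unfold; ring.

Lemma Cnorm2_ge0 (a : C) : 0 <= Cnorm2 a.
Proof. rewrite /Cnorm2; nra. Qed.

Lemma Cnorm2_neq0 (a : C) : a <> 0%cx -> Cnorm2 a <> 0.
Proof.
move=> Ha H; apply: Ha; apply C_ext; rewrite /Cnorm2 /= in H |- *; nra.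
Qed.

Lemma Cnorm2_gt0 (a : C) : a <> 0%cx -> 0 < Cnorm2 a.
Proof. move=> /Cnorm2_neq0; have := Cnorm2_ge0 a; lra. Qed.

Lemma C_ring_theory : ring_theory Czero Cone Cadd Cmul Csub Copp eq.
Proof. split=> *; cx_ring. Qed.

Lemma C_field_theory :
  field_theory Czero Cone Cadd Cmul Csub Copp Cdiv Cinv eq.
Proof.
split=> //; [exact: C_ring_theory | by case; lra |].
move=> a /Cnorm2_neq0 Ha; apply C_ext; cx_unfold; rewrite /Cnorm2 /= in Ha; field; lra.
Qed.

Add Field C_field : C_field_theory.

Lemma Cmod_ge0 (a : C) : 0 <= Cmod a. Proof. exact: sqrt_pos. Qed.
Lemma Cmod_sqr (a : C) : Cmod a ^ 2 = Cnorm2 a.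
Proof. rewrite /Cmod /= Rmult_1_r; exact/sqrt_sqrt/Cnorm2_ge0. Qed.
Lemma Cmod0 : Cmod 0 = 0.
Proof. by rewrite /Cmod /Cnorm2 /= !Rmult_0_l Rplus_0_l sqrt_0. Qed.
Lemma Cmod_mul (a b : C) : Cmod (a * b)%cx = Cmod a * Cmod b.
Proof. exact: Cmod_mult. Qed.
Lemma Cmod_add (a b : C) : Cmod (a + b)%cx <= Cmod a + Cmod b.
Proof. exact: Coquelicot.Complex.Cmod_triangle. Qed.
Lemma Cmod_opp (a : C) : Cmod (- a)%cx = Cmod a.
Proof. rewrite /Cmod /Cnorm2 /=; f_equal; ring. Qed.
Lemma Cmod_subC (a b : C) : Cmod (a - b)%cx = Cmod (b - a)%cx.
Proof. by rewrite -Cmod_opp; f_equal; ring. Qed.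
Lemma Cmod_conj (a : C) : Cmod (Cconj a) = Cmod a.
Proof. rewrite /Cmod /Cnorm2 /=; f_equal; ring. Qed.
Lemma Cmod_sub (a b : C) : Cmod (a - b)%cx <= Cmod a + Cmod b.
Proof. by rewrite -(Cmod_opp b); exact: Cmod_add. Qed.
Lemma Cmod_dist3 (a b c : C) : Cmod (a - c)%cx <= Cmod (a - b)%cx + Cmod (b - c)%cx.
Proof. have -> : (a - c)%cx = ((a - b) + (b - c))%cx by ring. exact: Cmod_add. Qed.
Lemma Cmod_le_sub (a b : C) : Cmod a <= Cmod b + Cmod (a - b)%cx.
Proof. have {1}-> : a = (b + (a - b))%cx by ring. exact: Cmod_add. Qed.
Lemma Cmod_RtoC (x : R) : Cmod (RtoC x) = Rabs x.
Proof. exact: Cmod_R. Qed.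
Lemma Cmod_gt0 (a : C) : a <> 0%cx -> 0 < Cmod a.
Proof. by move/Cnorm2_gt0; exact: sqrt_lt_R0. Qed.
Lemma Cmod_eq0 (a : C) : Cmod a = 0 -> a = 0%cx.
Proof. exact: Coquelicot.Complex.Cmod_eq_0. Qed.
Lemma Cmod_neq0 (a : C) : 0 < Cmod a -> a <> 0%cx.
Proof. by move=> H E; rewrite E Cmod0 in H; lra. Qed.
Lemma Cmod1 : Cmod 1 = 1. Proof. exact: Coquelicot.Complex.Cmod_1. Qed.
Lemma Cmod_inv (a : C) : a <> 0%cx -> Cmod (Cinv a) = / Cmod a.
Proof. exact: Coquelicot.Complex.Cmod_inv. Qed.
Lemma Cmod_div (a b : C) : b <> 0%cx -> Cmod (a / b)%cx = Cmod a / Cmod b.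
Proof. by move=> H; rewrite Cmod_mul Cmod_inv. Qed.
Lemma Cmod_fst (a : C) : Rabs (fst a) <= Cmod a.
Proof.
rewrite /Cmod -sqrt_Rsqr_abs; apply sqrt_le_1_alt; rewrite /Rsqr /Cnorm2; nra.
Qed.
Lemma Cmod_snd (a : C) : Rabs (snd a) <= Cmod a.
Proof.
rewrite /Cmod -sqrt_Rsqr_abs; apply sqrt_le_1_alt; rewrite /Rsqr /Cnorm2; nra.
Qed.
Lemma Cmod_le_fst_snd (a : C) : Cmod a <= Rabs (fst a) + Rabs (snd a).
Proof.
apply: Rsqr_incr_0; [| exact: Cmod_ge0 | have := Rabs_pos (fst a); have := Rabs_pos (snd a); lra].
rewrite !Rsqr_pow2 Cmod_sqr /Cnorm2.
rewrite -(pow2_abs (fst a)) -(pow2_abs (snd a)).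
have := Rabs_pos (fst a); have := Rabs_pos (snd a); nra.
Qed.

Lemma Cmod_square_le (a : C) (m : R) : 0 <= m -> Cnorm2 a <= m ^ 2 -> Cmod a <= m.
Proof.
move=> m0 H; apply: Rsqr_incr_0 => //; last exact: Cmod_ge0.
by rewrite !Rsqr_pow2 Cmod_sqr.
Qed.

(* Bounding [Re (l a)] for all unimodular [l] reduces modulus estimates to real ones. *)
Lemma Cmod_le_by_rotation (a : C) (m : R) :
  (forall l : C, Cmod l = 1 -> fst (l * a)%cx <= m) -> Cmod a <= m.
Proof.
move=> H; case: (Req_dec (Cmod a) 0) => [E|N].
  by have := H _ Cmod1; rewrite (Cmod_eq0 E) Cmod0 /=; lra.
have a0 : 0 < Cmod a by have := Cmod_ge0 a; lra.
have := H (Cconj a * RtoC (/ Cmod a))%cx.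
have -> : fst (Cconj a * RtoC (/ Cmod a) * a)%cx = Cmod a.
  cx_unfold.
  transitivity (Cnorm2 a / Cmod a); first by rewrite /Cnorm2; field; lra.
  by rewrite -Cmod_sqr; field; lra.
apply; rewrite Cmod_mul Cmod_conj Cmod_RtoC Rabs_pos_eq; first by field; lra.
by apply/Rlt_le/Rinv_0_lt_compat.
Qed.

(** * Complex differentiability *)

(** Division-free, so that [h = 0] is allowed and increments compose without case distinctions. *)
Definition cdiff (F : C -> C) (z d : C) : Prop :=
  forall eps, 0 < eps -> exists delta, 0 < delta /\ forall h : C, Cmod h < delta ->
    Cmod (F (z + h) - F z - d * h)%cx <= eps * Cmod h.

Lemma cdiff_const (a z : C) : cdiff (fun _ => a) z 0.
Proof.
move=> e e0; exists 1; split; first lra.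
move=> h _; have -> : (a - a - 0 * h)%cx = 0%cx by ring.
rewrite Cmod0; have := Cmod_ge0 h; nra.
Qed.

Lemma cdiff_id (z : C) : cdiff (fun x => x) z 1.
Proof.
move=> e e0; exists 1; split; first lra.
move=> h _; have -> : (z + h - z - 1 * h)%cx = 0%cx by ring.
rewrite Cmod0; have := Cmod_ge0 h; nra.
Qed.

Lemma cdiff_add (F H : C -> C) (z d d' : C) :
  cdiff F z d -> cdiff H z d' -> cdiff (fun x => F x + H x)%cx z (d + d')%cx.
Proof.
move=> HF HH e e0.
case: (HF (e / 2)) => [|a [a0 Ha]]; first lra.
case: (HH (e / 2)) => [|b [b0 Hb]]; first lra.
exists (Rmin a b); split; first exact: Rmin_pos.
move=> h hh; have {}Ha := Ha h (Rlt_le_trans _ _ _ hh (Rmin_l _ _)).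
have {}Hb := Hb h (Rlt_le_trans _ _ _ hh (Rmin_r _ _)).
have -> : (F (z + h) + H (z + h) - (F z + H z) - (d + d') * h)%cx
  = ((F (z + h) - F z - d * h) + (H (z + h) - H z - d' * h))%cx by ring.
apply: Rle_trans (Cmod_add _ _) _; lra.
Qed.

Lemma cdiff_lipschitz (F : C -> C) (z d : C) : cdiff F z d ->
  exists delta, 0 < delta /\ forall h, Cmod h < delta ->
    Cmod (F (z + h) - F z)%cx <= (Cmod d + 1) * Cmod h.
Proof.
move=> HF; case: (HF 1) => [|a [a0 Ha]]; first lra.
exists a; split=> // h hh; have := Ha h hh.
have := Cmod_le_sub (F (z + h) - F z)%cx (d * h)%cx; rewrite Cmod_mul; lra.
Qed.

Lemma cdiff_comp (F H : C -> C) (z d d' : C) :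
  cdiff H z d' -> cdiff F (H z) d -> cdiff (fun x => F (H x)) z (d * d')%cx.
Proof.
move=> HH HF e e0.
have dp := Cmod_ge0 d; have dp' := Cmod_ge0 d'.
case: (cdiff_lipschitz HH) => a [a0 Ha].
case: (HF (e / 2 / (Cmod d' + 1))) => [|b [b0 Hb]].
  by repeat apply: Rdiv_lt_0_compat => //; lra.
case: (HH (e / 2 / (Cmod d + 1))) => [|c [c0 Hc]].
  by repeat apply: Rdiv_lt_0_compat => //; lra.
exists (Rmin (Rmin a c) (b / (Cmod d' + 1))); split.
  by repeat apply: Rmin_pos => //; apply: Rdiv_lt_0_compat => //; lra.
move=> h hh; have h0 := Cmod_ge0 h.
have ha : Cmod h < a by apply: Rlt_le_trans hh _; apply: Rle_trans (Rmin_l _ _) (Rmin_l _ _).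
have hc : Cmod h < c by apply: Rlt_le_trans hh _; apply: Rle_trans (Rmin_l _ _) (Rmin_r _ _).
have hb : Cmod h < b / (Cmod d' + 1) by apply: Rlt_le_trans hh (Rmin_r _ _).
have {}hb : (Cmod d' + 1) * Cmod h < b.
  apply: (Rlt_le_trans _ ((Cmod d' + 1) * (b / (Cmod d' + 1)))).
    by apply: Rmult_lt_compat_l => //; lra.
  by apply: Req_le; field; lra.
have {}Ha := Ha h ha; have {}Hc := Hc h hc.
set k := (H (z + h) - H z)%cx in Ha Hc *.
have {}Hb := Hb k (Rle_lt_trans _ _ _ Ha hb).
have Ek : H (z + h)%cx = (H z + k)%cx by rewrite /k; ring.
have -> : (F (H (z + h)) - F (H z) - d * d' * h)%cx
   = ((F (H z + k) - F (H z) - d * k) + d * (k - d' * h))%cx by rewrite Ek; ring.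
apply: Rle_trans (Cmod_add _ _) _; rewrite Cmod_mul.
have Q1 : e / 2 / (Cmod d' + 1) * Cmod k <= e / 2 * Cmod h.
  apply: Rle_trans (Rmult_le_compat_l _ _ _ _ Ha) _.
    by apply Rlt_le; repeat apply: Rdiv_lt_0_compat => //; lra.
  by apply: Req_le; field; lra.
have Q2 : Cmod d * Cmod (k - d' * h)%cx <= e / 2 * Cmod h.
  apply: (Rle_trans _ ((Cmod d + 1) * (e / 2 / (Cmod d + 1) * Cmod h))); last first.
    by apply: Req_le; field; lra.
  apply: Rmult_le_compat => //; [exact: Cmod_ge0 | lra].
lra.
Qed.

Lemma cdiff_sqr (z : C) : cdiff (fun x => x * x)%cx z (z + z)%cx.
Proof.
move=> e e0; exists e; split=> // h hh.
have -> : ((z + h) * (z + h) - z * z - (z + z) * h)%cx = (h * h)%cx by ring.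
rewrite Cmod_mul; have := Cmod_ge0 h; nra.
Qed.

Lemma cdiff_scal (F : C -> C) (z d a : C) :
  cdiff F z d -> cdiff (fun x => a * F x)%cx z (a * d)%cx.
Proof.
move=> HF e e0; have ap := Cmod_ge0 a.
case: (HF (e / (Cmod a + 1))) => [|b [b0 Hb]]; first by apply: Rdiv_lt_0_compat => //; lra.
exists b; split=> // h hh; have {}Hb := Hb h hh.
have -> : (a * F (z + h) - a * F z - a * d * h)%cx = (a * (F (z + h) - F z - d * h))%cx by ring.
rewrite Cmod_mul.
apply: (Rle_trans _ ((Cmod a + 1) * (e / (Cmod a + 1) * Cmod h))); last first.
  by apply: Req_le; field; lra.
apply: Rmult_le_compat => //; [exact: Cmod_ge0 | lra].
Qed.

Lemma cdiff_val (F : C -> C) (z d d' : C) : cdiff F z d -> d = d' -> cdiff F z d'.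
Proof. by move=> H <-. Qed.

Lemma cdiff_ext (F H : C -> C) (z d : C) :
  (forall x, F x = H x) -> cdiff F z d -> cdiff H z d.
Proof. by move=> E HF e e0; case: (HF e e0) => a [a0 Ha]; exists a; split=> // h; rewrite -!E; apply: Ha. Qed.

Lemma cdiff_sub (F H : C -> C) (z d d' : C) :
  cdiff F z d -> cdiff H z d' -> cdiff (fun x => F x - H x)%cx z (d - d')%cx.
Proof.
move=> HF /(@cdiff_scal _ _ _ (- (1))%cx) HH.
apply: (cdiff_val (d := d + (- (1)) * d')%cx); last by ring.
by apply: cdiff_ext (cdiff_add HF HH) => x /=; ring.
Qed.

(* Polarisation reduces products to squares. *)
Lemma cdiff_mul (F H : C -> C) (z d d' : C) :
  cdiff F z d -> cdiff H z d' ->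
  cdiff (fun x => F x * H x)%cx z (d * H z + F z * d')%cx.
Proof.
move=> HF HH.
have S := cdiff_comp (cdiff_add HF HH) (cdiff_sqr _).
have D := cdiff_comp (cdiff_sub HF HH) (cdiff_sqr _).
have Q := cdiff_scal (RtoC (/ 4)) (cdiff_sub S D).
apply: cdiff_val; first apply: cdiff_ext Q => x /=.
  by apply C_ext; cx_unfold; field.
by apply C_ext; cx_unfold; field.
Qed.

Lemma cdiff_inv (z : C) : z <> 0%cx -> cdiff Cinv z (- (Cinv (z * z)))%cx.
Proof.
move=> z0 e e0; have mz := Cmod_gt0 z0.
(* The remainder is [h * h / (z * z * (z + h))]; the first bound keeps [Cmod (z + h)] above
   [Cmod z / 2], the second makes the quotient small. *)
exists (Rmin (Cmod z / 2) (e * Cmod z ^ 3 / 2)); split.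
  apply: Rmin_pos; first lra.
  by apply: Rdiv_lt_0_compat; last lra; apply: Rmult_lt_0_compat => //; apply: pow_lt.
move=> h hh; have h0 := Cmod_ge0 h.
have h1 : Cmod h < Cmod z / 2 by apply: Rlt_le_trans hh (Rmin_l _ _).
have h2 : Cmod h < e * Cmod z ^ 3 / 2 by apply: Rlt_le_trans hh (Rmin_r _ _).
have zh : Cmod z / 2 <= Cmod (z + h)%cx.
  have := Cmod_le_sub z (z + h)%cx; have -> : (z - (z + h))%cx = (- h)%cx by ring.
  rewrite Cmod_opp; lra.
have zh0 : (z + h)%cx <> 0%cx by apply: Cmod_neq0; lra.
have -> : (Cinv (z + h) - Cinv z - - Cinv (z * z) * h)%cx
   = (h * h / (z * z * (z + h)))%cx by field.
rewrite Cmod_div; last first.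
  by apply: Cmod_neq0; rewrite !Cmod_mul; repeat apply: Rmult_lt_0_compat => //; lra.
rewrite !Cmod_mul.
have Zp : 0 < Cmod z * Cmod z * Cmod (z + h)%cx.
  by repeat apply: Rmult_lt_0_compat => //; lra.
apply/Rle_div_l => //.
have H1 : Cmod z * Cmod z * (Cmod z / 2) <= Cmod z * Cmod z * Cmod (z + h)%cx.
  by apply: Rmult_le_compat_l => //; apply: Rmult_le_pos; lra.
have H2 : Cmod h <= e * (Cmod z * Cmod z * Cmod (z + h)%cx).
  apply: (Rle_trans _ (e * (Cmod z * Cmod z * (Cmod z / 2)))); first by simpl in h2; lra.
  by apply: Rmult_le_compat_l => //; lra.
have := Rmult_le_compat_l _ _ _ h0 H2; lra.
Qed.

Lemma cdiff_div (F H : C -> C) (z d d' : C) : H z <> 0%cx ->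
  cdiff F z d -> cdiff H z d' ->
  cdiff (fun x => F x / H x)%cx z ((d * H z - F z * d') / (H z * H z))%cx.
Proof.
move=> H0 HF HH.
apply: cdiff_val; first exact: (cdiff_mul HF (cdiff_comp HH (cdiff_inv H0))).
by cbv beta; field.
Qed.

Lemma is_derive_eps (f : R -> R) (t l : R) :
  (forall eps, 0 < eps -> exists delta, 0 < delta /\ forall s, Rabs (s - t) < delta ->
     Rabs (f s - f t - l * (s - t)) <= eps * Rabs (s - t)) -> is_derive f t l.
Proof.
move=> H; apply is_derive_Reals => e e0.
case: (H (e / 2)) => [|d [d0 Hd]]; first lra.
exists (mkposreal d d0) => h hn hh /=.
have := Hd (t + h); have -> : t + h - t = h by ring.
move=> /(_ hh) K.
have -> : (f (t + h) - f t) / h - l = (f (t + h) - f t - l * h) / h by field.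
rewrite Rabs_div //; apply/Rlt_div_l; have := Rabs_pos_lt _ hn; first lra.
nra.
Qed.

Lemma is_derive_continuity_pt (f : R -> R) (t l : R) : is_derive f t l -> continuity_pt f t.
Proof. by move/is_derive_Reals => H; apply: derivable_continuous_pt; exists l. Qed.

Lemma cdiff_is_derive_fst (F : C -> C) (a b d : C) (t : R) :
  cdiff F (a + RtoC t * b)%cx d ->
  is_derive (fun s => fst (F (a + RtoC s * b)%cx)) t (fst (d * b)%cx).
Proof.
move=> HF; apply: is_derive_eps => e e0; have b0 := Cmod_ge0 b.
case: (HF (e / (Cmod b + 1))) => [|c [c0 Hc]]; first by apply: Rdiv_lt_0_compat => //; lra.
exists (c / (Cmod b + 1)); split; first by apply: Rdiv_lt_0_compat => //; lra.
move=> s hs; set h := (RtoC (s - t) * b)%cx.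
have hE : Cmod h = Rabs (s - t) * Cmod b by rewrite Cmod_mul Cmod_RtoC.
have st := Rabs_pos (s - t).
have hlt : Cmod h < c.
  have : (Cmod b + 1) * Rabs (s - t) < (Cmod b + 1) * (c / (Cmod b + 1)).
    by apply: Rmult_lt_compat_l => //; lra.
  have -> : (Cmod b + 1) * (c / (Cmod b + 1)) = c by field; lra.
  rewrite hE; lra.
have {}Hc := Hc h hlt.
have E : (a + RtoC t * b + h)%cx = (a + RtoC s * b)%cx by rewrite /h; cx_ring.
rewrite E in Hc.
have -> : fst (F (a + RtoC s * b)%cx) - fst (F (a + RtoC t * b)%cx) - fst (d * b)%cx * (s - t)
   = fst (F (a + RtoC s * b) - F (a + RtoC t * b) - d * h)%cx.
  by rewrite /h; cx_unfold; ring.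
apply: Rle_trans (Cmod_fst _) _; apply: Rle_trans Hc _; rewrite hE.
apply: (Rle_trans _ (e / (Cmod b + 1) * (Rabs (s - t) * (Cmod b + 1)))); last first.
  by apply: Req_le; field; lra.
apply: Rmult_le_compat_l; first by apply/Rlt_le/Rdiv_lt_0_compat => //; lra.
by apply: Rmult_le_compat_l => //; lra.
Qed.

(** The real mean value theorem is applied to the real part of [l * F] along the segment, for each
    unimodular [l]. *)
Lemma mean_value_ineq (F d : C -> C) (a b : C) (m : R) :
  (forall t, 0 <= t <= 1 -> cdiff F (a + RtoC t * b)%cx (d (a + RtoC t * b)%cx)) ->
  (forall t, 0 <= t <= 1 -> Cmod (d (a + RtoC t * b)%cx * b)%cx <= m) ->
  Cmod (F (a + b) - F a)%cx <= m.
Proof.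
move=> HF Hm; apply: Cmod_le_by_rotation => l l1.
case: (MVT_gen (fun t => fst (l * F (a + RtoC t * b))%cx) 0 1
         (fun t => fst (l * d (a + RtoC t * b) * b)%cx)).
- move=> t; rewrite Rmin_left ?Rmax_right; try lra; move=> tt.
  by apply: (cdiff_is_derive_fst (F := fun x => (l * F x)%cx)); apply: cdiff_scal; apply: HF; lra.
- move=> t; rewrite Rmin_left ?Rmax_right; try lra; move=> tt.
  apply: is_derive_continuity_pt. apply: (cdiff_is_derive_fst (F := fun x => (l * F x)%cx)); apply: cdiff_scal; exact: HF.
move=> t; rewrite Rmin_left ?Rmax_right; try lra; move=> [tt].
have -> : (a + RtoC 1 * b)%cx = (a + b)%cx by cx_ring.
have -> : (a + RtoC 0 * b)%cx = a by cx_ring.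
move=> E.
have -> : fst (l * (F (a + b) - F a))%cx = fst (l * d (a + RtoC t * b) * b)%cx.
  by move: E => /=; lra.
apply: Rle_trans (Rle_abs _) _; apply: Rle_trans (Cmod_fst _) _.
have -> : (l * d (a + RtoC t * b) * b)%cx = (l * (d (a + RtoC t * b) * b))%cx by ring.
rewrite Cmod_mul l1 Rmult_1_l; exact: Hm.
Qed.

(** * Goursat's lemma and circle means *)

Lemma nested_intervals (u v : nat -> R) :
  (forall k, u k <= u (S k)) -> (forall k, v (S k) <= v k) -> (forall k, u k <= v k) ->
  exists x, forall k, u k <= x <= v k.
Proof.
move=> Hu Hv Huv.
have mu : forall k j, u k <= u (k + j)%coq_nat.
  by move=> k; elim=> [|j IH]; rewrite ?Nat.add_0_r ?Nat.add_succ_r; [lra | have := Hu (k + j)%coq_nat; lra].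
have mv : forall k j, v (k + j)%coq_nat <= v k.
  by move=> k; elim=> [|j IH]; rewrite ?Nat.add_0_r ?Nat.add_succ_r; [lra | have := Hv (k + j)%coq_nat; lra].
have uv : forall k j, u k <= v j.
  move=> k j; have := mu k j; have := mv j k; have := Huv (k + j)%coq_nat.
  by rewrite (Nat.add_comm j k); lra.
case: (completeness (fun r => exists k, r = u k)).
- by exists (v O) => r [k ->].
- by exists (u O), O.
move=> x [Hx1 Hx2]; exists x => k; split; first by apply: Hx1; exists k.
by apply: Hx2 => r [j ->].
Qed.

(** A bad rectangle has a bad quarter. The nested bad quarters shrink to a point, near which local
    goodness contradicts badness. *)
Lemma rectangle_bisection (Good : R -> R -> R -> R -> Prop) (a b c d : R) :
  a <= b -> c <= d ->
  (forall a' b' c' d', a' <= b' -> c' <= d' ->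
     let x := (a' + b') / 2 in let y := (c' + d') / 2 in
     Good a' x c' y -> Good x b' c' y -> Good a' x y d' -> Good x b' y d' ->
     Good a' b' c' d') ->
  (forall x y, a <= x <= b -> c <= y <= d -> exists delta, 0 < delta /\
     forall a' b' c' d', a' <= x <= b' -> c' <= y <= d' ->
       b' - a' < delta -> d' - c' < delta -> Good a' b' c' d') ->
  Good a b c d.
Proof.
move=> ab cd Hsub Hloc; apply: NNPP => Hbad.
pose rect := (R * R * (R * R))%type.
pose good (r : rect) := Good r.1.1 r.1.2 r.2.1 r.2.2.
pose ok (r : rect) := r.1.1 <= r.1.2 /\ r.2.1 <= r.2.2.
pose half (r r' : rect) := r.1.1 <= r'.1.1 /\ r'.1.2 <= r.1.2 /\ r.2.1 <= r'.2.1 /\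
  r'.2.2 <= r.2.2 /\ r'.1.2 - r'.1.1 = (r.1.2 - r.1.1) / 2 /\
  r'.2.2 - r'.2.1 = (r.2.2 - r.2.1) / 2.
have step : forall r : rect, ok r -> ~ good r -> exists r', half r r' /\ ok r' /\ ~ good r'.
  move=> [[a' b'] [c' d']] [/= ok1 ok2] bad; apply: NNPP => H; apply: bad.
  have K : forall r', half ((a', b'), (c', d')) r' -> ok r' -> good r'.
    by move=> r' h1 h2; apply: NNPP => h3; apply: H; exists r'.
  apply: Hsub => //.
  - by apply: (K ((a', (a' + b') / 2), (c', (c' + d') / 2))); rewrite /half /ok /=; lra.
  - by apply: (K (((a' + b') / 2, b'), (c', (c' + d') / 2))); rewrite /half /ok /=; lra.
  - by apply: (K ((a', (a' + b') / 2), ((c' + d') / 2, d'))); rewrite /half /ok /=; lra.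
  - by apply: (K (((a' + b') / 2, b'), ((c' + d') / 2, d'))); rewrite /half /ok /=; lra.
(* A bad quarter is selected by choice; on good rectangles the value is arbitrary. *)
pose next (r : rect) : rect :=
  epsilon (inhabits r) (fun r' => half r r' /\ ok r' /\ ~ good r').
have nextP : forall r, ok r -> ~ good r -> half r (next r) /\ ok (next r) /\ ~ good (next r).
  by move=> r h1 h2; exact: (epsilon_spec (inhabits r) _ (step r h1 h2)).
pose s := fix s (k : nat) : rect := match k with O => ((a, b), (c, d)) | S k => next (s k) end.
have sP : forall k, ok (s k) /\ ~ good (s k).
  by elim=> [//|k [h1 h2]]; have := nextP _ h1 h2; tauto.
have sH : forall k, half (s k) (s (S k)).
  by move=> k; have [h1 h2] := sP k; have := nextP _ h1 h2; tauto.
have len : forall k, (s k).1.2 - (s k).1.1 = (b - a) * (/ 2) ^ k /\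
                     (s k).2.2 - (s k).2.1 = (d - c) * (/ 2) ^ k.
  elim=> [|k [h1 h2]]; first by rewrite /=; lra.
  by have [_ [_ [_ [_ [-> ->]]]]] := sH k; rewrite h1 h2 /=; lra.
case: (@nested_intervals (fun k => (s k).1.1) (fun k => (s k).1.2)).
- by move=> k; have := sH k; rewrite /half; lra.
- by move=> k; have := sH k; rewrite /half; lra.
- by move=> k; have [[]] := sP k; lra.
move=> x Hx.
case: (@nested_intervals (fun k => (s k).2.1) (fun k => (s k).2.2)).
- by move=> k; have := sH k; rewrite /half; lra.
- by move=> k; have := sH k; rewrite /half; lra.
- by move=> k; have [[]] := sP k; lra.
move=> y Hy.
case: (Hloc x y (Hx O) (Hy O)) => delta [d0 Hd].
case: (@pow_lt_1_zero (/ 2) _ (delta / ((b - a) + (d - c) + 1))).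
- by rewrite Rabs_pos_eq; lra.
- by apply: Rdiv_lt_0_compat => //; lra.
move=> N /(_ N (le_n _)); rewrite Rabs_pos_eq; last by apply: pow_le; lra.
move=> hN.
have {}hN : (/ 2) ^ N * ((b - a) + (d - c) + 1) < delta.
  by apply/Rlt_div_r => //; lra.
have hp : 0 < (/ 2) ^ N by apply: pow_lt; lra.
have [l1 l2] := len N.
have [_ bad] := sP N; apply: bad; apply: Hd => //; rewrite ?l1 ?l2; nra.
Qed.

Lemma differentiable_pt_lim_near (f : R -> R -> R) (x y lx ly eta : R) :
  differentiable_pt_lim f x y lx ly -> 0 < eta ->
  exists delta, 0 < delta /\ forall a b c d u v, a <= x <= b -> c <= y <= d ->
    b - a < delta -> d - c < delta -> a <= u <= b -> c <= v <= d ->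
    Rabs (f u v - f x y - (lx * (u - x) + ly * (v - y))) <= eta * ((b - a) + (d - c)).
Proof.
move=> H e0; case: (H (mkposreal eta e0)) => [[delta d0] /= Hd].
exists delta; split=> // a b c d u v hx hy h1 h2 hu hv.
have hux : Rabs (u - x) <= b - a by apply: Rabs_le; lra.
have hvy : Rabs (v - y) <= d - c by apply: Rabs_le; lra.
apply: Rle_trans (Hd u v _ _) _; try lra.
apply: Rmult_le_compat_l; first lra.
by apply: Rmax_lub; lra.
Qed.

Lemma differentiable_pt_lim_continuous_l (f : R -> R -> R) (x y lx ly : R) :
  differentiable_pt_lim f x y lx ly -> continuous (fun u => f u y) x.
Proof.
move=> H; apply continuity_pt_filterlim; apply: derivable_continuous_pt; exists (lx * 1 + ly * 0).
apply: (@derivable_pt_lim_comp_2d f (fun u => u) (fun _ => y)); first exact: H.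
  exact: derivable_pt_lim_id.
exact: derivable_pt_lim_const.
Qed.

Lemma differentiable_pt_lim_continuous_r (f : R -> R -> R) (x y lx ly : R) :
  differentiable_pt_lim f x y lx ly -> continuous (fun v => f x v) y.
Proof.
move=> H; apply continuity_pt_filterlim; apply: derivable_continuous_pt; exists (lx * 0 + ly * 1).
apply: (@derivable_pt_lim_comp_2d f (fun _ => x) (fun v => v)); first exact: H.
  exact: derivable_pt_lim_const.
exact: derivable_pt_lim_id.
Qed.

(** The integral of [P dx + Q dy] counterclockwise around the boundary of the rectangle. *)
Definition circulation (P Q : R -> R -> R) (a b c d : R) : R :=
  RInt (fun u => P u c) a b + RInt (fun v => Q b v) c d
  - RInt (fun u => P u d) a b - RInt (fun v => Q a v) c d.

Lemma RInt_near_const (f : R -> R) (a b m e : R) : a <= b -> ex_RInt f a b ->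
  (forall t, a <= t <= b -> Rabs (f t - m) <= e) ->
  Rabs (RInt f a b - m * (b - a)) <= (b - a) * e.
Proof.
move=> ab Hf H.
have -> : RInt f a b - m * (b - a) = RInt (fun t => minus (f t) m) a b.
  rewrite RInt_minus // ?RInt_const; last exact: ex_RInt_const.
  by rewrite /minus /plus /opp /scal /= /mult /=; ring.
apply: abs_RInt_le_const => //.
by apply: ex_RInt_minus => //; apply: ex_RInt_const.
Qed.

(* Only differentiability at each point is assumed, so Green's formula is not available:
   Goursat's bisection replaces it. *)
Lemma goursat_rectangle (P Q : R -> R -> R) (a b c d : R) : a <= b -> c <= d ->
  (forall x y, a <= x <= b -> c <= y <= d -> exists px m qy,
     differentiable_pt_lim P x y px m /\ differentiable_pt_lim Q x y m qy) ->
  circulation P Q a b c d = 0.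
Proof.
move=> ab cd H.
have xP : forall a' b' y, a <= a' -> a' <= b' -> b' <= b -> c <= y <= d ->
    ex_RInt (fun u => P u y) a' b'.
  move=> a' b' y h1 h2 h3 hy; apply: ex_RInt_continuous => x.
  rewrite Rmin_left ?Rmax_right // => hx.
  case: (H x y) => [||px [m [qy [HP _]]]] //; first lra.
  exact: differentiable_pt_lim_continuous_l HP.
have xQ : forall c' d' x, c <= c' -> c' <= d' -> d' <= d -> a <= x <= b ->
    ex_RInt (fun v => Q x v) c' d'.
  move=> c' d' x h1 h2 h3 hx; apply: ex_RInt_continuous => y.
  rewrite Rmin_left ?Rmax_right // => hy.
  case: (H x y) => [||px [m [qy [_ HQ]]]] //; first lra.
  exact: differentiable_pt_lim_continuous_r HQ.
suff K : forall e, 0 < e -> Rabs (circulation P Q a b c d) <= e * ((b - a) + (d - c)) ^ 2.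
  apply: NNPP => N; have L := Rabs_pos_lt _ N.
  set z := Rabs _ in K L; set l := ((b - a) + (d - c)) ^ 2 in K.
  have l0 : 0 <= l by apply: pow2_ge_0.
  have := K (z / (2 * (l + 1))); case; first by apply: Rdiv_lt_0_compat; lra.
    move=> h; have : z < z / (2 * (l + 1)) * (l + 1).
      apply: Rlt_le_trans h _; apply: Rmult_le_compat_l; last lra.
      by apply/Rlt_le/Rdiv_lt_0_compat; lra.
    have -> : z / (2 * (l + 1)) * (l + 1) = z / 2 by field; lra.
    lra.
  move=> h; have : z <= z / (2 * (l + 1)) * (l + 1).
    rewrite {1}h; apply: Rmult_le_compat_l; last lra.
    by apply/Rlt_le/Rdiv_lt_0_compat; lra.
  have -> : z / (2 * (l + 1)) * (l + 1) = z / 2 by field; lra.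
  lra.
move=> e e0.
(* A bound quadratic in the side lengths survives bisection: each quarter has half the side sum,
   hence a quarter of the bound, and the circulations of the quarters add up. *)
pose Good a' b' c' d' := a <= a' -> b' <= b -> c <= c' -> d' <= d ->
  Rabs (circulation P Q a' b' c' d') <= e * ((b' - a') + (d' - c')) ^ 2.
suff : Good a b c d by apply; lra.
apply: rectangle_bisection => //.
- move=> a' b' c' d' h1 h2 x y; rewrite /Good => G1 G2 G3 G4 k1 k2 k3 k4.
  have hx : a' <= x <= b' by rewrite /x; lra.
  have hy : c' <= y <= d' by rewrite /y; lra.
  have CP : forall v, c <= v <= d -> RInt (fun u => P u v) a' b' =
      RInt (fun u => P u v) a' x + RInt (fun u => P u v) x b'.
    by move=> v hv; rewrite -(RInt_Chasles _ a' x b') //; apply: xP; lra.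
  have CQ : forall u, a <= u <= b -> RInt (fun v => Q u v) c' d' =
      RInt (fun v => Q u v) c' y + RInt (fun v => Q u v) y d'.
    by move=> u hu; rewrite -(RInt_Chasles _ c' y d') //; apply: xQ; lra.
  have -> : circulation P Q a' b' c' d' =
     circulation P Q a' x c' y + circulation P Q x b' c' y
     + circulation P Q a' x y d' + circulation P Q x b' y d'.
    by rewrite /circulation !CP ?CQ; try lra; ring.
  have {}G1 := G1 ltac:(lra) ltac:(lra) ltac:(lra) ltac:(lra).
  have {}G2 := G2 ltac:(lra) ltac:(lra) ltac:(lra) ltac:(lra).
  have {}G3 := G3 ltac:(lra) ltac:(lra) ltac:(lra) ltac:(lra).
  have {}G4 := G4 ltac:(lra) ltac:(lra) ltac:(lra) ltac:(lra).
  have E : forall l, e * (l / 2) ^ 2 = e * l ^ 2 / 4 by move=> l; field.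
  have e1 : x - a' = (b' - a') / 2 by rewrite /x; field.
  have e2 : b' - x = (b' - a') / 2 by rewrite /x; field.
  have e3 : y - c' = (d' - c') / 2 by rewrite /y; field.
  have e4 : d' - y = (d' - c') / 2 by rewrite /y; field.
  have e5 : (b' - a') / 2 + (d' - c') / 2 = ((b' - a') + (d' - c')) / 2 by field.
  rewrite e1 e3 e5 E in G1; rewrite e2 e3 e5 E in G2; rewrite e1 e4 e5 E in G3; rewrite e2 e4 e5 E in G4.
  apply: Rle_trans (Rabs_triang _ _) _.
  have := Rabs_triang (circulation P Q a' x c' y + circulation P Q x b' c' y) (circulation P Q a' x y d').
  have := Rabs_triang (circulation P Q a' x c' y) (circulation P Q x b' c' y).
  lra.
(* The two cross partial derivatives are both [m], so the linear parts of [P] and [Q] contribute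
   opposite amounts. Only the differentiability errors remain, one [e / 2] for each of the two
   facing sides. *)
- move=> x y hx hy; case: (H x y hx hy) => px [m [qy [HP HQ]]].
  case: (differentiable_pt_lim_near (eta := e / 2) HP) => [|d1 [d10 H1]]; first lra.
  case: (differentiable_pt_lim_near (eta := e / 2) HQ) => [|d2 [d20 H2]]; first lra.
  exists (Rmin d1 d2); split; first exact: Rmin_pos.
  move=> a' b' c' d' kx ky s1 s2; rewrite /Good => k1 k2 k3 k4.
  have := Rmin_l d1 d2; have := Rmin_r d1 d2 => r2 r1.
  have E1 : RInt (fun u => P u c' - P u d') a' b' =
     RInt (fun u => P u c') a' b' - RInt (fun u => P u d') a' b'.
    by apply: (RInt_minus (V := R_CompleteNormedModule)); apply: xP; lra.
  have E2 : RInt (fun v => Q b' v - Q a' v) c' d' =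
     RInt (fun v => Q b' v) c' d' - RInt (fun v => Q a' v) c' d'.
    by apply: (RInt_minus (V := R_CompleteNormedModule)); apply: xQ; lra.
  set L := (b' - a') + (d' - c').
  have B1 : Rabs (RInt (fun u => P u c' - P u d') a' b' - m * (c' - d') * (b' - a')) <= (b' - a') * (e * L).
    apply: RInt_near_const; first lra.
      by apply: (ex_RInt_minus (V := R_NormedModule)); apply: xP; lra.
    move=> t ht.
    have := H1 a' b' c' d' t c' kx ky ltac:(lra) ltac:(lra) ht ltac:(lra).
    have := H1 a' b' c' d' t d' kx ky ltac:(lra) ltac:(lra) ht ltac:(lra).
    rewrite -/L; set A := P t c'; set B := P t d'; set D := P x y => K2 K1.
    have -> : A - B - m * (c' - d') = (A - D - (px * (t - x) + m * (c' - y)))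
       - (B - D - (px * (t - x) + m * (d' - y))) by ring.
    apply: Rle_trans (Rabs_triang _ _) _; rewrite Rabs_Ropp; lra.
  have B2 : Rabs (RInt (fun v => Q b' v - Q a' v) c' d' - m * (b' - a') * (d' - c')) <= (d' - c') * (e * L).
    apply: RInt_near_const; first lra.
      by apply: (ex_RInt_minus (V := R_NormedModule)); apply: xQ; lra.
    move=> t ht.
    have := H2 a' b' c' d' b' t kx ky ltac:(lra) ltac:(lra) ltac:(lra) ht.
    have := H2 a' b' c' d' a' t kx ky ltac:(lra) ltac:(lra) ltac:(lra) ht.
    rewrite -/L; set A := Q b' t; set B := Q a' t; set D := Q x y => K2 K1.
    have -> : A - B - m * (b' - a') = (A - D - (m * (b' - x) + qy * (t - y)))
       - (B - D - (m * (a' - x) + qy * (t - y))) by ring.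
    apply: Rle_trans (Rabs_triang _ _) _; rewrite Rabs_Ropp; lra.
  rewrite E1 in B1; rewrite E2 in B2; rewrite /circulation.
  set I1 := RInt (fun u => P u c') a' b' in B1 *; set I2 := RInt (fun u => P u d') a' b' in B1 *.
  set I3 := RInt (fun v => Q b' v) c' d' in B2 *; set I4 := RInt (fun v => Q a' v) c' d' in B2 *.
  have -> : I1 + I3 - I2 - I4 = (I1 - I2 - m * (c' - d') * (b' - a')) + (I3 - I4 - m * (b' - a') * (d' - c')) by ring.
  apply: Rle_trans (Rabs_triang _ _) _.
  have -> : e * L ^ 2 = (b' - a') * (e * L) + (d' - c') * (e * L) by rewrite /L; ring.
  lra.
Qed.

Lemma differentiable_pt_lim_val (f : R -> R -> R) (x y lx ly lx' ly' : R) :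
  differentiable_pt_lim f x y lx ly -> lx = lx' -> ly = ly' ->
  differentiable_pt_lim f x y lx' ly'.
Proof. by move=> H <- <-. Qed.

Lemma differentiable_pt_lim_snd (f : R -> R) (x y l : R) :
  derivable_pt_lim f y l -> differentiable_pt_lim (fun _ v => f v) x y 0 l.
Proof.
move=> /(@differentiable_pt_lim_proj1_0 f y x l) H e; case: (H e) => d Hd.
exists d => u v hu hv; have := Hd v u hv hu; rewrite Rmax_comm.
by have -> : l * (v - y) + 0 * (u - x) = 0 * (u - x) + l * (v - y) by ring.
Qed.

Lemma differentiable_pt_lim_mult (x y : R) :
  differentiable_pt_lim (fun u v => u * v) x y y x.
Proof.
move=> [e e0]; exists (mkposreal e e0) => u v /= hu hv.
have -> : u * v - x * y - (y * (u - x) + x * (v - y)) = (u - x) * (v - y) by ring.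
rewrite Rabs_mult.
have h1 := Rmax_l (Rabs (u - x)) (Rabs (v - y)); have h2 := Rmax_r (Rabs (u - x)) (Rabs (v - y)).
have := Rabs_pos (u - x); have := Rabs_pos (v - y); nra.
Qed.

(** The Cauchy-Riemann equations: multiplication by [p + i q] has real part [p du - q dv]. *)
Lemma cdiff_differentiable_fst (k : C -> C) (x y p q : R) :
  cdiff k (x, y) (p, q) -> differentiable_pt_lim (fun u v => fst (k (u, v))) x y p (- q).
Proof.
move=> H [e e0]; case: (H (e / 2)) => [|d [d0 Hd]]; first lra.
have d2 : 0 < d / 2 by lra.
exists (mkposreal _ d2) => u v /= hu hv.
have := Hd (u - x, v - y).
have -> : ((x, y) + (u - x, v - y)%R)%cx = (u, v) by cx_unfold; f_equal; ring.
have hm : Cmod (u - x, v - y) <= 2 * Rmax (Rabs (u - x)) (Rabs (v - y)).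
  apply: Rle_trans (Cmod_le_fst_snd _) _ => /=.
  have := Rmax_l (Rabs (u - x)) (Rabs (v - y)); have := Rmax_r (Rabs (u - x)) (Rabs (v - y)); lra.
have hm2 : Cmod (u - x, v - y) < d by apply: Rle_lt_trans (Cmod_le_fst_snd _) _ => /=; lra.
move=> /(_ hm2) K.
have -> : fst (k (u, v)) - fst (k (x, y)) - (p * (u - x) + - q * (v - y))
  = fst (k (u, v) - k (x, y) - (p, q) * (u - x, v - y)%R)%cx by cx_unfold; ring.
apply: Rle_trans (Cmod_fst _) _; nra.
Qed.

(** Multiplication by [-i] turns the imaginary part into a real part. *)
Lemma cdiff_differentiable_snd (k : C -> C) (x y p q : R) :
  cdiff k (x, y) (p, q) -> differentiable_pt_lim (fun u v => snd (k (u, v))) x y q p.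
Proof.
move=> H; have := @cdiff_differentiable_fst (fun z => ((0, -1)%R * k z)%cx) x y q (- p).
rewrite Ropp_involutive => K.
apply: (@differentiable_pt_lim_ext (fun u v => fst ((0, -1)%R * k (u, v))%cx)).
  by exists (mkposreal 1 Rlt_0_1) => u v _ _; cx_unfold; ring.
by apply: K; apply: cdiff_val (cdiff_scal _ H) _; cx_unfold; f_equal; ring.
Qed.

Definition cis (t : R) : C := (cos t, sin t).

Lemma Cmod_cis (t : R) : Cmod (cis t) = 1.
Proof.
rewrite /Cmod /Cnorm2 /cis /=; have := sin2_cos2 t; rewrite /Rsqr => H.
have -> : cos t * (cos t * 1) + sin t * (sin t * 1) = 1 by lra.
exact: sqrt_1.
Qed.

Lemma Cmod_circle (r t : R) : 0 <= r -> Cmod (RtoC r * cis t)%cx = r.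
Proof. by move=> r0; rewrite Cmod_mul Cmod_cis Cmod_RtoC Rabs_pos_eq //; ring. Qed.

Section CircleMean.
Variables (k : C -> C) (L : C) (rho : R).
Hypothesis k_diff : forall z, 0 < Cmod z < rho -> exists d, cdiff k z d.
Hypothesis k_lim : forall e, 0 < e -> exists delta, 0 < delta /\
  forall z, 0 < Cmod z < delta -> Cmod (k z - L)%cx <= e.

(** Logarithmic polar coordinates [z = exp (s + i t)]. The form [V ds + U dt] is the imaginary part
    of [k z dz / z], and its closedness is a Cauchy-Riemann equation. *)
Let U s t := fst (k (exp s * cos t, exp s * sin t)).
Let V s t := snd (k (exp s * cos t, exp s * sin t)).

Lemma polar_closed (s t : R) : exp s < rho -> exists vs m ut,
  differentiable_pt_lim V s t vs m /\ differentiable_pt_lim U s t m ut.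
Proof.
move=> hs.
have Ez : (exp s * cos t, exp s * sin t) = (RtoC (exp s) * cis t)%cx by rewrite /cis; cx_unfold; f_equal; ring.
have [[p q] Hd] : exists d, cdiff k (exp s * cos t, exp s * sin t) d.
  by apply: k_diff; rewrite Ez Cmod_circle; have := exp_pos s; lra.
have DU := cdiff_differentiable_fst Hd; have DV := cdiff_differentiable_snd Hd.
have De : differentiable_pt_lim (fun u _ => exp u) s t (exp s) 0.
  by apply: differentiable_pt_lim_proj1_0; apply: derivable_pt_lim_exp.
have Dc : differentiable_pt_lim (fun u v => exp u * cos v) s t (exp s * cos t) (- (exp s * sin t)).
  apply: differentiable_pt_lim_val.
    apply: (@differentiable_pt_lim_comp (fun a b => a * b) (fun u _ => exp u) (fun _ v => cos v));
      [exact: differentiable_pt_lim_mult | exact: De |].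
    by apply: differentiable_pt_lim_snd; apply: derivable_pt_lim_cos.
  - by ring.
  - by ring.
have Ds : differentiable_pt_lim (fun u v => exp u * sin v) s t (exp s * sin t) (exp s * cos t).
  apply: differentiable_pt_lim_val.
    apply: (@differentiable_pt_lim_comp (fun a b => a * b) (fun u _ => exp u) (fun _ v => sin v));
      [exact: differentiable_pt_lim_mult | exact: De |].
    by apply: differentiable_pt_lim_snd; apply: derivable_pt_lim_sin.
  - by ring.
  - by ring.
have HU := @differentiable_pt_lim_comp _ _ _ _ _ _ _ _ _ _ _ DU Dc Ds.
have HV := @differentiable_pt_lim_comp _ _ _ _ _ _ _ _ _ _ _ DV Dc Ds.
eexists; exists (p * (exp s * cos t) - q * (exp s * sin t)); eexists; split.
  by apply: differentiable_pt_lim_val HV _ _; [reflexivity | ring].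
by apply: differentiable_pt_lim_val HU _ _; [ring | reflexivity].
Qed.

(** The circulation around the rectangle vanishes, and its sides [t = 0] and [t = 2 PI] cancel by
    periodicity; the other two sides are the means on the two circles. *)
Lemma polar_mean_const (s s' : R) : s <= s' -> exp s' < rho ->
  RInt (U s) 0 (2 * PI) = RInt (U s') 0 (2 * PI).
Proof.
move=> ss hs; have pi0 := PI_RGT_0.
have : circulation V U s s' 0 (2 * PI) = 0.
  apply: goursat_rectangle => //; first lra.
  move=> x y hx hy; apply: polar_closed; apply: Rle_lt_trans hs.
  by case: (proj2 hx) => [/exp_increasing|->]; lra.
rewrite /circulation.
have -> : (fun u => V u (2 * PI)) = (fun u => V u 0).
  by apply: functional_extensionality => u; rewrite /V cos_2PI sin_2PI cos_0 sin_0.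
by rewrite -/(U s) -/(U s'); lra.
Qed.

Lemma polar_ex_RInt (s : R) : exp s < rho -> ex_RInt (U s) 0 (2 * PI).
Proof.
move=> hs; apply: ex_RInt_continuous => t _.
case: (@polar_closed s t hs) => vs [m [ut [_ H]]].
exact: differentiable_pt_lim_continuous_r H.
Qed.

(** At the origin only a limit is asked for, so that difference quotients qualify. The mean does not
    depend on the radius and approaches the value given by [L] on small circles. *)
Lemma circle_mean (r : R) : 0 < r < rho ->
  is_RInt (fun t => fst (k (RtoC r * cis t)%cx)) 0 (2 * PI) (2 * PI * fst L).
Proof.
move=> hr; have pi0 := PI_RGT_0.
have Er : exp (ln r) = r by apply: exp_ln; lra.
have UE : forall s, U s = fun t => fst (k (RtoC (exp s) * cis t)%cx).
  move=> s; apply: functional_extensionality => t; rewrite /U; do 2 f_equal.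
  by apply C_ext; cx_unfold; ring.
have -> : (fun t => fst (k (RtoC r * cis t)%cx)) = U (ln r) by rewrite UE Er.
have X : exp (ln r) < rho by lra.
suff <- : RInt (U (ln r)) 0 (2 * PI) = 2 * PI * fst L.
  by apply: RInt_correct; apply: polar_ex_RInt.
apply: Rminus_diag_uniq; apply: NNPP => N; have {N} N0 := Rabs_pos_lt _ N.
set z := Rabs _ in N0.
(* Integrated over a length [2 PI], this error is half of the supposed discrepancy [z]. *)
case: (k_lim (e := z / (4 * PI))) => [|delta [d0 Hd]]; first by apply: Rdiv_lt_0_compat; lra.
pose s := ln (Rmin r (delta / 2)).
have hm : 0 < Rmin r (delta / 2) by apply: Rmin_pos; lra.
have Es : exp s = Rmin r (delta / 2) by apply: exp_ln.
have sr : s <= ln r.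
  by rewrite /s; case: (Rmin_l r (delta / 2)) => [/(ln_increasing _ _ hm)|->]; lra.
have := polar_mean_const sr X => E.
have sX : exp s < rho by rewrite Es; have := Rmin_l r (delta / 2); lra.
have : Rabs (RInt (U s) 0 (2 * PI) - fst L * (2 * PI - 0)) <= (2 * PI - 0) * (z / (4 * PI)).
  apply: RInt_near_const; [lra | exact: polar_ex_RInt | move=> t _].
  rewrite UE.
  have -> : fst (k (RtoC (exp s) * cis t)%cx) - fst L = fst (k (RtoC (exp s) * cis t) - L)%cx by cx_unfold; ring.
  apply: Rle_trans (Cmod_fst _) _; apply: Hd; rewrite Cmod_circle; last by have := exp_pos s; lra.
  by rewrite Es; have := Rmin_r r (delta / 2); lra.
have -> : (2 * PI - 0) * (z / (4 * PI)) = z / 2 by field; lra.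
rewrite E; have -> : fst L * (2 * PI - 0) = 2 * PI * fst L by ring.
rewrite -/z; lra.
Qed.

End CircleMean.

(** * Cauchy's estimate for the derivative *)

Lemma cdiff_continuous (F : C -> C) (z d : C) : cdiff F z d ->
  forall e, 0 < e -> exists delta, 0 < delta /\
    forall x, Cmod (x - z)%cx < delta -> Cmod (F x - F z)%cx <= e.
Proof.
move=> H e e0; case: (cdiff_lipschitz H) => a [a0 Ha]; have dp := Cmod_ge0 d.
exists (Rmin a (e / (Cmod d + 1))); split.
  by apply: Rmin_pos => //; apply: Rdiv_lt_0_compat; lra.
move=> x hx; have h1 := Rlt_le_trans _ _ _ hx (Rmin_l _ _); have h2 := Rlt_le_trans _ _ _ hx (Rmin_r _ _).
have := Ha _ h1; have -> : (z + (x - z))%cx = x by ring.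
move=> h; apply: Rle_trans h _; rewrite Rmult_comm; apply/Rle_div_r; lra.
Qed.

Lemma cdiff_quotient_lim (F : C -> C) (d : C) : cdiff F 0 d ->
  forall e, 0 < e -> exists delta, 0 < delta /\
    forall z, 0 < Cmod z < delta -> Cmod ((F z - F 0) / z - d)%cx <= e.
Proof.
move=> H e e0; case: (H e e0) => a [a0 Ha]; exists a; split=> // z [z0 za].
have := Ha z za; have -> : (0 + z)%cx = z by ring.
have zn := Cmod_neq0 z0.
have -> : ((F z - F 0) / z - d)%cx = ((F z - F 0 - d * z) / z)%cx by field.
by rewrite Cmod_div // => h; apply/Rle_div_l.
Qed.

Lemma cdiff_quotient (F : C -> C) (d z : C) : cdiff F z d -> z <> 0%cx ->
  exists d', cdiff (fun x => (F x - F 0) / x)%cx z d'.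
Proof.
move=> H z0; eexists; apply: cdiff_div => //; last exact: cdiff_id.
by apply: cdiff_sub H (cdiff_const _ _).
Qed.

(** The derivative is the circle mean of the difference quotient at the origin. On the circle of
    radius [rho / 2], which lies inside the open disc, this quotient is at most [2 m / (rho / 2)];
    hence the factor 4. *)
Lemma cauchy_estimate (F : C -> C) (d : C) (rho m : R) : 0 < rho ->
  (forall z, Cmod z < rho -> exists d', cdiff F z d') -> cdiff F 0 d ->
  (forall z, Cmod z < rho -> Cmod (F z) <= m) ->
  Cmod d <= 4 * m / rho.
Proof.
move=> r0 HF H0 Hm; have pi0 := PI_RGT_0.
have F0 : Cmod (F 0%cx) <= m by apply: Hm; rewrite Cmod0.
apply: Cmod_le_by_rotation => l l1.
pose k := fun z => (l * ((F z - F 0) / z))%cx.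
have I : is_RInt (fun t => fst (k (RtoC (rho / 2) * cis t)%cx)) 0 (2 * PI) (2 * PI * fst (l * d)%cx).
  apply: (@circle_mean k (l * d)%cx rho); last lra.
  - move=> z [z1 z2]; case: (HF z z2) => d' Hd'.
    case: (cdiff_quotient Hd' (Cmod_neq0 z1)) => d2 Hd2; exists (l * d2)%cx; exact: cdiff_scal.
  - move=> e e0; case: (cdiff_quotient_lim H0 e0) => a [a0 Ha]; exists a; split=> // z hz.
    have -> : (k z - l * d)%cx = (l * ((F z - F 0) / z - d))%cx by rewrite /k; ring.
    by rewrite Cmod_mul l1 Rmult_1_l; apply: Ha.
have J : is_RInt (fun _ : R => 4 * m / rho) 0 (2 * PI) (2 * PI * (4 * m / rho)).
  have -> : 2 * PI * (4 * m / rho) = scal (2 * PI - 0) (4 * m / rho) by rewrite /scal /= /mult /=; ring.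
  exact: is_RInt_const.
have := is_RInt_le _ _ _ _ _ _ _ I J => K.
suff : 2 * PI * fst (l * d)%cx <= 2 * PI * (4 * m / rho) by nra.
apply: K; first lra.
move=> t _; apply: Rle_trans (Rle_abs _) _; apply: Rle_trans (Cmod_fst _) _.
have cz : Cmod (RtoC (rho / 2) * cis t)%cx = rho / 2 by apply: Cmod_circle; lra.
rewrite /k Cmod_mul l1 Rmult_1_l Cmod_div; last by apply: Cmod_neq0; lra.
rewrite cz; apply/Rle_div_l; first lra.
have -> : 4 * m / rho * (rho / 2) = m + m by field; lra.
by apply: Rle_trans (Cmod_sub _ _) _; apply: Rplus_le_compat => //; apply: Hm; lra.
Qed.

(** * Holomorphic functions with nonnegative real part *)

(* The two added terms are holomorphic and vanish at [0], so they do not change the circle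
   mean, but they turn the real part of the difference quotient into a multiple of [Re F]. *)
Lemma caratheodory_estimate (F : C -> C) (d : C) :
  (forall z, Cmod z < 1 -> exists d', cdiff F z d') -> cdiff F 0 d ->
  (forall z, Cmod z < 1 -> 0 <= fst (F z)) ->
  Cmod d <= 2 * fst (F 0%cx).
Proof.
move=> HF H0 Hp; have pi0 := PI_RGT_0.
apply: Cmod_le_by_rotation => l l1.
suff K : forall r, 0 < r < 1 -> r * fst (l * d)%cx <= 2 * fst (F 0%cx).
  apply: Rnot_lt_le => N.
  have p0 : 0 <= fst (F 0%cx) by apply: Hp; rewrite Cmod0; lra.
  set x := fst (l * d)%cx in K N; set p := 2 * fst (F 0%cx) in K N.
  have xp : 0 < x by rewrite /p in N; lra.
  (* If [p < x], this radius is below 1 and turns the left side into the midpoint of [x] and [p],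
     which exceeds [p]. *)
  have := K ((x + p) / (2 * x)).
  have -> : (x + p) / (2 * x) * x = (x + p) / 2 by field; lra.
  suff : 0 < (x + p) / (2 * x) < 1 by move=> h /(_ h); lra.
  split; first by apply: Rdiv_lt_0_compat; rewrite /p; lra.
  by apply/Rlt_div_l; lra.
move=> r hr.
pose k := fun z => (l * ((F z - F 0) / z)
   + RtoC (/ r ^ 2) * (z * (Cconj l * F z + Cconj (l * F 0))))%cx.
have diff_B : forall z d', cdiff F z d' ->
   cdiff (fun z => RtoC (/ r ^ 2) * (z * (Cconj l * F z + Cconj (l * F 0))))%cx z
    (RtoC (/ r ^ 2) * (1 * (Cconj l * F z + Cconj (l * F 0)) + z * (Cconj l * d' + 0)))%cx.
  move=> z d' Hd'; apply: cdiff_scal; apply: cdiff_mul; first exact: cdiff_id.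
  by apply: cdiff_add (cdiff_const _ _); apply: cdiff_scal.
have I : is_RInt (fun t => fst (k (RtoC r * cis t)%cx)) 0 (2 * PI) (2 * PI * fst (l * d)%cx).
  apply: (@circle_mean k (l * d)%cx 1); last lra.
  - move=> z [z1 z2]; case: (HF z z2) => d' Hd'.
    case: (cdiff_quotient Hd' (Cmod_neq0 z1)) => d2 Hd2; eexists.
    by apply: cdiff_add; [apply: cdiff_scal Hd2 | apply: diff_B Hd'].
  - move=> e e0; case: (cdiff_quotient_lim H0 (e := e / 2)) => [|a [a0 Ha]]; first lra.
    case: (cdiff_continuous (diff_B _ _ H0) (e := e / 2)) => [|b [b0 Hb]]; first lra.
    exists (Rmin a b); split; first exact: Rmin_pos.
    move=> z [z1 z2].
    have za := Rlt_le_trans _ _ _ z2 (Rmin_l _ _); have zb := Rlt_le_trans _ _ _ z2 (Rmin_r _ _).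
    have {}Ha := Ha z (conj z1 za).
    have {}Hb : Cmod (RtoC (/ r ^ 2) * (z * (Cconj l * F z + Cconj (l * F 0))))%cx <= e / 2.
      have -> : (RtoC (/ r ^ 2) * (z * (Cconj l * F z + Cconj (l * F 0))))%cx
        = (RtoC (/ r ^ 2) * (z * (Cconj l * F z + Cconj (l * F 0))) -
           RtoC (/ r ^ 2) * (0 * (Cconj l * F 0 + Cconj (l * F 0))))%cx by ring.
      by apply: Hb; have -> : (z - 0)%cx = z by ring.
    have -> : (k z - l * d)%cx = (l * ((F z - F 0) / z - d)
        + RtoC (/ r ^ 2) * (z * (Cconj l * F z + Cconj (l * F 0))))%cx by rewrite /k; ring.
    apply: Rle_trans (Cmod_add _ _) _; rewrite {1}Cmod_mul l1; lra.
have J : is_RInt (fun t => 2 / r * fst (F (RtoC r * cis t)%cx)) 0 (2 * PI)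
     (2 / r * (2 * PI * fst (F 0%cx))).
  apply: (is_RInt_scal (V := R_NormedModule)).
  apply: (@circle_mean F (F 0%cx) 1); last lra.
  - by move=> z [_ z2]; apply: HF.
  - move=> e e0; case: (cdiff_continuous H0 e0) => a [a0 Ha]; exists a; split=> // z [_ hz].
    by apply: Ha; have -> : (z - 0)%cx = z by ring.
have := is_RInt_le _ _ _ _ _ _ _ I J => K.
have {K} : 2 * PI * fst (l * d)%cx <= 2 / r * (2 * PI * fst (F 0%cx)).
  apply: K; first lra.
  move=> t _.
  have zr : Cmod (RtoC r * cis t)%cx = r by apply: Cmod_circle; lra.
  have := Hp (RtoC r * cis t)%cx ltac:(lra).
  have tr : Cinv (RtoC r * cis t)%cx = (RtoC (/ r) * Cconj (cis t))%cx.
    have := Cmod_sqr (RtoC r * cis t)%cx; rewrite zr /Cinv => <-.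
    by rewrite /cis; cx_unfold; f_equal; field; lra.
  (* On the circle [z / r ^ 2] is the conjugate of [1 / z]: the factors of [F z] add up to a real
     number and the two terms in [F 0] to a purely imaginary one. *)
  have -> : fst (k (RtoC r * cis t)%cx) =
     2 / r * (fst (l * Cconj (cis t))%cx * fst (F (RtoC r * cis t)%cx)).
    rewrite /k /Cdiv tr; set w := F (RtoC r * cis t)%cx; set w0 := F 0%cx.
    by cx_unfold; field; lra.
  move=> p0; apply: Rmult_le_compat_l; first by apply/Rlt_le/Rdiv_lt_0_compat; lra.
  have : fst (l * Cconj (cis t))%cx <= 1.
    apply: Rle_trans (Rle_abs _) _; apply: Rle_trans (Cmod_fst _) _.
    by rewrite Cmod_mul Cmod_conj Cmod_cis l1; lra.
  nra.
have -> : 2 / r * (2 * PI * fst (F 0%cx)) = 2 * PI * (2 * fst (F 0%cx) / r) by field; lra.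
have pi2 : 0 < 2 * PI by lra.
move=> /(Rmult_le_reg_l _ _ _ pi2) K.
by rewrite Rmult_comm; apply/Rle_div_r; lra.
Qed.

Lemma decreasing_of_derive (f : R -> R) (a b : R) : a <= b ->
  (forall t, a <= t <= b -> continuity_pt f t) ->
  (forall t, a < t < b -> exists l, is_derive f t l /\ l <= 0) -> f b <= f a.
Proof.
move=> ab Hc Hd; case: (Req_dec a b) => [->|N]; first lra.
(* The mean value point may be an endpoint, where no derivative is assumed; the minimum with 0 has
   the right sign there too. *)
case: (MVT_gen f a b (fun t => Rmin 0 (Derive f t))).
- rewrite Rmin_left ?Rmax_right // => t ht; case: (Hd t ht) => l [D L].
  by rewrite (is_derive_unique _ _ _ D) Rmin_right.
- by rewrite Rmin_left ?Rmax_right.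
move=> t [_ E]; have := Rmin_l 0 (Derive f t); nra.
Qed.

(** The Cayley map [m] takes the disc to the half-plane and 0 to [w], with derivative [2 Re w] at 0;
    Caratheodory's estimate applies to [h (m z)]. *)
Lemma halfplane_schwarz_pick (h : C -> C) (d w : C) :
  (forall z, 0 < fst z -> exists d', cdiff h z d') ->
  (forall z, 0 < fst z -> 0 <= fst (h z)) ->
  0 < fst w -> cdiff h w d -> Cmod d * fst w <= fst (h w).
Proof.
move=> Hh Hp w0 Hd.
pose m := fun z : C => ((w + Cconj w * z) / (1 - z))%cx.
have n0 : forall z, Cmod z < 1 -> (1 - z)%cx <> 0%cx.
  move=> z hz; apply: Cmod_neq0; have := Cmod_le_sub 1 z; rewrite Cmod1; lra.
have Dm : forall z, Cmod z < 1 -> cdiff m z (((Cconj w) * (1 - z) + (w + Cconj w * z)) / ((1 - z) * (1 - z)))%cx.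
  move=> z hz; have z1 := n0 _ hz; apply: cdiff_val.
    apply: cdiff_div => //.
      by apply: cdiff_add (cdiff_const _ _) (cdiff_scal _ (cdiff_id _)).
    by apply: cdiff_sub (cdiff_const _ _) (cdiff_id _).
  by cbv beta; field.
have Rm : forall z, Cmod z < 1 -> 0 < fst (m z).
  move=> z hz; have z1 := Cnorm2_gt0 (n0 _ hz).
  have -> : fst (m z) = fst w * (1 - Cnorm2 z) / Cnorm2 (1 - z)%cx.
    by rewrite /m; move: z1; cx_unfold => z1; field; lra.
  apply: Rdiv_lt_0_compat => //; apply: Rmult_lt_0_compat => //.
  by rewrite -Cmod_sqr; have := Cmod_ge0 z; nra.
have m0 : m 0%cx = w by rewrite /m; field; apply: Cmod_neq0; rewrite Cmod1; lra.
have := @caratheodory_estimate (fun z => h (m z)) (d * (RtoC 2 * RtoC (fst w)))%cx.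
rewrite m0 !Cmod_mul !Cmod_RtoC (Rabs_pos_eq 2) ?(Rabs_pos_eq (fst w)); try lra.
move=> K; suff : Cmod d * (2 * fst w) <= 2 * fst (h w) by lra.
apply: K.
- move=> z hz; case: (Hh _ (Rm _ hz)) => d' Hd'; eexists; exact: cdiff_comp (Dm _ hz) Hd'.
- apply: cdiff_val; first by apply: cdiff_comp; [apply: Dm; rewrite Cmod0; lra | rewrite m0; exact: Hd].
  f_equal; transitivity (Cconj w + w)%cx; first by field; apply: Cmod_neq0; rewrite Cmod1; lra.
  by cx_ring.
- by move=> z hz; apply: Hp; apply: Rm.
Qed.

(** The numerator of the derivative of the ratio is [t Re h' - Re h], which Schwarz-Pick makes
    nonpositive. *)
Lemma halfplane_ratio_decreasing (h : C -> C) (x x' y : R) :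
  (forall z, 0 < fst z -> exists d, cdiff h z d) ->
  (forall z, 0 < fst z -> 0 <= fst (h z)) ->
  0 < x -> x <= x' -> fst (h (x', y)) / x' <= fst (h (x, y)) / x.
Proof.
move=> Hh Hp x0 xx.
have D : forall t, x <= t <= x' -> exists l, is_derive (fun t => fst (h (t, y)) / t) t l /\ l <= 0.
  move=> t ht; have t0 : 0 < fst (t, y) by rewrite /=; lra.
  case: (Hh _ t0) => d Hd.
  have E : forall s, (s, y) = ((0, y)%R + RtoC s * 1)%cx by move=> s; cx_unfold; f_equal; ring.
  have Df : is_derive (fun s => fst (h (s, y))) t (fst (d * 1)%cx).
    apply: (is_derive_ext (fun s => fst (h ((0, y)%R + RtoC s * 1)%cx))); first by move=> s; rewrite -E.
    by apply: cdiff_is_derive_fst; rewrite -E.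
  exists ((fst d * t - fst (h (t, y))) / t ^ 2); split.
    have -> : (fst d * t - fst (h (t, y))) / t ^ 2 = (fst (d * 1)%cx * t - fst (h (t, y)) * 1) / t ^ 2 by cx_unfold; f_equal; ring.
    by apply: is_derive_div; [exact: Df | exact: is_derive_id | lra].
  have := halfplane_schwarz_pick Hh Hp t0 Hd => /= SP.
  have fd : fst d <= Cmod d by apply: Rle_trans (Rle_abs _) (Cmod_fst _).
  apply/Rle_div_l; first nra.
  nra.
apply: (@decreasing_of_derive (fun t => fst (h (t, y)) / t) x x' xx) => t ht.
  by case: (D t ht) => l [Dl Hl]; exact: is_derive_continuity_pt Dl.
by apply: D; lra.
Qed.

(** By Schwarz-Pick, [Re h] grows at most like [exp (|y| / x)] in the vertical direction, so it is
    at most [exp M * e * x] in the sector. This bounds [h'] by [exp M * e] there and by [e] on the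
    axis; a vertical and a horizontal path then give the constant. *)
Lemma halfplane_sublinear (h h' : C -> C) (x0 x y M e : R) :
  (forall z, 0 < fst z -> cdiff h z (h' z)) ->
  (forall z, 0 < fst z -> 0 <= fst (h z)) ->
  0 < x0 -> x0 <= x -> 0 <= e -> Rabs y <= M * x ->
  (forall t, x0 <= t -> fst (h (t, 0)) <= e * t) ->
  Cmod (h (x, y)) <= Cmod (h (x0, 0)) + (1 + M * exp M) * e * x.
Proof.
move=> Hh Hp x00 xx e0 hy He.
have Hex : forall z, 0 < fst z -> exists d, cdiff h z d by move=> z /Hh; exists (h' z).
have SP : forall z, 0 < fst z -> Cmod (h' z) * fst z <= fst (h z).
  by move=> z hz; apply: halfplane_schwarz_pick (Hh z hz).
have M0 : 0 <= M by have := Rabs_pos y; nra.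
have V : forall s, Rabs s <= M * x -> fst (h (x, s)) <= exp M * (e * x).
  move=> s hs.
  (* [sg] is the sign of [s]; it lets one computation serve both vertical directions. *)
  have [sg [sgs sg1]] : exists sg, sg * Rabs s = s /\ Rabs sg = 1.
    case: (Rle_dec 0 s) => q; first by exists 1; rewrite Rabs_R1 Rabs_pos_eq //; lra.
    by exists (-1); rewrite Rabs_Ropp Rabs_R1 Rabs_left; lra.
  have E : forall t, (x, sg * t) = (RtoC x + RtoC t * (0, sg)%R)%cx by move=> t; cx_unfold; f_equal; ring.
  pose f t := fst (h (x, sg * t)) * exp (- (t / x)).
  have D : forall t, exists l, is_derive f t l /\ l <= 0.
    move=> t; have t0 : 0 < fst (x, sg * t) by rewrite /=; lra.
    have Df : is_derive (fun t => fst (h (x, sg * t))) t (fst (h' (x, sg * t)%R * (0, sg)%R)%cx).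
      apply: (is_derive_ext (fun t => fst (h (RtoC x + RtoC t * (0, sg)%R)%cx))); first by move=> u; rewrite -E.
      by apply: cdiff_is_derive_fst; rewrite -E; apply: Hh.
    have De : is_derive (fun t => exp (- (t / x))) t (- / x * exp (- (t / x))).
      by auto_derive => //; rewrite /Rdiv; field; lra.
    exists (fst (h' (x, sg * t)%R * (0, sg)%R)%cx * exp (- (t / x)) + fst (h (x, sg * t)) * (- / x * exp (- (t / x)))).
    split; first by apply: is_derive_mult => //; move=> *; exact: Rmult_comm.
    have ep := exp_pos (- (t / x)).
    have B : fst (h' (x, sg * t)%R * (0, sg)%R)%cx <= fst (h (x, sg * t)) * / x.
      apply: Rle_trans (Rle_abs _) _; apply: Rle_trans (Cmod_fst _) _; rewrite Cmod_mul.
      have -> : Cmod (0, sg) = 1.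
        have -> : ((0, sg) : C) = ((0, 1)%R * RtoC sg)%cx by cx_unfold; f_equal; ring.
        rewrite Cmod_mul Cmod_RtoC sg1 /Cmod /Cnorm2 /=.
        have -> : 0 * (0 * 1) + 1 * (1 * 1) = 1 by ring.
        by rewrite sqrt_1; ring.
      rewrite Rmult_1_r; apply/Rle_div_r; first lra.
      exact: (SP _ t0).
    nra.
  have := @decreasing_of_derive f 0 (Rabs s) (Rabs_pos s).
  rewrite /f sgs Rmult_0_r; have -> : - (0 / x) = 0 by field; lra.
  rewrite exp_0 Rmult_1_r => K.
  have {K} : fst (h (x, s)) * exp (- (Rabs s / x)) <= fst (h (x, 0)).
    apply: K => t _; case: (D t) => l [Dl Hl]; first exact: is_derive_continuity_pt Dl.
    by exists l.
  rewrite exp_Ropp => K.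
  have {}K : fst (h (x, s)) <= fst (h (x, 0)) * exp (Rabs s / x).
    by apply/Rle_div_l => //; exact: exp_pos.
  apply: Rle_trans K _; rewrite Rmult_comm; apply: Rmult_le_compat.
  - exact/Rlt_le/exp_pos.
  - by apply: Hp => /=; lra.
  - have : Rabs s / x <= M by apply/Rle_div_l; lra.
    by case=> [/exp_increasing|->]; lra.
  - by apply: He.
have HV : Cmod (h (x, y) - h (x, 0)%R)%cx <= M * exp M * e * x.
  have -> : (x, y) = (RtoC x + (0, y)%R)%cx by cx_unfold; f_equal; ring.
  apply: (@mean_value_ineq h h' (RtoC x) (0, y)) => t ht.
    by apply: Hh; cx_unfold; lra.
  have -> : (RtoC x + RtoC t * (0, y)%R)%cx = (x, t * y) by cx_unfold; f_equal; ring.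
  rewrite Cmod_mul.
  have -> : Cmod (0, y) = Rabs y.
    by rewrite /Cmod /Cnorm2 /= -sqrt_Rsqr_abs /Rsqr; f_equal; ring.
  have ty : Rabs (t * y) <= M * x.
    rewrite Rabs_mult Rabs_pos_eq; last lra; have := Rabs_pos y; nra.
  have := SP (x, t * y) ltac:(rewrite /=; lra); have := V _ ty => /= K1 K2.
  have : Cmod (h' (x, t * y)) <= exp M * e by apply: (Rmult_le_reg_r x); lra.
  have := Cmod_ge0 (h' (x, t * y)); have := Rabs_pos y; have := exp_pos M; nra.
have HH : Cmod (h (x, 0)%R - h (x0, 0)%R)%cx <= e * x.
  have -> : (x, 0) = ((x0, 0)%R + RtoC (x - x0))%cx by cx_unfold; f_equal; ring.
  apply: (@mean_value_ineq h h' (x0, 0) (RtoC (x - x0))) => t ht.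
    by apply: Hh; cx_unfold; nra.
  have -> : ((x0, 0)%R + RtoC t * RtoC (x - x0))%cx = (x0 + t * (x - x0), 0) by cx_unfold; f_equal; ring.
  rewrite Cmod_mul Cmod_RtoC Rabs_pos_eq; last lra.
  set s := x0 + t * (x - x0); have s0 : x0 <= s by rewrite /s; nra.
  have := SP (s, 0) ltac:(rewrite /=; lra); have := He _ s0 => /= K1 K2.
  have : Cmod (h' (s, 0)) <= e by apply: (Rmult_le_reg_r s); lra.
  have := Cmod_ge0 (h' (s, 0)); nra.
have := Cmod_dist3 (h (x, y)) (h (x, 0)%R) (h (x0, 0)%R).
have := Cmod_le_sub (h (x, y)) (h (x0, 0)%R); lra.
Qed.

(** * Vectors *)

HB.instance Definition _ := Monoid.isComLaw.Build R 0 Rplus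
  (fun x y z => esym (Rplus_assoc x y z)) Rplus_comm Rplus_0_l.

Lemma CaddA : associative Cadd. Proof. move=> a b c; ring. Qed.
Lemma CaddC : commutative Cadd. Proof. move=> a b; ring. Qed.
Lemma Cadd0 : left_id Czero Cadd. Proof. move=> a; ring. Qed.

HB.instance Definition _ := Monoid.isComLaw.Build C Czero Cadd CaddA CaddC Cadd0.

Lemma sumR_le (n : nat) (f g : 'I_n -> R) : (forall i, f i <= g i) ->
  \big[Rplus/0]_(i < n) f i <= \big[Rplus/0]_(i < n) g i.
Proof. by move=> H; apply: (big_ind2 (fun a b => a <= b)) => [|* |i _]; [lra | lra | exact: H]. Qed.

Lemma sumR_ge0 (n : nat) (f : 'I_n -> R) : (forall i, 0 <= f i) ->
  0 <= \big[Rplus/0]_(i < n) f i.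
Proof. by move=> H; apply: (big_ind (fun a => 0 <= a)) => [|* |i _]; [lra | lra | exact: H]. Qed.

Lemma sumR_scal (n : nat) (a : R) (f : 'I_n -> R) :
  \big[Rplus/0]_(i < n) (a * f i) = a * \big[Rplus/0]_(i < n) f i.
Proof. by rewrite (big_morph (fun x => a * x) (id1 := 0) (op1 := Rplus)) // => [x y|]; ring. Qed.

Lemma sumR_const (n : nat) (a : R) : \big[Rplus/0]_(i < n) a = INR n * a.
Proof.
elim: n => [|n IH]; first by rewrite big_ord0 /=; ring.
by rewrite S_INR big_ord_recr /= IH; ring.
Qed.

Lemma sumR_add (n : nat) (f g : 'I_n -> R) :
  \big[Rplus/0]_(i < n) (f i + g i) =
  \big[Rplus/0]_(i < n) f i + \big[Rplus/0]_(i < n) g i.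
Proof. by rewrite big_split. Qed.

Lemma sumR_term_le (n : nat) (f : 'I_n -> R) (j : 'I_n) : (forall i, 0 <= f i) ->
  f j <= \big[Rplus/0]_(i < n) f i.
Proof.
move=> H; have -> : \big[Rplus/0]_(i < n) f i = f j + \big[Rplus/0]_(i < n | i != j) f i.
  exact: (bigD1 j).
have : 0 <= \big[Rplus/0]_(i < n | i != j) f i.
  by apply: (big_ind (fun a => 0 <= a)) => [|* |i _]; [lra | lra | exact: H].
by lra.
Qed.

(** The sum norm, equivalent to [vnorm] up to a factor [n], carries the local estimates: its
    triangle inequality is coordinatewise and asks for no Cauchy-Schwarz inequality. *)
Definition norm1 {n} (v : vec n) : R := \big[Rplus/0]_(i < n) Cmod (v i).

Lemma vec_ext (n : nat) (u v : vec n) : (forall i, u i = v i) -> u = v.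
Proof. exact: functional_extensionality. Qed.

Definition vzero {n} : vec n := fun _ => Czero.

Lemma norm1_ge0 (n : nat) (v : vec n) : 0 <= norm1 v.
Proof. by apply: sumR_ge0 => i; exact: Cmod_ge0. Qed.
Lemma norm1_coord (n : nat) (v : vec n) (i : 'I_n) : Cmod (v i) <= norm1 v.
Proof. by apply: (@sumR_term_le n (fun i => Cmod (v i))) => j; exact: Cmod_ge0. Qed.
Lemma norm1_add (n : nat) (u v : vec n) : norm1 (vadd u v) <= norm1 u + norm1 v.
Proof. by rewrite /norm1 -sumR_add; apply: sumR_le => i; exact: Cmod_add. Qed.
Lemma norm1_scal (n : nat) (a : C) (v : vec n) : norm1 (vscal a v) = Cmod a * norm1 v.
Proof. by rewrite /norm1 -sumR_scal; apply: eq_bigr => i _; exact: Cmod_mul. Qed.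
Lemma norm1_eq0 (n : nat) (v : vec n) : norm1 v = 0 -> v = vzero.
Proof.
move=> H; apply: vec_ext => i; apply: Cmod_eq0.
by have := norm1_coord v i; have := Cmod_ge0 (v i); lra.
Qed.
Lemma norm1_zero (n : nat) : norm1 (@vzero n) = 0.
Proof. by rewrite /norm1 big1 // => i _; exact: Cmod0. Qed.

Lemma vnorm2_ge0 (n : nat) (v : vec n) : 0 <= vnorm2 v.
Proof. by apply: sumR_ge0 => i; exact: Cnorm2_ge0. Qed.
Lemma vnorm_sqr (n : nat) (v : vec n) : vnorm v ^ 2 = vnorm2 v.
Proof. by rewrite /vnorm /= Rmult_1_r; apply/sqrt_sqrt/vnorm2_ge0. Qed.
Lemma Cnorm2_coord (n : nat) (v : vec n) (i : 'I_n) : Cnorm2 (v i) <= vnorm2 v.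
Proof. by apply: (@sumR_term_le n (fun i => Cnorm2 (v i))) => j; exact: Cnorm2_ge0. Qed.
Lemma Cmod_coord (n : nat) (v : vec n) (i : 'I_n) : Cmod (v i) <= vnorm v.
Proof. by apply: sqrt_le_1_alt; exact: Cnorm2_coord. Qed.

Lemma vnorm2_le_norm1 (n : nat) (v : vec n) : vnorm2 v <= norm1 v ^ 2.
Proof.
rewrite /vnorm2; apply: (Rle_trans _ (\big[Rplus/0]_(i < n) (norm1 v * Cmod (v i)))).
  apply: sumR_le => i; rewrite -Cmod_sqr; have := norm1_coord v i; have := Cmod_ge0 (v i); nra.
by rewrite sumR_scal -/(norm1 v); apply: Req_le; ring.
Qed.

Lemma vnorm_le_norm1 (n : nat) (v : vec n) : vnorm v <= norm1 v.
Proof.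
rewrite /vnorm -(sqrt_pow2 (norm1 v)); last exact: norm1_ge0.
by apply: sqrt_le_1_alt; exact: vnorm2_le_norm1.
Qed.

Lemma norm1_le_vnorm (n : nat) (v : vec n) : norm1 v <= INR n * vnorm v.
Proof. by rewrite -sumR_const; apply: sumR_le => i; exact: Cmod_coord. Qed.

Lemma norm1_sqr_le (n : nat) (v : vec n) : norm1 v ^ 2 <= INR n ^ 2 * vnorm2 v.
Proof.
rewrite -vnorm_sqr -Rpow_mult_distr; apply: pow_incr; split; first exact: norm1_ge0.
exact: norm1_le_vnorm.
Qed.

Lemma ball_open (n : nat) (p : vec n) : ball p ->
  exists delta, 0 < delta /\ forall x, norm1 (vsub x p) < delta -> ball x.
Proof.
rewrite /ball => hp; exists (Rmin 1 ((1 - vnorm2 p) / 4)); split; first by apply: Rmin_pos; lra.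
move=> x hx; set h := vsub x p in hx.
have h1 := Rlt_le_trans _ _ _ hx (Rmin_l _ _); have h2 := Rlt_le_trans _ _ _ hx (Rmin_r _ _).
suff : vnorm2 x <= vnorm2 p + 3 * norm1 h by lra.
rewrite /vnorm2 /norm1 -sumR_scal -sumR_add; apply: sumR_le => i.
have E : x i = (p i + h i)%cx by rewrite /h /vsub; ring.
have pi1 : Cmod (p i) <= 1.
  apply: Cmod_square_le; first lra.
  by have := Cnorm2_coord p i; lra.
have hi1 := norm1_coord h i; have p0 := Cmod_ge0 (p i); have hi0 := Cmod_ge0 (h i).
have := Cmod_add (p i) (h i); rewrite -E => K; have x0 := Cmod_ge0 (x i).
rewrite -!Cmod_sqr; nra.
Qed.

Lemma vec_line_sub (n : nat) (z v p : vec n) (a : C) :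
  norm1 (vsub (vadd z (vscal a v)) p) <= norm1 (vsub z p) + Cmod a * norm1 v.
Proof.
rewrite -norm1_scal; apply: Rle_trans (norm1_add _ _).
by apply: Req_le; f_equal; apply: vec_ext => i; rewrite /vsub /vadd /vscal; ring.
Qed.

Lemma norm1_segment (n : nat) (x y p : vec n) (t delta : R) : 0 <= t <= 1 ->
  norm1 (vsub x p) < delta -> norm1 (vsub y p) < delta ->
  norm1 (vsub (vadd y (vscal (RtoC t) (vsub x y))) p) < delta.
Proof.
move=> ht hx hy.
have -> : vsub (vadd y (vscal (RtoC t) (vsub x y))) p =
   vadd (vscal (RtoC (1 - t)) (vsub y p)) (vscal (RtoC t) (vsub x p)).
  by apply: vec_ext => i; rewrite /vsub /vadd /vscal; cx_ring.
apply: Rle_lt_trans (norm1_add _ _) _; rewrite !norm1_scal !Cmod_RtoC !Rabs_pos_eq; try lra.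
have := norm1_ge0 (vsub x p); have := norm1_ge0 (vsub y p) => h1 h2.
case: (Rle_lt_dec t (1 / 2)) => ht2; nra.
Qed.

(** * Local estimates for a holomorphic map *)

Lemma clinear_scal (n : nat) (L : vec n -> vec n) (a : C) (v : vec n) (i : 'I_n) :
  Clinear L -> L (vscal a v) i = (a * L v i)%cx.
Proof.
move=> HL.
have L0 : L vzero i = 0%cx.
  have := HL 1%cx vzero vzero i.
  have -> : vadd (vscal 1 vzero) vzero = (vzero : vec n).
    by apply: vec_ext => j; rewrite /vadd /vscal /vzero; ring.
  rewrite /vadd /vscal => E.
  have -> : L vzero i = ((1 * L vzero i + L vzero i) - L vzero i)%cx by ring.
  by rewrite -E; ring.
have := HL a v vzero i.
have -> : vadd (vscal a v) vzero = vscal a v.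
  by apply: vec_ext => j; rewrite /vadd /vscal /vzero; ring.
by move=> ->; rewrite /vadd /vscal L0; ring.
Qed.

Lemma clinear_zero (n : nat) (L : vec n -> vec n) (i : 'I_n) :
  Clinear L -> L vzero i = 0%cx.
Proof.
move=> HL; have -> : (vzero : vec n) = vscal 0 vzero by apply: vec_ext => j; rewrite /vscal /vzero; ring.
by rewrite clinear_scal //; ring.
Qed.

Lemma clinear_sub (n : nat) (L : vec n -> vec n) (u v : vec n) (i : 'I_n) :
  Clinear L -> L (vsub u v) i = (L u i - L v i)%cx.
Proof.
move=> HL; have -> : vsub u v = vadd (vscal (- (1)) v) u.
  by apply: vec_ext => j; rewrite /vsub /vadd /vscal; ring.
by rewrite HL /vadd /vscal; ring.
Qed.

Lemma clinear_expand (n : nat) (L : vec n -> vec n) (h : vec n) (i : 'I_n) : Clinear L ->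
  Cmod (L h i) <= \big[Rplus/0]_(j < n) (Cmod (h j) * Cmod (L (basis n j) i)).
Proof.
(* [tr k] keeps the first [k] coordinates of [h]; each truncation arises from the previous one by a
   single use of linearity. *)
move=> HL; pose tr (k : nat) : vec n := fun j => if (j < k)%N then h j else Czero.
have H : forall k, (k <= n)%N ->
    Cmod (L (tr k) i) <= \big[Rplus/0]_(j < n | (j < k)%N) (Cmod (h j) * Cmod (L (basis n j) i)).
  elim=> [|k IH] kn.
    have -> : tr O = vzero by apply: vec_ext => j; rewrite /tr ltn0.
    by rewrite clinear_zero // Cmod0 big_pred0 //; lra.
  have {}IH := IH (ltnW kn); pose j0 := Ordinal kn.
  have -> : tr k.+1 = vadd (vscal (h j0) (basis n j0)) (tr k).
    apply: vec_ext => j; rewrite /tr /vadd /vscal /basis ltnS leq_eqVlt.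
    case: eqP => [E|_] /=; last by case: ifP => _; ring.
    have -> : j = j0 by apply: val_inj.
    by rewrite /= ltnn; ring.
  rewrite HL /vadd /vscal; apply: Rle_trans (Cmod_add _ _) _; rewrite Cmod_mul.
  have -> : \big[Rplus/0]_(j < n | (j < k.+1)%N) (Cmod (h j) * Cmod (L (basis n j) i)) =
     Cmod (h j0) * Cmod (L (basis n j0) i) +
     \big[Rplus/0]_(j < n | (j < k)%N) (Cmod (h j) * Cmod (L (basis n j) i)).
    rewrite (bigD1 j0) /=; last exact: ltnSn.
    congr (_ + _); apply: eq_bigl => j; rewrite ltnS ltn_neqAle andbC; congr (_ && _).
  by lra.
have := H n (leqnn n).
have -> : tr n = h by apply: vec_ext => j; rewrite /tr ltn_ord.
by rewrite (eq_bigl xpredT) // => j; rewrite ltn_ord.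
Qed.

(** The sum of the absolute values of chosen bounds dominates each of them. *)
Lemma uniform_bound (n : nat) (P : 'I_n -> R -> Prop) :
  (forall i x y, x <= y -> P i x -> P i y) -> (forall i, exists x, P i x) ->
  exists x, 0 <= x /\ forall i, P i x.
Proof.
move=> mono H; pose f i := epsilon (inhabits 0) (P i).
have fP : forall i, P i (f i) by move=> i; exact: (epsilon_spec (inhabits 0) (P i) (H i)).
exists (\big[Rplus/0]_(i < n) Rabs (f i)); split; first by apply: sumR_ge0 => i; exact: Rabs_pos.
move=> i; apply: mono (fP i); apply: Rle_trans (Rle_abs _) _.
by apply: (@sumR_term_le n (fun i => Rabs (f i))) => j; exact: Rabs_pos.
Qed.

Section Holomorphic.
Variables (n : nat) (G : vec n -> vec n) (dG : vec n -> vec n -> vec n).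
Hypothesis G_diff : forall z, ball z -> is_cderiv G z (dG z).

Lemma dG_linear (z : vec n) : ball z -> Clinear (dG z).
Proof. by move=> /G_diff []. Qed.

Lemma line_cdiff (z v : vec n) (a : C) (i : 'I_n) : ball (vadd z (vscal a v)) ->
  cdiff (fun b => G (vadd z (vscal b v)) i) a (dG (vadd z (vscal a v)) v i).
Proof.
set p := vadd z _ => hp e e0; have [HL Hd] := G_diff hp.
have v0 := norm1_ge0 v.
case: (ball_open hp) => d1 [d10 H1].
case: (Hd (e / (norm1 v + 1))) => [|d2 [d20 H2]]; first by apply: Rdiv_lt_0_compat; lra.
exists (Rmin d1 d2 / (norm1 v + 1)); split.
  by apply: Rdiv_lt_0_compat; [exact: Rmin_pos | lra].
move=> h hh; have hp0 := Cmod_ge0 h.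
have hv : norm1 (vscal h v) < Rmin d1 d2.
  rewrite norm1_scal; apply: (Rle_lt_trans _ (Cmod h * (norm1 v + 1))); first nra.
  by apply/Rlt_div_r => //; lra.
have hv1 := Rlt_le_trans _ _ _ hv (Rmin_l _ _); have hv2 := Rlt_le_trans _ _ _ hv (Rmin_r _ _).
have -> : vadd z (vscal (a + h) v) = vadd p (vscal h v).
  by apply: vec_ext => j; rewrite /p /vadd /vscal; ring.
have B : ball (vadd p (vscal h v)).
  apply: H1; have -> // : vsub (vadd p (vscal h v)) p = vscal h v.
  by apply: vec_ext => j; rewrite /vadd /vsub; ring.
have -> : (G (vadd p (vscal h v)) i - G p i - dG p v i * h)%cx =
   vsub (vsub (G (vadd p (vscal h v))) (G p)) (dG p (vscal h v)) i.
  by rewrite /vsub clinear_scal //; ring.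
(* [is_cderiv] speaks only of nonzero increments. *)
case: (Req_dec (norm1 (vscal h v)) 0) => [N|N].
  rewrite (norm1_eq0 N).
  have -> : vadd p vzero = p by apply: vec_ext => j; rewrite /vadd /vzero; ring.
  rewrite /vsub clinear_zero //; have -> : (G p i - G p i - 0)%cx = 0%cx by ring.
  by rewrite Cmod0; nra.
apply: Rle_trans (Cmod_coord _ _) _.
have vn : 0 < vnorm (vscal h v).
  have := norm1_le_vnorm (vscal h v); have := norm1_ge0 (vscal h v); have := sqrt_pos (vnorm2 (vscal h v)).
  rewrite -/(vnorm _) => -[//|<-]; rewrite Rmult_0_r; lra.
apply: Rle_trans (H2 _ B _) _; first by split=> //; apply: Rle_lt_trans (vnorm_le_norm1 _) hv2.
apply: (Rle_trans _ (e / (norm1 v + 1) * (Cmod h * (norm1 v + 1)))); last by apply: Req_le; field; lra.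
apply: Rmult_le_compat_l; first by apply/Rlt_le/Rdiv_lt_0_compat; lra.
by apply: Rle_trans (vnorm_le_norm1 _) _; rewrite norm1_scal; nra.
Qed.

(** Cauchy's estimate on the disc of radius [delta / norm1 h]. Writing the disc as
    [Cmod a * norm1 h < delta] lets the statement include [h = 0], where [D] vanishes. *)
Lemma cauchy_line (h : vec n) (F : C -> C) (D : C) (delta m : R) :
  0 < delta -> (forall a, Cmod a * norm1 h < delta -> exists d, cdiff F a d) ->
  (norm1 h = 0 -> D = 0%cx) -> cdiff F 0 D ->
  (forall a, Cmod a * norm1 h < delta -> Cmod (F a) <= m) ->
  Cmod D <= 4 * m / delta * norm1 h.
Proof.
move=> d0 HF HD HD0 Hm; case: (Req_dec (norm1 h) 0) => [E|N].
  by rewrite HD // Cmod0 E; lra.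
have h0 : 0 < norm1 h by have := norm1_ge0 h; lra.
have -> : 4 * m / delta * norm1 h = 4 * m / (delta / norm1 h) by field; lra.
apply: cauchy_estimate HD0 _.
- exact: Rdiv_lt_0_compat.
- by move=> a /(Rlt_div_r _ _ _ h0); apply: HF.
- by move=> a /(Rlt_div_r _ _ _ h0); apply: Hm.
Qed.

(** Differentiability at the single point [p] already bounds [G] near [p], and such a bound is what
    Cauchy's estimates start from. *)
Lemma locally_bounded (p : vec n) : ball p -> exists delta M, 0 < delta /\ 0 < M /\
  forall x, norm1 (vsub x p) < delta -> ball x /\ forall i, Cmod (G x i) <= M.
Proof.
move=> hp; have [HL Hd] := G_diff hp; case: (ball_open hp) => d1 [d10 H1].
case: (Hd 1 Rlt_0_1) => d2 [d20 H2].
have [K [K0 HK]] : exists K, 0 <= K /\ forall i h, Cmod (dG p h i) <= K * norm1 h.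
  apply: uniform_bound => [i x y xy H h|i].
    by apply: Rle_trans (H h) _; apply: Rmult_le_compat_r => //; exact: norm1_ge0.
  exists (\big[Rplus/0]_(j < n) Cmod (dG p (basis n j) i)) => h.
  apply: Rle_trans (clinear_expand h i HL) _; rewrite Rmult_comm -sumR_scal; apply: sumR_le => j.
  by apply: Rmult_le_compat_r; [exact: Cmod_ge0 | exact: norm1_coord].
exists (Rmin 1 (Rmin d1 d2)), (norm1 (G p) + K + 1); split; first by repeat apply: Rmin_pos => //; lra.
split; first by have := norm1_ge0 (G p); lra.
move=> x hx; have h1 := Rlt_le_trans _ _ _ hx (Rmin_l _ _).
have h2 := Rlt_le_trans _ _ _ hx (Rmin_r _ _).
have h3 := Rlt_le_trans _ _ _ h2 (Rmin_l _ _); have h4 := Rlt_le_trans _ _ _ h2 (Rmin_r _ _).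
have Bx := H1 _ h3; split=> // i.
set h := vsub x p in hx h1 h2 h3 h4.
have Ex : x = vadd p h by apply: vec_ext => j; rewrite /h /vadd /vsub; ring.
have hn := norm1_ge0 h.
case: (Req_dec (norm1 h) 0) => [N|N].
  have -> : x = p by rewrite Ex (norm1_eq0 N); apply: vec_ext => j; rewrite /vadd /vzero; ring.
  have := norm1_coord (G p) i; lra.
have vn : 0 < vnorm h.
  have := norm1_le_vnorm h; have := sqrt_pos (vnorm2 h).
  rewrite -/(vnorm _) => -[//|<-]; rewrite Rmult_0_r; lra.
have := H2 h; rewrite -Ex => /(_ Bx) /(_ (conj vn (Rle_lt_trans _ _ _ (vnorm_le_norm1 _) h4))) Q.
have {}Q := Rle_trans _ _ _ (Cmod_coord _ i) Q.
have v1 := vnorm_le_norm1 h.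
have -> : G x i = (vsub (vsub (G x) (G p)) (dG p h) i + (dG p h i + G p i))%cx by rewrite /vsub; ring.
apply: Rle_trans (Cmod_add _ _) _; have := Cmod_add (dG p h i) (G p i).
have := HK i h; have := norm1_coord (G p) i; nra.
Qed.

(** Each bound follows from the previous one on half the radius: a bound for [G] gives one for [dG]
    by Cauchy, hence a Lipschitz bound for [G], hence a Lipschitz bound for [dG], hence the
    quadratic Taylor remainder. *)
Lemma local_estimates (p : vec n) : ball p -> exists delta K, 0 < delta /\ 0 < K /\
  (forall x, norm1 (vsub x p) < delta -> ball x) /\
  (forall y h i, norm1 (vsub y p) < delta -> Cmod (dG y h i) <= K * norm1 h) /\
  (forall x y i, norm1 (vsub x p) < delta -> norm1 (vsub y p) < delta ->
     Cmod (G x i - G y i)%cx <= K * norm1 (vsub x y)) /\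
  (forall x y i, norm1 (vsub x p) < delta -> norm1 (vsub y p) < delta ->
     Cmod (G x i - G y i - dG y (vsub x y) i)%cx <= K * norm1 (vsub x y) ^ 2).
Proof.
move=> hp; case: (locally_bounded hp) => d [M [d0 [M0 HM]]].
have inball : forall x, norm1 (vsub x p) < d -> ball x by move=> x /HM [].
have line0 : forall (y h : vec n), vadd y (vscal 0 h) = y.
  by move=> y h; apply: vec_ext => j; rewrite /vadd /vscal; ring.
have line1 : forall (x y : vec n), vadd y (vscal (0 + 1) (vsub x y)) = x.
  by move=> x y; apply: vec_ext => j; rewrite /vadd /vscal /vsub; ring.
have dlin : forall y h i, norm1 (vsub y p) < d -> norm1 h = 0 -> dG y h i = 0%cx.
  by move=> y h i hy /norm1_eq0 ->; apply: clinear_zero; apply: dG_linear; apply: inball.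
have L1 : forall y h i, norm1 (vsub y p) < d / 2 -> Cmod (dG y h i) <= 4 * M / (d / 2) * norm1 h.
  move=> y h i hy.
  have inb : forall a, Cmod a * norm1 h < d / 2 -> norm1 (vsub (vadd y (vscal a h)) p) < d.
    by move=> a ha; have := vec_line_sub y h p a; lra.
  apply: (@cauchy_line h (fun a => G (vadd y (vscal a h)) i)); first lra.
  - by move=> a ha; eexists; apply: line_cdiff; apply: inball; apply: inb.
  - by apply: dlin; lra.
  - have := @line_cdiff y h 0 i; rewrite line0; apply; apply: inball; lra.
  - by move=> a /inb /HM [_]; apply.
set K1 := 4 * M / (d / 2) in L1.
have K10 : 0 < K1 by rewrite /K1; apply: Rdiv_lt_0_compat; lra.
have seg : forall x y t delta, delta <= d -> 0 <= t <= 1 -> norm1 (vsub x p) < delta -> norm1 (vsub y p) < delta ->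
   ball (vadd y (vscal (RtoC t) (vsub x y))).
  by move=> x y t dl hdl ht hx hy; apply: inball; apply: (Rlt_le_trans _ dl) => //; apply: norm1_segment.
have seg0 : forall t, (0 + RtoC t * 1)%cx = RtoC t by move=> t; ring.
have L2 : forall x y i, norm1 (vsub x p) < d / 2 -> norm1 (vsub y p) < d / 2 ->
     Cmod (G x i - G y i)%cx <= K1 * norm1 (vsub x y).
  move=> x y i hx hy.
  have := @mean_value_ineq (fun a => G (vadd y (vscal a (vsub x y))) i)
    (fun a => dG (vadd y (vscal a (vsub x y))) (vsub x y) i) 0 1 (K1 * norm1 (vsub x y)).
  rewrite line0 line1; apply => t ht; rewrite seg0.
    by apply: line_cdiff; apply: (seg _ _ _ (d / 2)) => //; lra.
  rewrite Cmod_mul Cmod1 Rmult_1_r; apply: L1; exact: norm1_segment.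
(* Cauchy's estimate for the difference of [G] on two parallel lines; the Lipschitz bound makes that
   difference small. *)
have L3 : forall x y h i, norm1 (vsub x p) < d / 4 -> norm1 (vsub y p) < d / 4 ->
     Cmod (dG x h i - dG y h i)%cx <= 4 * (K1 * norm1 (vsub x y)) / (d / 4) * norm1 h.
  move=> x y h i hx hy.
  have inb : forall z a, norm1 (vsub z p) < d / 4 -> Cmod a * norm1 h < d / 4 ->
     norm1 (vsub (vadd z (vscal a h)) p) < d / 2.
    by move=> z a hz ha; have := vec_line_sub z h p a; lra.
  have inb2 : forall z a, norm1 (vsub z p) < d / 4 -> Cmod a * norm1 h < d / 4 ->
     ball (vadd z (vscal a h)).
    by move=> z a hz ha; apply: inball; have := inb z a hz ha; lra.
  apply: (@cauchy_line h (fun a => (G (vadd x (vscal a h)) i - G (vadd y (vscal a h)) i)%cx)); first lra.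
  - by move=> a ha; eexists; apply: cdiff_sub; apply: line_cdiff; apply: inb2.
  - by move=> h0; rewrite !dlin //; try lra; ring.
  - apply: cdiff_sub.
      by have := @line_cdiff x h 0 i; rewrite line0; apply; apply: inball; lra.
    by have := @line_cdiff y h 0 i; rewrite line0; apply; apply: inball; lra.
  - move=> a ha; apply: Rle_trans (L2 _ _ i (inb _ _ hx ha) (inb _ _ hy ha)) _.
    have -> : vsub (vadd x (vscal a h)) (vadd y (vscal a h)) = vsub x y; last lra.
    by apply: vec_ext => j; rewrite /vsub /vadd; ring.
set K2 := 4 * K1 / (d / 4).
have K20 : 0 < K2 by rewrite /K2; apply: Rdiv_lt_0_compat; lra.
exists (d / 4), (K1 + K2); split; first lra; split; first lra; split; first by move=> x hx; apply: inball; lra.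
split.
  move=> y h i hy; have := L1 y h i ltac:(lra); have := norm1_ge0 h; nra.
split.
  move=> x y i hx hy; have := L2 x y i ltac:(lra) ltac:(lra); have := norm1_ge0 (vsub x y); nra.
move=> x y i hx hy.
have By : ball y by apply: inball; lra.
have := @mean_value_ineq (fun a => (G (vadd y (vscal a (vsub x y))) i - a * dG y (vsub x y) i)%cx)
    (fun a => (dG (vadd y (vscal a (vsub x y))) (vsub x y) i - dG y (vsub x y) i)%cx) 0 1 (K2 * norm1 (vsub x y) ^ 2).
rewrite line0 line1.
have -> : (G x i - (0 + 1) * dG y (vsub x y) i - (G y i - 0 * dG y (vsub x y) i))%cx
   = (G x i - G y i - dG y (vsub x y) i)%cx by ring.
move=> K; apply: Rle_trans (K _ _) _.
- move=> t ht; rewrite seg0; apply: cdiff_sub.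
    by apply: line_cdiff; apply: (seg _ _ _ (d / 4)) => //; lra.
  apply: cdiff_val; first by apply: cdiff_mul (cdiff_id _) (cdiff_const _ _).
  by cbv beta; ring.
- move=> t ht; rewrite seg0 Cmod_mul Cmod1 Rmult_1_r.
  have nn := norm1_ge0 (vsub x y).
  apply: Rle_trans (L3 _ _ _ _ _ _) _ => //; first exact: norm1_segment.
  have -> : norm1 (vsub (vadd y (vscal (RtoC t) (vsub x y))) y) = t * norm1 (vsub x y).
    rewrite -{2}(Rabs_pos_eq t); last lra.
    rewrite -Cmod_RtoC -norm1_scal; f_equal; apply: vec_ext => j; rewrite /vsub /vadd; ring.
  have -> : 4 * (K1 * (t * norm1 (vsub x y))) / (d / 4) * norm1 (vsub x y) = K2 * (t * norm1 (vsub x y) ^ 2).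
    by rewrite /K2; field; lra.
  apply: Rmult_le_compat_l; first lra.
  have := pow2_ge_0 (norm1 (vsub x y)); nra.
- have := pow2_ge_0 (norm1 (vsub x y)); nra.
Qed.

End Holomorphic.

(** * Holomorphic dependence of trajectories on the initial point *)

(** The differential inequality is available only while [e] stays below [bar], that is, while two
    trajectories stay close. The Gronwall bound itself is below [bar], so [bar] is never reached. *)
Lemma gronwall_barrier (e : R -> R) (T A B K bar : R) :
  0 <= A -> 0 <= B -> 0 <= K -> e 0 <= A -> (A + B * T) * exp (K * T) < bar ->
  (forall t, 0 <= t <= T -> continuity_pt e t) ->
  (forall t, 0 < t < T -> e t <= bar -> exists l, is_derive e t l /\ l <= K * e t + B) ->
  forall t, 0 <= t <= T -> e t <= (A + B * t) * exp (K * t).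
Proof.
move=> A0 B0 K0 eA hbar Hc Hd.
have G : forall s, 0 <= s <= T -> (forall r, 0 <= r < s -> e r <= bar) -> e s <= (A + B * s) * exp (K * s).
  move=> s hs Hs; pose f t := e t * exp (- (K * t)) - B * t.
  have c2 : forall t, is_derive (fun t => exp (- (K * t))) t (- K * exp (- (K * t))).
    by move=> t; auto_derive => //; ring.
  have := @decreasing_of_derive f 0 s (proj1 hs) => M.
  have {M} : f s <= f 0.
    apply: M => t ht.
      apply: continuity_pt_minus.
        apply: continuity_pt_mult; first by apply: Hc; lra.
        exact: is_derive_continuity_pt (c2 t).
      by apply: derivable_continuous_pt; exists (B * 1); apply: derivable_pt_lim_scal; apply: derivable_pt_lim_id.
    case: (Hd t) => [||l [Dl Hl]]; [lra | by apply: Hs; lra |].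
    exists ((l * exp (- (K * t)) + e t * (- K * exp (- (K * t)))) - B); split.
      apply: (is_derive_minus (V := R_NormedModule)); last by auto_derive => //; ring.
      by apply: is_derive_mult => //; move=> *; exact: Rmult_comm.
    have e1 : 0 < exp (- (K * t)) by exact: exp_pos.
    have e2 : exp (- (K * t)) <= 1.
      rewrite -exp_0; have : - (K * t) <= 0 by nra.
      by case=> [/exp_increasing|->]; lra.
    nra.
  rewrite /f !Rmult_0_r Ropp_0 exp_0 Rmult_1_r Rminus_0_r exp_Ropp => M.
  apply/Rle_div_l; first exact: exp_pos.
  by rewrite /Rdiv; lra.
have mono : forall s, 0 <= s <= T -> (A + B * s) * exp (K * s) < bar.
  move=> s hs; apply: Rle_lt_trans hbar; apply: Rmult_le_compat; [nra | exact/Rlt_le/exp_pos | nra |].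
  have : K * s <= K * T by nra.
  by case=> [/exp_increasing|->]; lra.
(* If [bar] were reached at [t1], the supremum [s] of the times up to which [e] stays within [bar]
   would still satisfy [e s < bar], and continuity would push it further. *)
have L : forall t, 0 <= t <= T -> e t < bar.
  move=> t1 ht1; apply: Rnot_le_lt => bad.
  pose S s := 0 <= s <= t1 /\ forall r, 0 <= r <= s -> e r <= bar.
  case: (completeness S).
  - by exists t1 => s [[_ h] _].
  - exists 0; split; first lra.
    move=> r hr; have -> : r = 0 by lra.
    have := mono 0 ltac:(lra); rewrite !Rmult_0_r exp_0; lra.
  move=> s [ub lub].
  have S0 : S 0.
    split; first lra; move=> r hr; have -> : r = 0 by lra.
    have := mono 0 ltac:(lra); rewrite !Rmult_0_r exp_0; lra.
  have s0 : 0 <= s by apply: ub.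
  have st : s <= t1 by apply: lub => r [[_ h] _].
  have below : forall r, 0 <= r < s -> e r <= bar.
    move=> r hr; apply: NNPP => N.
    suff : s <= r by lra.
    apply: lub => q [hq1 hq2]; apply: Rnot_lt_le => qr; apply: N; apply: hq2; lra.
  have es : e s < bar.
    by apply: (Rle_lt_trans _ ((A + B * s) * exp (K * s))); [apply: G => // | apply: mono]; lra.
  have slt : s < t1 by case: st => [//|E]; rewrite E in es; lra.
  have := Hc s ltac:(lra) (bar - e s) ltac:(lra) => -[a [a0 Ha]].
  pose q := Rmin t1 (s + a / 2).
  have : q <= s.
    apply: ub; split; first by split; [apply: Rmin_glb; lra | apply: Rmin_l].
    move=> r hr; case: (Rlt_le_dec r s) => rs; first by apply: below; lra.
    case: (Req_dec r s) => [->|N]; first lra.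
    have := Ha r; rewrite /dist /= /R_dist /D_x /no_cond.
    have := Rmin_r t1 (s + a / 2); rewrite -/q => q2.
    case/(_ _)/Rabs_def2; last by move=> h1 h2; lra.
    by split; [split=> //; exact/not_eq_sym | rewrite Rabs_pos_eq; lra].
  rewrite /q /Rmin; case: Rle_dec => _; lra.
by move=> t ht; apply: G => // r hr; apply: Rlt_le; apply: L; lra.
Qed.

Definition rcdiff (f : R -> C) (t : R) (d : C) : Prop :=
  forall eps, 0 < eps -> exists delta, 0 < delta /\ forall s, Rabs (s - t) < delta ->
    Cmod (f s - f t - RtoC (s - t) * d)%cx <= eps * Rabs (s - t).

Lemma rcdiff_sub (f g : R -> C) (t : R) (d d' : C) :
  rcdiff f t d -> rcdiff g t d' -> rcdiff (fun s => f s - g s)%cx t (d - d')%cx.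
Proof.
move=> Hf Hg e e0; case: (Hf (e / 2)) => [|a [a0 Ha]]; first lra.
case: (Hg (e / 2)) => [|b [b0 Hb]]; first lra.
exists (Rmin a b); split; first exact: Rmin_pos.
move=> s hs; have {}Ha := Ha s (Rlt_le_trans _ _ _ hs (Rmin_l _ _)).
have {}Hb := Hb s (Rlt_le_trans _ _ _ hs (Rmin_r _ _)).
have -> : (f s - g s - (f t - g t) - RtoC (s - t) * (d - d'))%cx =
  ((f s - f t - RtoC (s - t) * d) - (g s - g t - RtoC (s - t) * d'))%cx by ring.
apply: Rle_trans (Cmod_sub _ _) _; lra.
Qed.

Lemma rcdiff_scal (f : R -> C) (t : R) (c d : C) :
  rcdiff f t d -> rcdiff (fun s => c * f s)%cx t (c * d)%cx.
Proof.
move=> Hf e e0; have c0 := Cmod_ge0 c.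
case: (Hf (e / (Cmod c + 1))) => [|a [a0 Ha]]; first by apply: Rdiv_lt_0_compat; lra.
exists a; split=> // s hs; have {}Ha := Ha s hs.
have -> : (c * f s - c * f t - RtoC (s - t) * (c * d))%cx = (c * (f s - f t - RtoC (s - t) * d))%cx by ring.
rewrite Cmod_mul; apply: (Rle_trans _ ((Cmod c + 1) * (e / (Cmod c + 1) * Rabs (s - t)))).
  by apply: Rmult_le_compat => //; [exact: Cmod_ge0 | lra].
by apply: Req_le; field; lra.
Qed.

Lemma rcdiff_fst (f : R -> C) (t : R) (d : C) : rcdiff f t d -> is_derive (fun s => fst (f s)) t (fst d).
Proof.
move=> H; apply: is_derive_eps => e e0; case: (H e e0) => a [a0 Ha]; exists a; split=> // s hs.
have -> : fst (f s) - fst (f t) - fst d * (s - t) = fst (f s - f t - RtoC (s - t) * d)%cx by cx_unfold; ring.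
by apply: Rle_trans (Cmod_fst _) (Ha s hs).
Qed.

Lemma rcdiff_snd (f : R -> C) (t : R) (d : C) : rcdiff f t d -> is_derive (fun s => snd (f s)) t (snd d).
Proof.
move=> H; apply: is_derive_eps => e e0; case: (H e e0) => a [a0 Ha]; exists a; split=> // s hs.
have -> : snd (f s) - snd (f t) - snd d * (s - t) = snd (f s - f t - RtoC (s - t) * d)%cx by cx_unfold; ring.
by apply: Rle_trans (Cmod_snd _) (Ha s hs).
Qed.

Lemma rcdiff_Cnorm2 (f : R -> C) (t : R) (d : C) : rcdiff f t d ->
  is_derive (fun s => Cnorm2 (f s)) t (2 * (fst (f t) * fst d + snd (f t) * snd d)).
Proof.
move=> H; have H1 := rcdiff_fst H; have H2 := rcdiff_snd H; rewrite /Cnorm2.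
have -> : 2 * (fst (f t) * fst d + snd (f t) * snd d) =
   plus (INR 2 * fst d * fst (f t) ^ 1) (INR 2 * snd d * snd (f t) ^ 1) by rewrite /plus /=; ring.
by apply: (is_derive_plus (V := R_NormedModule)); [apply: is_derive_pow H1 | apply: is_derive_pow H2].
Qed.

Lemma is_derive_sumR (n : nat) (f : 'I_n -> R -> R) (l : 'I_n -> R) (t : R) :
  (forall i, is_derive (f i) t (l i)) ->
  is_derive (fun s => \big[Rplus/0]_(i < n) f i s) t (\big[Rplus/0]_(i < n) l i).
Proof.
elim: n f l => [|n IH] f l H.
  rewrite big_ord0; apply: (is_derive_ext (fun _ => 0)); first by move=> s; rewrite big_ord0.
  exact: (is_derive_const (V := R_NormedModule)).
rewrite big_ord_recr /=.
apply: (is_derive_ext (fun s => plus (\big[Rplus/0]_(i < n) f (widen_ord (leqnSn n) i) s) (f ord_max s))).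
  by move=> s; rewrite big_ord_recr.
by apply: (is_derive_plus (V := R_NormedModule)); [apply: IH => i | apply: H].
Qed.

Lemma inner_re_le (a b : C) : fst a * fst b + snd a * snd b <= Cmod a * Cmod b.
Proof.
have -> : fst a * fst b + snd a * snd b = fst (a * Cconj b)%cx by cx_unfold; ring.
by rewrite -(Cmod_conj b) -Cmod_mul; apply: Rle_trans (Rle_abs _) (Cmod_fst _).
Qed.

(** The squared norm is differentiable even where [y] vanishes. The inequality
    [2 b N <= N ^ 2 + b ^ 2] separates the inhomogeneity, and [N ^ 2 <= n ^ 2 * vnorm2] closes the
    estimate. *)
Lemma energy_derive (n : nat) (y y' : R -> vec n) (t K b : R) : 0 <= K ->
  (forall i, rcdiff (fun s => y s i) t (y' t i)) ->
  (forall i, Cmod (y' t i) <= K * norm1 (y t) + b) ->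
  exists l, is_derive (fun s => vnorm2 (y s)) t l /\
    l <= (2 * K + 1) * INR n ^ 2 * vnorm2 (y t) + b ^ 2.
Proof.
move=> K0 Hd Hb; eexists; split.
  by apply: is_derive_sumR => i; apply: rcdiff_Cnorm2; apply: Hd.
set N := norm1 (y t) in Hb.
apply: (Rle_trans _ (\big[Rplus/0]_(i < n) (2 * (K * N + b) * Cmod (y t i)))).
  apply: sumR_le => i; have := inner_re_le (y t i) (y' t i); have := Hb i.
  have := Cmod_ge0 (y t i); nra.
rewrite sumR_scal -/(norm1 _) -/N.
have := norm1_sqr_le (y t); rewrite -/N => H.
have : (2 * K + 1) * N ^ 2 <= (2 * K + 1) * (INR n ^ 2 * vnorm2 (y t)).
  by apply: Rmult_le_compat_l => //; lra.
have := pow2_ge_0 (N - b); nra.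
Qed.

(* Beyond the half-line the trajectory is continued by its tangent, to have two-sided
   derivatives at every [t >= 0]. *)
Definition extend {n} (x : R -> vec n) (v : vec n) (t : R) : vec n :=
  if Rle_dec 0 t then x t else vadd (x 0) (vscalR t v).

Definition trajectory {n} (G : vec n -> vec n) (x : R -> vec n) (z : vec n) : Prop :=
  x 0 = z /\ (forall t, 0 <= t -> ball (x t)) /\
  (forall t, 0 <= t -> has_deriv_on_halfline x t (G (x t))).

Lemma extend_ge0 (n : nat) (x : R -> vec n) (v : vec n) (t : R) : 0 <= t -> extend x v t = x t.
Proof. by rewrite /extend; case: Rle_dec. Qed.

Lemma extend_rcdiff (n : nat) (G : vec n -> vec n) (x : R -> vec n) (z : vec n) (t : R) (i : 'I_n) :
  trajectory G x z -> 0 <= t ->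
  rcdiff (fun s => extend x (G (x 0)) s i) t (G (x t) i).
Proof.
move=> [_ [_ Hx]] t0 e e0; case: (Hx t t0 e e0) => a [a0 Ha].
have K : forall s, 0 <= s -> Rabs (s - t) < a -> Cmod (x s i - x t i - RtoC (s - t) * G (x t) i)%cx <= e * Rabs (s - t).
  move=> s s0 hs; case: (Req_dec s t) => [->|N].
    have -> : (x t i - x t i - RtoC (t - t) * G (x t) i)%cx = 0%cx by cx_ring.
    by rewrite Cmod0; have := Rabs_pos (t - t); nra.
  have := Ha s s0 (conj (Rabs_pos_lt _ (Rminus_eq_contra _ _ N)) hs); apply: Rle_trans.
  exact: (Cmod_coord (vsub (vsub (x s) (x t)) (vscalR (s - t) (G (x t)))) i).
rewrite /extend; case: Rle_dec => // ?.
have [tp|E] : 0 < t \/ 0 = t by lra.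
  exists (Rmin a t); split; first exact: Rmin_pos.
  move=> s hs; have h1 := Rlt_le_trans _ _ _ hs (Rmin_l _ _); have h2 := Rlt_le_trans _ _ _ hs (Rmin_r _ _).
  case: Rle_dec => s0; first exact: K.
  by exfalso; move: h2; rewrite Rabs_left; lra.
subst t; exists a; split=> // s hs; case: Rle_dec => s0; first exact: K.
have -> : (vadd (x 0%R) (vscalR s (G (x 0%R))) i - x 0%R i - RtoC (s - 0) * G (x 0%R) i)%cx = 0%cx.
  by rewrite /vadd /vscalR /vscal; cx_ring.
by rewrite Cmod0; have := Rabs_pos (s - 0); nra.
Qed.

(** The difference quotients satisfy a Cauchy criterion at 0; the derivative is their limit along
    the real increments [s m], taken separately in real and imaginary part. *)
Lemma cdiff_of_cauchy (F : C -> C) (a : C) (h0 K : R) : 0 < h0 -> 0 <= K ->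
  (forall h k, 0 < Cmod h < h0 -> 0 < Cmod k < h0 ->
     Cmod ((F (a + h) - F a) / h - (F (a + k) - F a) / k)%cx <= K * (Cmod h + Cmod k)) ->
  exists d, cdiff F a d.
Proof.
move=> h00 K0 H; pose q h := ((F (a + h) - F a) / h)%cx.
pose s m := RtoC (h0 / 2 / INR (S m)).
have Sp : forall m, 0 < INR (S m) by move=> m; apply: lt_0_INR; lia.
have S1 : forall m, 1 <= INR (S m) by move=> m; rewrite S_INR; have := pos_INR m; lra.
have sm : forall m, Cmod (s m) = h0 / 2 / INR (S m).
  by move=> m; rewrite Cmod_RtoC Rabs_pos_eq //; apply/Rlt_le/Rdiv_lt_0_compat; [lra | exact: Sp].
have s_in : forall m, 0 < Cmod (s m) < h0.
  move=> m; rewrite sm; split; first by apply: Rdiv_lt_0_compat; [lra | exact: Sp].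
  apply/Rlt_div_l; first exact: Sp.
  have := S1 m; nra.
have s_small : forall e, 0 < e -> exists N, forall m, (m >= N)%coq_nat -> Cmod (s m) < e.
  move=> e e0; case: (archimed_cor1 (e / h0)); first exact: Rdiv_lt_0_compat.
  move=> N [HN N0]; exists N => m hm; rewrite sm.
  have : / INR (S m) <= / INR N.
    apply: Rinv_le_contravar; first by apply: lt_0_INR; lia.
    by apply: le_INR; lia.
  have := Rinv_0_lt_compat _ (Sp m) => i1 i2.
  have : / INR (S m) * h0 < e by apply/Rlt_div_r => //; lra.
  rewrite /Rdiv; nra.
have C1 : Cauchy_crit (fun m => fst (q (s m))).
  move=> e e0; case: (s_small (e / (2 * (K + 1)))) => [|N HN]; first by apply: Rdiv_lt_0_compat; lra.
  exists N => m m' hm hm'; rewrite /Rdist.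
  have -> : fst (q (s m)) - fst (q (s m')) = fst (q (s m) - q (s m'))%cx by cx_unfold; ring.
  apply: Rle_lt_trans (Cmod_fst _) _; apply: Rle_lt_trans (H _ _ (s_in m) (s_in m')) _.
  have := HN m hm; have := HN m' hm' => k1 k2.
  apply: (Rle_lt_trans _ ((K + 1) * (Cmod (s m) + Cmod (s m')))); first by have := s_in m; have := s_in m'; nra.
  have -> : e = (K + 1) * (e / (2 * (K + 1)) + e / (2 * (K + 1))) by field; lra.
  by apply: Rmult_lt_compat_l; lra.
have C2 : Cauchy_crit (fun m => snd (q (s m))).
  move=> e e0; case: (s_small (e / (2 * (K + 1)))) => [|N HN]; first by apply: Rdiv_lt_0_compat; lra.
  exists N => m m' hm hm'; rewrite /Rdist.
  have -> : snd (q (s m)) - snd (q (s m')) = snd (q (s m) - q (s m'))%cx by cx_unfold; ring.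
  apply: Rle_lt_trans (Cmod_snd _) _; apply: Rle_lt_trans (H _ _ (s_in m) (s_in m')) _.
  have := HN m hm; have := HN m' hm' => k1 k2.
  apply: (Rle_lt_trans _ ((K + 1) * (Cmod (s m) + Cmod (s m')))); first by have := s_in m; have := s_in m'; nra.
  have -> : e = (K + 1) * (e / (2 * (K + 1)) + e / (2 * (K + 1))) by field; lra.
  by apply: Rmult_lt_compat_l; lra.
case: (R_complete _ C1) => d1 H1; case: (R_complete _ C2) => d2 H2.
exists (d1, d2).
have lim : forall h, 0 < Cmod h < h0 -> Cmod (q h - (d1, d2)%R)%cx <= K * Cmod h.
  move=> h hh; apply: le_epsilon => e e0.
  case: (H1 (e / 3)) => [|N1 HN1]; first lra.
  case: (H2 (e / 3)) => [|N2 HN2]; first lra.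
  case: (s_small (e / (3 * (K + 1)))) => [|N3 HN3]; first by apply: Rdiv_lt_0_compat; lra.
  pose m := Nat.max N1 (Nat.max N2 N3).
  have m1 : (m >= N1)%coq_nat by rewrite /m; lia.
  have m2 : (m >= N2)%coq_nat by rewrite /m; lia.
  have m3 : (m >= N3)%coq_nat by rewrite /m; lia.
  have := HN1 m m1; have := HN2 m m2; have := HN3 m m3.
  rewrite /Rdist => k3 k2 k1.
  have := Cmod_dist3 (q h) (q (s m)) (d1, d2); have := H _ _ hh (s_in m); rewrite -/(q h) -/(q (s m)).
  have := Cmod_le_fst_snd (q (s m) - (d1, d2)%R)%cx.
  have -> : fst (q (s m) - (d1, d2)%R)%cx = fst (q (s m)) - d1 by cx_unfold; ring.
  have -> : snd (q (s m) - (d1, d2)%R)%cx = snd (q (s m)) - d2 by cx_unfold; ring.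
  have : K * Cmod (s m) <= e / 3.
    have -> : e / 3 = (K + 1) * (e / (3 * (K + 1))) by field; lra.
    have := s_in m; nra.
  lra.
move=> e e0; exists (Rmin h0 (e / (K + 1))); split; first by apply: Rmin_pos => //; apply: Rdiv_lt_0_compat; lra.
move=> h hh; have h1 := Rlt_le_trans _ _ _ hh (Rmin_l _ _); have h2 := Rlt_le_trans _ _ _ hh (Rmin_r _ _).
case: (Req_dec (Cmod h) 0) => [E|N].
  rewrite (Cmod_eq0 E); have -> : (F (a + 0) - F a - (d1, d2)%R * 0)%cx = (F (a + 0) - F a)%cx by ring.
  have -> : (a + 0)%cx = a by ring.
  have -> : (F a - F a)%cx = 0%cx by ring.
  by rewrite !Cmod0; lra.
have hp : 0 < Cmod h by have := Cmod_ge0 h; lra.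
have hn := Cmod_neq0 hp.
have -> : (F (a + h) - F a - (d1, d2)%R * h)%cx = ((q h - (d1, d2)%R) * h)%cx by rewrite /q; field.
rewrite Cmod_mul; apply: Rmult_le_compat_r; first lra.
apply: Rle_trans (lim h (conj hp h1)) _.
have : Cmod h * (K + 1) < e by apply/Rlt_div_r => //; lra.
nra.
Qed.

Section Flow.
Variables (n : nat) (G : vec n -> vec n) (dG : vec n -> vec n -> vec n).
Hypothesis G_diff : forall z, ball z -> is_cderiv G z (dG z).

Lemma trajectory_continuous (x : R -> vec n) (z : vec n) (t : R) : trajectory G x z -> 0 <= t ->
  forall e, 0 < e -> exists delta, 0 < delta /\
    forall s, 0 <= s -> Rabs (s - t) < delta -> norm1 (vsub (x s) (x t)) < e.
Proof.
move=> [_ [_ Hx]] t0 e e0; case: (Hx t t0 1 Rlt_0_1) => a [a0 Ha].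
set v := norm1 (G (x t)); have v0 : 0 <= v by exact: norm1_ge0.
have N0 := pos_INR n.
exists (Rmin a (e / (INR n + v + 1))); split; first by apply: Rmin_pos => //; apply: Rdiv_lt_0_compat; lra.
move=> s s0 hs; have h1 := Rlt_le_trans _ _ _ hs (Rmin_l _ _); have h2 := Rlt_le_trans _ _ _ hs (Rmin_r _ _).
case: (Req_dec s t) => [->|N].
  have -> : vsub (x t) (x t) = vzero by apply: vec_ext => i; rewrite /vsub /vzero; ring.
  by rewrite norm1_zero.
have sp := Rabs_pos_lt _ (Rminus_eq_contra _ _ N).
have := Ha s s0 (conj sp h1); set w := vsub (vsub _ _) _ => hw.
have -> : vsub (x s) (x t) = vadd w (vscalR (s - t) (G (x t))).
  by apply: vec_ext => i; rewrite /w /vadd /vsub; ring.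
apply: Rle_lt_trans (norm1_add _ _) _; rewrite norm1_scal Cmod_RtoC -/v.
have := norm1_le_vnorm w => k.
have : Rabs (s - t) * (INR n + v + 1) < e by apply/Rlt_div_r => //; lra.
nra.
Qed.

(* The reciprocal of the radius also serves as the bound, so that compactness of [[0, T]]
   makes both uniform at once. *)
Let controlled (p : vec n) (r : R) : Prop :=
  (forall h i, Cmod (dG p h i) <= / r * norm1 h) /\
  (forall x i, norm1 (vsub x p) < r -> ball x /\
     Cmod (G x i - G p i)%cx <= / r * norm1 (vsub x p) /\
     Cmod (G x i - G p i - dG p (vsub x p) i)%cx <= / r * norm1 (vsub x p) ^ 2).

Lemma controlled_le (p : vec n) (r r' : R) : 0 < r' -> r' <= r -> controlled p r -> controlled p r'.
Proof.
move=> r0 rr [H1 H2]; have ir : / r <= / r' by apply: Rinv_le_contravar.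
split=> [h i|x i hx].
  by apply: Rle_trans (H1 h i) _; apply: Rmult_le_compat_r => //; exact: norm1_ge0.
case: (H2 x i (Rlt_le_trans _ _ _ hx rr)) => [B [K1 K2]]; split=> //; split.
  by apply: Rle_trans K1 _; apply: Rmult_le_compat_r => //; exact: norm1_ge0.
by apply: Rle_trans K2 _; apply: Rmult_le_compat_r => //; exact: pow2_ge_0.
Qed.

Lemma trajectory_controlled (x : R -> vec n) (z : vec n) (T : R) : trajectory G x z ->
  exists r, 0 < r /\ forall t, 0 <= t <= T -> controlled (x t) r.
Proof.
move=> Hx.
have L : forall t, 0 <= t -> exists r : posreal, forall s, 0 <= s -> Rabs (s - t) < r -> controlled (x s) r.
  move=> t t0; case: (local_estimates G_diff (proj1 (proj2 Hx) t t0)) => d [K [d0 [K0 [E1 [E2 [E3 E4]]]]]].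
  case: (trajectory_continuous Hx t0 (e := d / 2)) => [|a [a0 Ha]]; first lra.
  have r0 : 0 < Rmin a (Rmin (d / 2) (/ K)).
    by repeat apply: Rmin_pos => //; [lra | exact: Rinv_0_lt_compat].
  exists (mkposreal _ r0) => s s0 /= hs.
  have := Rmin_l a (Rmin (d / 2) (/ K)); have := Rmin_r a (Rmin (d / 2) (/ K)).
  have := Rmin_l (d / 2) (/ K); have := Rmin_r (d / 2) (/ K); move: r0 hs.
  set r := Rmin a _ => r0 hs q1 q2 q3 q4.
  have xs := Ha s s0 ltac:(lra).
  have rK : K <= / r by rewrite -(Rinv_inv K); apply: Rinv_le_contravar; lra.
  have tri : forall y, norm1 (vsub y (x s)) < r -> norm1 (vsub y (x t)) < d.
    move=> y hy; have -> : vsub y (x t) = vadd (vsub y (x s)) (vsub (x s) (x t)).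
      by apply: vec_ext => i; rewrite /vadd /vsub; ring.
    apply: Rle_lt_trans (norm1_add _ _) _; lra.
  split=> [h i|y i hy].
    apply: Rle_trans (E2 _ h i _) _; first lra.
    by apply: Rmult_le_compat_r => //; exact: norm1_ge0.
  have hy' := tri y hy; have xs' : norm1 (vsub (x s) (x t)) < d by lra.
  split; first exact: E1.
  split.
    by apply: Rle_trans (E3 _ _ i hy' xs') _; apply: Rmult_le_compat_r => //; exact: norm1_ge0.
  by apply: Rle_trans (E4 _ _ i hy' xs') _; apply: Rmult_le_compat_r => //; exact: pow2_ge_0.
pose one := mkposreal 1 Rlt_0_1.
pose P t (r : posreal) := forall s, 0 <= s -> Rabs (s - t) < r -> controlled (x s) r.
pose delta t := epsilon (inhabits one) (P t).
have deltaP : forall t, 0 <= t -> P t (delta t).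
  by move=> t t0; exact: (epsilon_spec (inhabits one) (P t) (L t t0)).
(* Up to a double negation, each [s] lies within [delta t] of some time [t] with [d <= delta t]. *)
case: (compactness_value_1d 0 T delta) => d Hd; exists d; split; first exact: cond_pos.
move=> s hs; apply: NNPP => N; apply: (Hd s hs) => -[t [ht [h1 h2]]]; apply: N.
apply: (controlled_le (cond_pos d) h2); apply: deltaP; lra.
Qed.

Variable X : vec n -> R -> vec n.
Hypothesis X_traj : forall z, ball z -> trajectory G (X z) z.

(** Gronwall is used twice: on the distance of two trajectories, to bound it by a multiple of [h],
    and on the difference of two difference quotients, which starts at 0 and obeys the linearised
    equation up to an error of order [|h| + |k|]. The second bound is the Cauchy criterion, so the
    variational equation is never solved. *)
Lemma flow_line_cdiff (z v : vec n) (a : C) (T : R) (i : 'I_n) : 0 <= T ->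
  ball (vadd z (vscal a v)) ->
  exists d, cdiff (fun b => X (vadd z (vscal b v)) T i) a d.
Proof.
move=> T0 B; set p := vadd z (vscal a v) in B.
pose p_ h := vadd z (vscal (a + h) v).
have pE : forall h, p_ h = vadd p (vscal h v).
  by move=> h; apply: vec_ext => j; rewrite /p_ /p /vadd /vscal; ring.
have Hx := X_traj B; set x := X p in Hx.
case: (trajectory_controlled T Hx) => r [r0 Hr].
case: (ball_open B) => b0 [b00 Hb0].
have N0 := pos_INR n; have v0 := norm1_ge0 v; have ir : 0 < / r by exact: Rinv_0_lt_compat.
pose kappa := (2 * / r + 1) * INR n ^ 2.
have k0 : 0 <= kappa by apply: Rmult_le_pos; [lra | exact: pow2_ge_0].
(* If the squared norm is at most [bar], then [norm1] is below [r], because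
   [norm1 ^ 2 <= n ^ 2 * vnorm2]. *)
pose bar := r ^ 2 / (2 * (INR n ^ 2 + 1)).
have n20 := pow2_ge_0 (INR n).
have bar0 : 0 < bar by apply: Rdiv_lt_0_compat; [exact: pow_lt | lra].
pose V := norm1 v ^ 2 * exp (kappa * T).
have V0 : 0 <= V by apply: Rmult_le_pos; [exact: pow2_ge_0 | exact/Rlt_le/exp_pos].
pose h0 := Rmin (Rmin 1 (bar / (V + 1))) (b0 / (norm1 v + 1)).
have h00 : 0 < h0 by repeat apply: Rmin_pos; try lra; apply: Rdiv_lt_0_compat; lra.
have hball : forall h, Cmod h < h0 -> ball (p_ h).
  move=> h hh; rewrite pE; apply: Hb0.
  have -> : vsub (vadd p (vscal h v)) p = vscal h v by apply: vec_ext => j; rewrite /vsub /vadd; ring.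
  rewrite norm1_scal.
  have : Cmod h < b0 / (norm1 v + 1) by apply: Rlt_le_trans hh (Rmin_r _ _).
  have v1 : 0 < norm1 v + 1 by lra.
  have := Cmod_ge0 h => c0 /(Rlt_div_r _ _ _ v1) c1; nra.
pose xe := extend x (G (x 0)).
pose xh h := extend (X (p_ h)) (G (X (p_ h) 0)).
pose y h t : vec n := vsub (xh h t) (xe t).
have xe_ge0 : forall t, 0 <= t -> xe t = x t by move=> t t0; exact: extend_ge0.
have xh_ge0 : forall h t, 0 <= t -> xh h t = X (p_ h) t by move=> h t t0; exact: extend_ge0.
have dxe : forall t j, 0 <= t -> rcdiff (fun s => xe s j) t (G (x t) j).
  by move=> t j t0; exact: extend_rcdiff Hx t0.
have dxh : forall h t j, Cmod h < h0 -> 0 <= t -> rcdiff (fun s => xh h s j) t (G (X (p_ h) t) j).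
  by move=> h t j hh t0; exact: extend_rcdiff (X_traj (hball h hh)) t0.
have x0E : x 0 = p by case: Hx.
have xh0E : forall h, Cmod h < h0 -> X (p_ h) 0 = p_ h by move=> h hh; case: (X_traj (hball h hh)).
have cont_vnorm2 : forall (f f' : R -> vec n) t, (forall j, rcdiff (fun s => f s j) t (f' t j)) ->
    continuity_pt (fun s => vnorm2 (f s)) t.
  move=> f f' t H; exact: is_derive_continuity_pt (is_derive_sumR (fun j => rcdiff_Cnorm2 (H j))).
(* The barrier keeps the perturbed trajectory within the radius [r] on which the Lipschitz bound
   around [x t] holds; [h0] is small enough for [Cmod h ^ 2 * V] to stay below it. *)
have near : forall h t, Cmod h < h0 -> 0 <= t <= T -> vnorm2 (y h t) <= Cmod h ^ 2 * V /\ norm1 (vsub (X (p_ h) t) (x t)) < r.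
  move=> h t hh ht; have hp := Cmod_ge0 h.
  have hV : Cmod h ^ 2 * V < bar.
    have h1 : Cmod h < 1 by apply: Rlt_le_trans hh (Rle_trans _ _ _ (Rmin_l _ _) (Rmin_l _ _)).
    have : Cmod h < bar / (V + 1) by apply: Rlt_le_trans hh (Rle_trans _ _ _ (Rmin_l _ _) (Rmin_r _ _)).
    have V1 : 0 < V + 1 by lra.
    move=> /(Rlt_div_r _ _ _ V1) h2; nra.
  have small : forall t, 0 <= t -> vnorm2 (y h t) <= bar -> norm1 (vsub (X (p_ h) t) (x t)) < r.
    move=> t' t0 hb; rewrite -(xe_ge0 _ t0) -(xh_ge0 _ _ t0).
    have := norm1_sqr_le (y h t') => q1.
    have q2 : INR n ^ 2 * vnorm2 (y h t') <= INR n ^ 2 * bar by apply: Rmult_le_compat_l.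
    have q3 : INR n ^ 2 * bar < r ^ 2.
      have -> : INR n ^ 2 * bar = (INR n ^ 2 * r ^ 2) / (2 * (INR n ^ 2 + 1)) by rewrite /bar; field; lra.
      apply/Rlt_div_l; first lra.
      have : 0 < r ^ 2 by exact: pow_lt.
      nra.
    apply: Rnot_le_lt => q4.
    have : r ^ 2 <= norm1 (y h t') ^ 2 by apply: pow_incr; split; [lra | exact: q4].
    lra.
  have dy : forall t j, 0 <= t -> rcdiff (fun s => y h s j) t (vsub (G (X (p_ h) t)) (G (x t)) j).
    by move=> t' j t0; apply: rcdiff_sub; [exact: dxh | exact: dxe].
  have E : forall t, 0 <= t <= T -> vnorm2 (y h t) <= (Cmod h ^ 2 * norm1 v ^ 2 + 0 * t) * exp (kappa * t).
    apply: (@gronwall_barrier (fun t => vnorm2 (y h t)) T (Cmod h ^ 2 * norm1 v ^ 2) 0 kappa bar) => //; try lra.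
    - by apply: Rmult_le_pos; exact: pow2_ge_0.
    - rewrite /y xe_ge0 ?xh_ge0; try lra; rewrite xh0E // x0E pE.
      have -> : vsub (vadd p (vscal h v)) p = vscal h v by apply: vec_ext => j; rewrite /vsub /vadd; ring.
      by apply: Rle_trans (vnorm2_le_norm1 _) _; rewrite norm1_scal Rpow_mult_distr; lra.
    - by rewrite Rmult_0_l Rplus_0_r Rmult_assoc -/V.
    - by move=> t' t0; apply: (cont_vnorm2 _ (fun t => vsub (G (X (p_ h) t)) (G (x t)))) => j; apply: dy; lra.
    - move=> t' t0 hb; have tn := small t' ltac:(lra) hb.
      have := @energy_derive n (y h) (fun t => vsub (G (X (p_ h) t)) (G (x t))) t' (/ r) 0 ltac:(lra).
      case.
      + by move=> j; apply: dy; lra.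
      + move=> j; have [_ HT] := Hr t' ltac:(lra); have [_ [K1 _]] := HT _ j tn.
        by rewrite /y xe_ge0 ?xh_ge0; try lra; rewrite Rplus_0_r.
      + by move=> l [Dl Hl]; exists l; split=> //; rewrite /kappa; lra.
  have Et : vnorm2 (y h t) <= Cmod h ^ 2 * V.
    apply: Rle_trans (E t ht) _; rewrite Rmult_0_l Rplus_0_r /V Rmult_assoc.
    apply: Rmult_le_compat_l; first exact: pow2_ge_0.
    apply: Rmult_le_compat_l; first exact: pow2_ge_0.
    have : kappa * t <= kappa * T by nra.
    by case=> [/exp_increasing|->]; lra.
  by split=> //; apply: small; lra.
pose C1 := / r * (INR n ^ 2 * V).
have C10 : 0 <= C1 by apply: Rmult_le_pos; [lra | apply: Rmult_le_pos].
pose C2 := C1 ^ 2 * T * exp (kappa * T).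
have C20 : 0 <= C2.
  by apply: Rmult_le_pos; [apply: Rmult_le_pos => //; exact: pow2_ge_0 | exact/Rlt_le/exp_pos].
apply: (@cdiff_of_cauchy _ a h0 (sqrt C2)) => //; first exact: sqrt_pos.
move=> h k [h1 h2] [k1 k2].
have hn := Cmod_neq0 h1; have kn := Cmod_neq0 k1.
pose w t : vec n := vsub (vscal (Cinv h) (y h t)) (vscal (Cinv k) (y k t)).
pose w' t : vec n := vsub (vscal (Cinv h) (vsub (G (X (p_ h) t)) (G (x t)))) (vscal (Cinv k) (vsub (G (X (p_ k) t)) (G (x t)))).
have dw : forall t j, 0 <= t -> rcdiff (fun s => w s j) t (w' t j).
  by move=> t j t0; apply: rcdiff_sub; apply: rcdiff_scal; apply: rcdiff_sub; (exact: dxh || exact: dxe).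
have rem : forall h t j, 0 < Cmod h < h0 -> 0 <= t <= T ->
   Cmod (Cinv h * (G (X (p_ h) t) j - G (x t) j - dG (x t) (vsub (X (p_ h) t) (x t)) j))%cx <= C1 * Cmod h.
  move=> g t j [g1 g2] ht; have [q1 q2] := near g t g2 ht.
  have [_ HT] := Hr t ht; have [_ [_ K2]] := HT _ j q2.
  rewrite Cmod_mul Cmod_inv; last exact: Cmod_neq0.
  have q3 := norm1_sqr_le (y g t); move: q3; rewrite {1}/y xe_ge0 ?xh_ge0; try lra; move=> q3.
  have q4 : norm1 (vsub (X (p_ g) t) (x t)) ^ 2 <= INR n ^ 2 * (Cmod g ^ 2 * V).
    by apply: Rle_trans q3 _; apply: Rmult_le_compat_l.
  have q5 : / r * norm1 (vsub (X (p_ g) t) (x t)) ^ 2 <= C1 * Cmod g * Cmod g.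
    have -> : C1 * Cmod g * Cmod g = / r * (INR n ^ 2 * (Cmod g ^ 2 * V)) by rewrite /C1; ring.
    by apply: Rmult_le_compat_l => //; lra.
  by rewrite Rmult_comm; apply/Rle_div_l => //; lra.
(* The inequality for [w] holds whatever the size of [w], so the barrier is simply put 1 above the
   final bound. *)
have E : forall t, 0 <= t <= T -> vnorm2 (w t) <= (0 + (C1 * (Cmod h + Cmod k)) ^ 2 * t) * exp (kappa * t).
  apply: (@gronwall_barrier (fun t => vnorm2 (w t)) T 0 ((C1 * (Cmod h + Cmod k)) ^ 2) kappa
     ((0 + (C1 * (Cmod h + Cmod k)) ^ 2 * T) * exp (kappa * T) + 1)); try lra.
  - exact: pow2_ge_0.
  - have -> : w 0 = vzero; last by apply: Rle_trans (vnorm2_le_norm1 _) _; rewrite norm1_zero; lra.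
    rewrite /w /y xe_ge0 ?xh_ge0; try lra; rewrite !xh0E // x0E !pE.
    by apply: vec_ext => j; rewrite /vsub /vscal /vadd /vzero; field.
  - by move=> t t0; apply: (cont_vnorm2 _ w') => j; apply: dw; lra.
  - move=> t t0 _; have := @energy_derive n w w' t (/ r) (C1 * (Cmod h + Cmod k)) ltac:(lra).
    case.
    + by move=> j; apply: dw; lra.
    + move=> j; have [HT _] := Hr t ltac:(lra).
      have Lx : Clinear (dG (x t)) by apply: (dG_linear G_diff); apply: (proj1 (proj2 Hx)); lra.
      have wE : w t = vsub (vscal (Cinv h) (vsub (X (p_ h) t) (x t))) (vscal (Cinv k) (vsub (X (p_ k) t) (x t))).
        by rewrite /w /y xe_ge0 ?xh_ge0 //; lra.
      have := HT (w t) j; have := rem h t j (conj h1 h2) ltac:(lra); have := rem k t j (conj k1 k2) ltac:(lra).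
      set Rh := (Cinv h * _)%cx; set Rk := (Cinv k * _)%cx => s1 s2 s3.
      have -> : w' t j = (dG (x t) (w t) j + (Rh - Rk))%cx.
        by rewrite wE clinear_sub // !clinear_scal // /w' /Rh /Rk /vsub /vscal; ring.
      apply: Rle_trans (Cmod_add _ _) _; have := Cmod_sub Rh Rk; lra.
    + by move=> l [Dl Hl]; exists l; split=> //; rewrite /kappa; lra.
have := E T ltac:(lra) => ET.
have {ET} : Cnorm2 (w T i) <= C2 * (Cmod h + Cmod k) ^ 2.
  apply: Rle_trans (Cnorm2_coord _ _) _; apply: Rle_trans ET _; apply: Req_le; rewrite /C2; ring.
have -> : ((X (vadd z (vscal (a + h) v)) T i - X (vadd z (vscal a v)) T i) / h -
   (X (vadd z (vscal (a + k) v)) T i - X (vadd z (vscal a v)) T i) / k)%cx = w T i.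
  rewrite /w /y xe_ge0 ?xh_ge0 // -/p -/(p_ h) -/(p_ k) -/x.
  set A := X (p_ h) T; set B' := X (p_ k) T; set D := x T.
  by rewrite /vsub /vscal; field.
move=> ET; apply: Cmod_square_le; first by apply: Rmult_le_pos; [exact: sqrt_pos | lra].
by rewrite Rpow_mult_distr pow2_sqrt.
Qed.

End Flow.

Lemma inf_generator_flow (n : nat) (G : vec n -> vec n) : inf_generator G ->
  exists X : vec n -> R -> vec n, forall z, ball z -> trajectory G (X z) z.
Proof.
move=> HG.
exists (fun z => epsilon (inhabits (fun _ => z)) (fun x => trajectory G x z)) => z hz.
apply: (epsilon_spec (inhabits (fun _ => z)) (fun x => trajectory G x z)).
case: (HG z hz) => x [H1 [H2 H3]]; exists x; split=> //; exact: vec_ext.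
Qed.

(** * Differentiation rules along real curves *)

Lemma rcdiff_comp (f : R -> C) (F : C -> C) (t : R) (d d' : C) :
  rcdiff f t d -> cdiff F (f t) d' -> rcdiff (fun s => F (f s)) t (d' * d)%cx.
Proof.
move=> Hf HF e e0; have d0 := Cmod_ge0 d; have d0' := Cmod_ge0 d'.
case: (HF (e / (2 * (Cmod d + 1)))) => [|b [b0 Hb]]; first by apply: Rdiv_lt_0_compat; lra.
have m0 : 0 < Rmin 1 (e / (2 * (Cmod d' + 1))) by apply: Rmin_pos; [lra | apply: Rdiv_lt_0_compat; lra].
case: (Hf _ m0) => a [a0 Ha].
exists (Rmin a (b / (Cmod d + 1))); split; first by apply: Rmin_pos => //; apply: Rdiv_lt_0_compat; lra.
move=> s hs; have h1 := Rlt_le_trans _ _ _ hs (Rmin_l _ _); have h2 := Rlt_le_trans _ _ _ hs (Rmin_r _ _).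
have {}Ha := Ha s h1; have st := Rabs_pos (s - t).
have := Rmin_l 1 (e / (2 * (Cmod d' + 1))); have := Rmin_r 1 (e / (2 * (Cmod d' + 1))) => r2 r1.
set k := (f s - f t)%cx in Ha.
have kb : Cmod k <= (Cmod d + 1) * Rabs (s - t).
  have := Cmod_le_sub k (RtoC (s - t) * d)%cx; rewrite Cmod_mul Cmod_RtoC; nra.
have d1 : 0 < Cmod d + 1 by lra.
have kb2 : Cmod k < b by move: h2 => /(Rlt_div_r _ _ _ d1); lra.
have {}Hb := Hb k kb2; have Ek : (f t + k)%cx = f s by rewrite /k; ring.
rewrite Ek in Hb.
have -> : (F (f s) - F (f t) - RtoC (s - t) * (d' * d))%cx =
  ((F (f s) - F (f t) - d' * k) + d' * (k - RtoC (s - t) * d))%cx by ring.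
apply: Rle_trans (Cmod_add _ _) _; rewrite Cmod_mul.
have Q1 : e / (2 * (Cmod d + 1)) * Cmod k <= e / 2 * Rabs (s - t).
  apply: (Rle_trans _ (e / (2 * (Cmod d + 1)) * ((Cmod d + 1) * Rabs (s - t)))).
    by apply: Rmult_le_compat_l => //; apply/Rlt_le/Rdiv_lt_0_compat; lra.
  by apply: Req_le; field; lra.
have Q2 : Cmod d' * Cmod (k - RtoC (s - t) * d)%cx <= e / 2 * Rabs (s - t).
  apply: (Rle_trans _ ((Cmod d' + 1) * (e / (2 * (Cmod d' + 1)) * Rabs (s - t)))); last first.
    by apply: Req_le; field; lra.
  apply: Rmult_le_compat => //; [exact: Cmod_ge0 | lra |].
  by apply: Rle_trans Ha _; apply: Rmult_le_compat_r.
lra.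
Qed.

Lemma rcdiff_val (f : R -> C) (t : R) (d d' : C) : rcdiff f t d -> d = d' -> rcdiff f t d'.
Proof. by move=> H <-. Qed.

Lemma rcdiff_ext (f g : R -> C) (t : R) (d : C) : (forall s, f s = g s) -> rcdiff f t d -> rcdiff g t d.
Proof. by move=> E; have -> : f = g by exact: functional_extensionality. Qed.

Lemma rcdiff_const (a : C) (t : R) : rcdiff (fun _ => a) t 0.
Proof.
move=> e e0; exists 1; split; first lra; move=> s _.
have -> : (a - a - RtoC (s - t) * 0)%cx = 0%cx by ring.
by rewrite Cmod0; have := Rabs_pos (s - t); nra.
Qed.

Lemma rcdiff_add (f g : R -> C) (t : R) (d d' : C) :
  rcdiff f t d -> rcdiff g t d' -> rcdiff (fun s => f s + g s)%cx t (d + d')%cx.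
Proof.
move=> Hf /(@rcdiff_scal _ _ (- (1))%cx) Hg.
apply: (rcdiff_val (d := d - (- (1)) * d')%cx); last by ring.
by apply: rcdiff_ext (rcdiff_sub Hf Hg) => s /=; ring.
Qed.

Lemma rcdiff_mul (f g : R -> C) (t : R) (d d' : C) :
  rcdiff f t d -> rcdiff g t d' -> rcdiff (fun s => f s * g s)%cx t (d * g t + f t * d')%cx.
Proof.
move=> Hf Hg.
have S := rcdiff_comp (rcdiff_add Hf Hg) (cdiff_sqr _).
have D := rcdiff_comp (rcdiff_sub Hf Hg) (cdiff_sqr _).
have Q := rcdiff_scal (RtoC (/ 4)) (rcdiff_sub S D).
apply: rcdiff_val; first apply: rcdiff_ext Q => x /=.
  by apply C_ext; cx_unfold; field.
by apply C_ext; cx_unfold; field.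
Qed.

Lemma rcdiff_div (f g : R -> C) (t : R) (d d' : C) : g t <> 0%cx ->
  rcdiff f t d -> rcdiff g t d' ->
  rcdiff (fun s => f s / g s)%cx t ((d * g t - f t * d') / (g t * g t))%cx.
Proof.
move=> g0 Hf Hg.
apply: rcdiff_val; first exact: (rcdiff_mul Hf (rcdiff_comp Hg (cdiff_inv g0))).
by cbv beta; field.
Qed.

Lemma rcdiff_inner (n : nat) (f : R -> vec n) (f' c : vec n) (t : R) :
  (forall i, rcdiff (fun s => f s i) t (f' i)) ->
  rcdiff (fun s => inner (f s) c) t (inner f' c).
Proof.
rewrite /inner; elim: n f f' c => [|n IH] f f' c H.
  rewrite big_ord0; apply: (rcdiff_ext (f := fun _ => 0%cx)); last exact: rcdiff_const.
  by move=> s; rewrite big_ord0.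
rewrite big_ord_recr; apply: (rcdiff_ext (f := fun s => (\big[Cadd/Czero]_(i < n)
   Cmul (f s (widen_ord (leqnSn n) i)) (Cconj (c (widen_ord (leqnSn n) i))) + f s ord_max * Cconj (c ord_max))%cx)).
  by move=> s; rewrite big_ord_recr.
apply: rcdiff_add.
  apply: (IH (fun s i => f s (widen_ord (leqnSn n) i)) (fun i => f' (widen_ord (leqnSn n) i)) (fun i => c (widen_ord (leqnSn n) i))) => i.
  exact: H.
apply: rcdiff_val; first exact: rcdiff_mul (H ord_max) (rcdiff_const _ _).
by cbv beta; ring.
Qed.

Lemma cdiff_inner (n : nat) (f : C -> vec n) (c : vec n) (a : C) :
  (forall i, exists d, cdiff (fun b => f b i) a d) ->
  exists d, cdiff (fun b => inner (f b) c) a d.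
Proof.
rewrite /inner; elim: n f c => [|n IH] f c H.
  exists 0%cx; apply: (cdiff_ext (F := fun _ => 0%cx)); last exact: cdiff_const.
  by move=> s; rewrite big_ord0.
case: (IH (fun s i => f s (widen_ord (leqnSn n) i)) (fun i => c (widen_ord (leqnSn n) i))).
  by move=> i; apply: H.
move=> d Hd; case: (H ord_max) => d' Hd'; eexists.
apply: (cdiff_ext (F := fun s => (\big[Cadd/Czero]_(i < n)
   Cmul (f s (widen_ord (leqnSn n) i)) (Cconj (c (widen_ord (leqnSn n) i))) + f s ord_max * Cconj (c ord_max))%cx)).
  by move=> s; rewrite big_ord_recr.
by apply: cdiff_add Hd (cdiff_mul Hd' (cdiff_const _ _)).
Qed.

Lemma inner_basis (n : nat) (v : vec n) (i : 'I_n) : inner v (basis n i) = v i.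
Proof.
rewrite /inner (bigD1 i) //= big1 => [|j ji].
  by rewrite /basis eqxx /Cone; cx_ring.
have -> : basis n i j = 0%cx by rewrite /basis (_ : (nat_of_ord j == i) = false) //; exact: negbTE.
by cx_ring.
Qed.

(** * Siegel coordinates *)

(* In the Siegel model [(w, v) = ((1 + z_1) / (1 - z_1), z'' / (1 - z_1))] of the ball,
   [siegel c] is [w - 2 <v, c> + |c|^2], whose real part is [- uB z + |v - c|^2]. Hence it
   maps the ball to the right half-plane, and along the complex geodesic [v = c] through
   [e_1] its real part is exactly [- uB]. *)

Section Siegel.
Variables (n : nat) (i0 : 'I_n).
Hypothesis i0_0 : nat_of_ord i0 = 0%N.

Lemma coord1E (z : vec n) : coord1 z = z i0.
Proof. by rewrite /coord1 -i0_0 inner_basis. Qed.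

Lemma basis0E (i : 'I_n) : basis n 0 i = if i == i0 then 1%cx else 0%cx.
Proof. by rewrite /basis -i0_0. Qed.

Lemma ball_coord1_neq1 (z : vec n) : ball z -> (1 - z i0)%cx <> 0%cx.
Proof.
move=> hz E; have E1 : z i0 = 1%cx.
  by transitivity (1 - (1 - z i0))%cx; [ring | rewrite E; ring].
have := Cnorm2_coord z i0; rewrite E1 /ball in hz *; rewrite /Cnorm2 /=; lra.
Qed.

Definition siegel (c z : vec n) : C :=
  (RtoC 2 * (1 - inner z c) / (1 - z i0) - 1 + RtoC (vnorm2 c))%cx.

Definition dsiegel (c z w : vec n) : C :=
  (RtoC 2 * ((1 - inner z c) * w i0 - inner w c * (1 - z i0)) / ((1 - z i0) * (1 - z i0)))%cx.

(** The vector [(1 - z_1) (v - c)] of the Siegel model, with first entry 0 when [c i0 = 0]. It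
    measures how far [z] is from the slice [v = c]. *)
Definition defect (c z : vec n) : vec n :=
  fun i => (z i - (if i == i0 then z i0 else 0) - (1 - z i0) * c i)%cx.

Lemma sum_inner_re (z c : vec n) (k : C) :
  fst (inner z c * k)%cx = \big[Rplus/0]_(i < n) fst (z i * Cconj (c i) * k)%cx.
Proof.
rewrite /inner (big_morph (fun a => fst (a * k)%cx) (id1 := 0) (op1 := Rplus)) //.
- by move=> a b; cx_unfold; ring.
- by cx_unfold; ring.
Qed.

Lemma defect_norm (c z : vec n) : c i0 = 0%cx ->
  vnorm2 (defect c z) = vnorm2 z - Cnorm2 (z i0) - 2 * fst (inner z c * Cconj (1 - z i0))%cx
     + vnorm2 c * Cnorm2 (1 - z i0)%cx.
Proof.
move=> c0.
have -> : Cnorm2 (z i0) = \big[Rplus/0]_(i < n) (if i == i0 then Cnorm2 (z i0) else 0).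
  by rewrite -big_mkcond big_pred1_eq.
rewrite sum_inner_re.
(* Every term becomes a sum with a coefficient, so that the identity can be checked coordinate by
   coordinate. *)
have -> : forall a b c d : R, a - b - 2 * c + d = a + (-1) * b + (-2) * c + d by move=> *; ring.
rewrite (Rmult_comm (vnorm2 c)) /vnorm2 -!sumR_scal -!sumR_add; apply: eq_bigr => i _.
rewrite /defect; case: eqP => [->|_]; rewrite ?c0; cx_unfold; ring.
Qed.

Lemma siegel_re (c z : vec n) : c i0 = 0%cx -> (1 - z i0)%cx <> 0%cx ->
  Cnorm2 (1 - z i0)%cx * fst (siegel c z) = 1 - vnorm2 z + vnorm2 (defect c z).
Proof.
move=> c0 z1; rewrite defect_norm // /siegel; have D := Cnorm2_gt0 z1.
move: D; set a := inner z c; set b := z i0; set N := vnorm2 c; set M := vnorm2 z.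
by move=> D; cx_unfold; move: D; cx_unfold => D; field; lra.
Qed.

Lemma siegel_re_ge0 (c z : vec n) : c i0 = 0%cx -> ball z -> 0 <= fst (siegel c z).
Proof.
move=> c0 hz; have z1 := ball_coord1_neq1 hz; have := siegel_re c0 z1; have D := Cnorm2_gt0 z1.
have := vnorm2_ge0 (defect c z); rewrite /ball in hz; nra.
Qed.

(** The complex line through [e_1] and [c]. For [c i0 = 0] it is the geodesic [v = c], with
    parameter [t = 1 - z_1], and [tau c] inverts the Siegel coordinate along it. *)
Definition slice (c : vec n) (t : C) : vec n := vadd (basis n 0) (vscal t (vsub c (basis n 0))).
Definition tau (c : vec n) (w : C) : C := (RtoC 2 / (w + RtoC (1 + vnorm2 c)))%cx.

Lemma slice_i0 (c : vec n) (t : C) : c i0 = 0%cx -> slice c t i0 = (1 - t)%cx.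
Proof. by move=> c0; rewrite /slice /vadd /vscal /vsub basis0E eqxx c0; ring. Qed.

Lemma slice_i (c : vec n) (t : C) (i : 'I_n) : i != i0 -> slice c t i = (t * c i)%cx.
Proof. by move=> ii; rewrite /slice /vadd /vscal /vsub basis0E (negbTE ii); ring. Qed.

Lemma inner_self (c : vec n) : inner c c = RtoC (vnorm2 c).
Proof.
rewrite /inner /vnorm2 (big_morph RtoC (id1 := Czero) (op1 := Cadd)) //; last by move=> a b; cx_ring.
by apply: eq_bigr => i _; cx_ring.
Qed.

Lemma inner_slice (c : vec n) (t : C) : c i0 = 0%cx -> inner (slice c t) c = (t * RtoC (vnorm2 c))%cx.
Proof.
move=> c0; rewrite -inner_self /inner (big_morph (fun a => t * a)%cx (id1 := Czero) (op1 := Cadd)).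
- apply: eq_bigr => i _; case: (eqVneq i i0) => [->|ii]; first by rewrite c0; cx_ring.
  by rewrite slice_i //; ring.
- by move=> a b; ring.
- by ring.
Qed.

Lemma siegel_slice (c : vec n) (t : C) : c i0 = 0%cx -> t <> 0%cx ->
  siegel c (slice c t) = (RtoC 2 / t - RtoC (1 + vnorm2 c))%cx.
Proof.
move=> c0 t0; rewrite /siegel inner_slice // slice_i0 //.
have -> : (1 - (1 - t))%cx = t by ring.
set N := vnorm2 c; have -> : RtoC (1 + N) = (1 + RtoC N)%cx by cx_ring.
have -> : (RtoC 2 = 1 + 1)%cx by cx_ring.
by field.
Qed.

Lemma defect_slice (c : vec n) (t : C) : c i0 = 0%cx -> defect c (slice c t) = vzero.
Proof.
move=> c0; apply: vec_ext => i; rewrite /defect slice_i0 // /vzero.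
case: eqP => [->|/eqP ii]; first by rewrite slice_i0 // c0; ring.
by rewrite slice_i //; ring.
Qed.

Lemma vnorm2_zero : vnorm2 (@vzero n) = 0.
Proof. by rewrite /vnorm2 big1 // => i _; rewrite /Cnorm2 /=; ring. Qed.

Lemma tau_denom_neq0 (c : vec n) (w : C) : 0 < fst w -> (w + RtoC (1 + vnorm2 c))%cx <> 0%cx.
Proof.
move=> w0 E; have := vnorm2_ge0 c.
have : fst (w + RtoC (1 + vnorm2 c))%cx = 0 by rewrite E.
by cx_unfold; lra.
Qed.

Lemma RtoC2_neq0 : RtoC 2 <> 0%cx.
Proof. by case; lra. Qed.

Lemma tau_neq0 (c : vec n) (w : C) : 0 < fst w -> tau c w <> 0%cx.
Proof.
move=> /(tau_denom_neq0 (c := c)) d0; apply: Cmod_neq0; rewrite Cmod_div //.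
by apply: Rdiv_lt_0_compat; apply: Cmod_gt0 => //; exact: RtoC2_neq0.
Qed.

Lemma siegel_slice_tau (c : vec n) (w : C) : c i0 = 0%cx -> 0 < fst w ->
  siegel c (slice c (tau c w)) = w.
Proof.
move=> c0 w0; rewrite siegel_slice //; last exact: tau_neq0.
have d0 := @tau_denom_neq0 c w w0; have two := RtoC2_neq0.
by rewrite /tau; field.
Qed.

(** On the slice the defect vanishes, so [1 - |z| ^ 2] equals [|t| ^ 2 Re w], which is positive. *)
Lemma slice_ball (c : vec n) (w : C) : c i0 = 0%cx -> 0 < fst w -> ball (slice c (tau c w)).
Proof.
move=> c0 w0; have t0 := tau_neq0 (c := c) w0.
have := @siegel_re c (slice c (tau c w)) c0; rewrite slice_i0 // defect_slice // vnorm2_zero siegel_slice_tau //.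
have -> : (1 - (1 - tau c w))%cx = tau c w by ring.
move=> /(_ t0) E; have := Cnorm2_gt0 t0; rewrite /ball; nra.
Qed.

Lemma siegel_rcdiff (c : vec n) (f : R -> vec n) (f' : vec n) (t : R) :
  (1 - f t i0)%cx <> 0%cx ->
  (forall i, rcdiff (fun s => f s i) t (f' i)) ->
  rcdiff (fun s => siegel c (f s)) t (dsiegel c (f t) f').
Proof.
move=> z1 H; apply: rcdiff_val.
  apply: rcdiff_add (rcdiff_const _ _); apply: rcdiff_sub (rcdiff_const _ _).
  apply: (@rcdiff_div (fun s => RtoC 2 * (1 - inner (f s) c))%cx (fun s => 1 - f s i0)%cx) => //.
    by apply: rcdiff_scal; apply: rcdiff_sub (rcdiff_const _ _) (rcdiff_inner _ H).
  by apply: rcdiff_sub (rcdiff_const _ _) (H i0).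
by rewrite /dsiegel; field.
Qed.

Lemma siegel_cdiff (c : vec n) (f : C -> vec n) (a : C) :
  (1 - f a i0)%cx <> 0%cx ->
  (forall i, exists d, cdiff (fun s => f s i) a d) ->
  exists d, cdiff (fun s => siegel c (f s)) a d.
Proof.
move=> z1 H; case: (cdiff_inner c H) => d1 H1; case: (H i0) => d2 H2; eexists.
apply: cdiff_add (cdiff_const _ _); apply: cdiff_sub (cdiff_const _ _).
apply: (@cdiff_div (fun s => RtoC 2 * (1 - inner (f s) c))%cx (fun s => 1 - f s i0)%cx) => //.
  by apply: cdiff_scal; apply: cdiff_sub (cdiff_const _ _) H1.
by apply: cdiff_sub (cdiff_const _ _) H2.
Qed.

(* Every point of the ball lies on the slice of parameter [c = z'' / (1 - z_1)]. *)
Definition slice_param (z : vec n) : vec n :=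
  fun i => if i == i0 then 0%cx else (z i / (1 - z i0))%cx.

Lemma slice_param_i0 (z : vec n) : slice_param z i0 = 0%cx.
Proof. by rewrite /slice_param eqxx. Qed.

Lemma slice_paramE (z : vec n) : ball z -> slice (slice_param z) (1 - z i0)%cx = z.
Proof.
move=> hz; have z1 := ball_coord1_neq1 hz; apply: vec_ext => i.
case: (eqVneq i i0) => [->|ii]; first by rewrite slice_i0 ?slice_param_i0 //; ring.
by rewrite slice_i // /slice_param (negbTE ii); field.
Qed.

Lemma siegel_param (z : vec n) : ball z ->
  fst (siegel (slice_param z) z) = - uB z /\ 0 < fst (siegel (slice_param z) z) /\
  tau (slice_param z) (siegel (slice_param z) z) = (1 - z i0)%cx.
Proof.
move=> hz; have z1 := ball_coord1_neq1 hz; set c := slice_param z.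
have c0 : c i0 = 0%cx by exact: slice_param_i0.
have D := Cnorm2_gt0 z1.
have E : Cnorm2 (1 - z i0)%cx * fst (siegel c z) = 1 - vnorm2 z.
  have := defect_slice (1 - z i0)%cx c0; rewrite (slice_paramE hz) => d0.
  by rewrite siegel_re // d0 vnorm2_zero; ring.
have E2 : fst (siegel c z) = - uB z.
  rewrite /uB coord1E; apply: (Rmult_eq_reg_l (Cnorm2 (1 - z i0)%cx)); last lra.
  by rewrite E; field; lra.
split=> //; split; first by rewrite /ball in hz; nra.
have -> : siegel c z = (RtoC 2 / (1 - z i0) - RtoC (1 + vnorm2 c))%cx.
  by rewrite -(siegel_slice c0 z1) (slice_paramE hz).
rewrite /tau.
have two := RtoC2_neq0.
have -> : (RtoC 2 / (1 - z i0) - RtoC (1 + vnorm2 c) + RtoC (1 + vnorm2 c))%cx = (RtoC 2 / (1 - z i0))%cx by ring.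
by field.
Qed.

(** The shape of [|v - c| ^ 2] along a real line that starts on the slice [v = c]: it does not
    contribute to the first derivative. *)
Lemma is_derive_quadratic_remainder (S p q a b : R) : 0 < p ^ 2 + q ^ 2 ->
  is_derive (fun t => t ^ 2 * S / ((p - t * a) ^ 2 + (q - t * b) ^ 2)) 0 0.
Proof.
move=> h; auto_derive; first by rewrite /=; nra.
by field; rewrite /=; nra.
Qed.

(** With [c] frozen at the parameter of [z], [uB] is [|v - c| ^ 2] minus the real part of
    [siegel c], and the first term is quadratic in [t] along [z + t w]. So the non-holomorphic
    function [uB] has the differential of a holomorphic real part. *)
Lemma du_siegel (z w : vec n) : ball z -> du_is z w (- fst (dsiegel (slice_param z) z w)).
Proof.
move=> hz; have z1 := ball_coord1_neq1 hz; set c := slice_param z.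
have c0 : c i0 = 0%cx by exact: slice_param_i0.
have D0 := Cnorm2_gt0 z1.
pose f t := vadd z (vscalR t w).
have f0 : f 0 = z by apply: vec_ext => i; rewrite /f /vadd /vscalR /vscal; cx_ring.
have df : forall i, rcdiff (fun s => f s i) 0 (w i).
  move=> i e e0; exists 1; split; first lra; move=> s _.
  have -> : (f s i - f 0%R i - RtoC (s - 0) * w i)%cx = 0%cx by rewrite /f /vadd /vscalR /vscal; cx_ring.
  by rewrite Cmod0; have := Rabs_pos (s - 0); nra.
(* The defect is affine in the point and vanishes at [z]; [w1] is its rate of change in the
   direction [w]. *)
pose w1 : vec n := fun i => (w i - (if i == i0 then w i0 else 0) + w i0 * c i)%cx.
have dE : forall t, defect c (f t) = vscal (RtoC t) w1.
  move=> t; have := defect_slice (1 - z i0)%cx c0; rewrite (slice_paramE hz) => E.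
  apply: vec_ext => i; have : defect c z i = vzero i by rewrite E.
  rewrite /defect /vscal /w1 /f /vadd /vscalR /vscal /vzero; case: eqP => _ Ei.
    by transitivity (RtoC t * (w i - w i0 + w i0 * c i) + (z i - z i0 - (1 - z i0) * c i))%cx; [ring | rewrite Ei; ring].
  by transitivity (RtoC t * (w i - 0 + w i0 * c i) + (z i - 0 - (1 - z i0) * c i))%cx; [ring | rewrite Ei; ring].
have nE : forall t, vnorm2 (vscal (RtoC t) w1) = t ^ 2 * vnorm2 w1.
  by move=> t; rewrite /vnorm2 -sumR_scal; apply: eq_bigr => i _; rewrite /vscal; cx_unfold; ring.
set p := fst (1 - z i0)%cx; set q := snd (1 - z i0)%cx; set a := fst (w i0); set b := snd (w i0).
have DE : forall t, Cnorm2 (1 - f t i0)%cx = (p - t * a) ^ 2 + (q - t * b) ^ 2.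
  by move=> t; rewrite /f /p /q /a /b /vadd /vscalR /vscal; cx_unfold; ring.
have D0' : 0 < p ^ 2 + q ^ 2 by [].
apply is_derive_Reals.
(* The identity [siegel_re] asks for a nonzero [1 - f t i0], which continuity gives only for small
   [t]. *)
apply: (is_derive_ext_loc (fun t => t ^ 2 * vnorm2 w1 / ((p - t * a) ^ 2 + (q - t * b) ^ 2) - fst (siegel c (f t)))).
  have cD : continuity_pt (fun t => (p - t * a) ^ 2 + (q - t * b) ^ 2) 0.
    apply: (@is_derive_continuity_pt _ _ (2 * p * (- a) + 2 * q * (- b))).
    by auto_derive => //; ring.
  case: (cD (p ^ 2 + q ^ 2)) => [|d [dp Hd]]; first exact: D0'.
  exists (mkposreal d dp) => t ht; have {ht} ht' : Rabs (t - 0) < d by exact: ht.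
  have Dt : 0 < (p - t * a) ^ 2 + (q - t * b) ^ 2.
    case: (Req_dec t 0) => [->|tn]; first by rewrite !Rmult_0_l !Rminus_0_r.
    have := Hd t (conj (conj I (not_eq_sym tn)) ht').
    by rewrite /dist /= /R_dist => /Rabs_def2; lra.
  have t1 : (1 - f t i0)%cx <> 0%cx by move=> E; have := DE t; rewrite E /Cnorm2 /=; lra.
  have := siegel_re c0 t1; rewrite dE nE DE => E.
  rewrite /uB -/(f t) coord1E DE.
  apply: (Rmult_eq_reg_l ((p - t * a) ^ 2 + (q - t * b) ^ 2)); last lra.
  move: E Dt; set Dd := (p - t * a) ^ 2 + (q - t * b) ^ 2; set sg := fst (siegel c (f t)) => E Dt.
  transitivity (t ^ 2 * vnorm2 w1 - Dd * sg); first by field; lra.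
  by rewrite E; field; lra.
have -> : - fst (dsiegel c z w) = 0 - fst (dsiegel c z w) by ring.
apply: (is_derive_minus (V := R_NormedModule)); first exact: is_derive_quadratic_remainder.
rewrite -f0; apply: (rcdiff_fst (f := fun t => siegel c (f t))); apply: siegel_rcdiff => //.
by rewrite f0.
Qed.

Lemma du_unique (z w : vec n) (l : R) : ball z -> du_is z w l -> l = - fst (dsiegel (slice_param z) z w).
Proof. by move=> hz H; apply: uniqueness_limite H (du_siegel w hz). Qed.

End Siegel.

(** * Slice fields induced by the flow *)

Lemma derive_ge0_at_0 (f : R -> R) (l : R) : is_derive f 0 l -> f 0 = 0 ->
  (forall t, 0 <= t -> 0 <= f t) -> 0 <= l.
Proof.
move=> /is_derive_Reals D f0 Hf; apply: Rnot_lt_le => l0.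
case: (D (- l / 2)) => [|d Hd]; first lra.
have d0 := cond_pos d.
have := Hd (d / 2) ltac:(lra); rewrite Rplus_0_l f0 Rminus_0_r Rabs_pos_eq; last lra.
move=> /(_ ltac:(lra)) /Rabs_def2.
have : 0 <= f (d / 2) / (d / 2) by apply: Rdiv_le_0_compat; [apply: Hf; lra | lra].
lra.
Qed.

Section Generator.
Variables (n : nat) (i0 : 'I_n) (G : vec n -> vec n) (dG : vec n -> vec n -> vec n).
Hypothesis i0_0 : nat_of_ord i0 = 0%N.
Hypothesis G_diff : forall z, ball z -> is_cderiv G z (dG z).

Definition slice_field (c : vec n) (w : C) : C :=
  dsiegel i0 c (slice c (tau c w)) (G (slice c (tau c w))).

(* The flow induces self-maps [w |-> siegel c (X (slice c (tau c w)) t)] of the right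
   half-plane that start from the identity; [slice_field c] is their velocity. *)
Lemma slice_field_ratio_decreasing (c : vec n) (x x' y : R) : inf_generator G ->
  c i0 = 0%cx -> 0 < x -> x <= x' ->
  fst (slice_field c (x', y)) / x' <= fst (slice_field c (x, y)) / x.
Proof.
move=> HG c0 x0 xx; case: (inf_generator_flow HG) => X HX.
pose s w := slice c (tau c w).
have sB : forall w, 0 < fst w -> ball (s w) by move=> w w0; exact: (slice_ball i0_0).
pose Gam t w := siegel i0 c (X (s w) t).
have XB : forall t w, 0 <= t -> 0 < fst w -> ball (X (s w) t).
  by move=> t w t0 w0; have [_ [H _]] := HX _ (sB w w0); exact: H.
have Gam_pos : forall t, 0 <= t -> forall w, 0 < fst w -> 0 <= fst (Gam t w).
  by move=> t t0 w w0; apply: siegel_re_ge0 => //; exact: XB.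
have Gam_diff : forall t, 0 <= t -> forall w, 0 < fst w -> exists d, cdiff (Gam t) w d.
  move=> t t0 w w0.
  have [d1 H1] : exists d, cdiff (tau c) w d.
    eexists; apply: cdiff_div (cdiff_const _ _) (cdiff_add (cdiff_id _) (cdiff_const _ _)).
    exact: tau_denom_neq0.
  have [d2 H2] : exists d, cdiff (fun b => siegel i0 c (X (slice c b) t)) (tau c w) d.
    apply: siegel_cdiff; first by apply: ball_coord1_neq1; exact: XB.
    by move=> i; apply: (flow_line_cdiff G_diff HX) => //; exact: sB.
  by exists (d2 * d1)%cx; exact: (cdiff_comp H1 H2).
pose xe w := extend (X (s w)) (G (X (s w) 0)).
have X0 : forall w, 0 < fst w -> X (s w) 0 = s w by move=> w w0; case: (HX _ (sB w w0)).
have xe0 : forall w, 0 < fst w -> xe w 0 = s w by move=> w w0; rewrite /xe extend_ge0 ?X0 //; lra.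
have D : forall w, 0 < fst w -> is_derive (fun t => fst (siegel i0 c (xe w t))) 0 (fst (slice_field c w)).
  move=> w w0; apply: (rcdiff_fst (f := fun t => siegel i0 c (xe w t))).
  have -> : slice_field c w = dsiegel i0 c (xe w 0) (G (X (s w) 0)) by rewrite xe0 // X0.
  apply: siegel_rcdiff; first by rewrite xe0 //; apply: ball_coord1_neq1; exact: sB.
  by move=> i; apply: extend_rcdiff (HX _ (sB w w0)) _; lra.
have px : 0 < fst (x, y) by []; have px' : 0 < fst (x', y) by rewrite /=; lra.
(* At time 0 both ratios equal 1, and at each later time the one at [x] is at least the one at [x'];
   so the difference has a nonnegative derivative at 0. *)
have := @derive_ge0_at_0 (fun t => fst (siegel i0 c (xe (x, y) t)) * / x - fst (siegel i0 c (xe (x', y) t)) * / x')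
   (fst (slice_field c (x, y)) * / x - fst (slice_field c (x', y)) * / x') => K.
suff : 0 <= fst (slice_field c (x, y)) * / x - fst (slice_field c (x', y)) * / x' by rewrite /Rdiv; lra.
apply: K.
- apply: (is_derive_minus (V := R_NormedModule)).
    have := is_derive_scal _ _ (/ x) _ (D _ px); rewrite Rmult_comm => Q.
    by apply: is_derive_ext Q => t; rewrite Rmult_comm.
  have := is_derive_scal _ _ (/ x') _ (D _ px'); rewrite Rmult_comm => Q.
  by apply: is_derive_ext Q => t; rewrite Rmult_comm.
- by rewrite !xe0 // /s !siegel_slice_tau //=; field; lra.
- move=> t t0; rewrite /xe !extend_ge0 //.
  have := @halfplane_ratio_decreasing (Gam t) x x' y (Gam_diff t t0) (Gam_pos t t0) x0 xx.
  by rewrite /Gam /Rdiv; lra.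
Qed.

(** * Estimates in Koranyi regions *)

Lemma koranyiE (r : R) (z : vec n) :
  Koranyi r z <-> ball z /\ Cmod (1 - z i0)%cx <= r / 2 * (1 - vnorm2 z).
Proof. by rewrite /Koranyi (coord1E i0_0). Qed.

Lemma koranyi_ball (r : R) (z : vec n) : Koranyi r z -> ball z.
Proof. by case. Qed.

Lemma vnorm2_add_basis (z : vec n) (a : C) (j : 'I_n) :
  vnorm2 (vadd z (vscal a (basis n j))) = vnorm2 z + (2 * fst (z j * Cconj a)%cx + Cnorm2 a).
Proof.
have -> : 2 * fst (z j * Cconj a)%cx + Cnorm2 a =
   \big[Rplus/0]_(i < n) (if i == j then 2 * fst (z j * Cconj a)%cx + Cnorm2 a else 0).
  by rewrite -big_mkcond big_pred1_eq.
rewrite /vnorm2 -sumR_add; apply: eq_bigr => i _; rewrite /vadd /vscal /basis.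
have -> : (nat_of_ord i == j) = (i == j) by [].
by case: eqP => [->|_]; cx_unfold; ring.
Qed.

Lemma Cmod_one_sub_le2 (z : vec n) : ball z -> Cmod (1 - z i0)%cx <= 2.
Proof.
move=> hz; apply: Rle_trans (Cmod_sub _ _) _; rewrite Cmod1.
suff : Cmod (z i0) <= 1 by lra.
by apply: Cmod_square_le; [lra | have := Cnorm2_coord z i0; rewrite /ball in hz; lra].
Qed.

Lemma one_sub_Cnorm2_le (a : C) : Cmod a <= 1 -> 1 - Cnorm2 a <= 2 * Cmod (1 - a)%cx.
Proof.
move=> a1; have := Cmod_le_sub 1 a; rewrite Cmod1 -Cmod_sqr; have := Cmod_ge0 a; nra.
Qed.

Lemma Cnorm2_coord2 (z : vec n) (i j : 'I_n) : i != j -> Cnorm2 (z i) + Cnorm2 (z j) <= vnorm2 z.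
Proof.
move=> ij.
have -> : vnorm2 z = Cnorm2 (z j) + \big[Rplus/0]_(k < n | k != j) Cnorm2 (z k) by exact: (bigD1 j).
have -> : \big[Rplus/0]_(k < n | k != j) Cnorm2 (z k) =
   Cnorm2 (z i) + \big[Rplus/0]_(k < n | (k != j) && (k != i)) Cnorm2 (z k) by exact: (bigD1 i).
have : 0 <= \big[Rplus/0]_(k < n | (k != j) && (k != i)) Cnorm2 (z k).
  by apply: (big_ind (fun a => 0 <= a)) => [|* |k _]; [lra | lra | exact: Cnorm2_ge0].
lra.
Qed.

Lemma Cnorm2_coord_le (z : vec n) (j : 'I_n) : ball z -> j != i0 ->
  Cnorm2 (z j) <= 2 * Cmod (1 - z i0)%cx.
Proof.
move=> hz ji; have := Cnorm2_coord2 z ji; rewrite /ball in hz.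
have : Cmod (z i0) <= 1 by apply: Cmod_square_le; [lra | have := Cnorm2_coord z i0; lra].
move=> /one_sub_Cnorm2_le; lra.
Qed.

(** In the region [1 - |z| ^ 2] is at least [2 |1 - z_1| / r], while a move by [a] changes [|z| ^ 2]
    by at most [3 |a|]. A radius of order [|1 - z_1|] therefore only widens the aperture. *)
Lemma koranyi_move_e1 (r : R) (z : vec n) (a : C) : 1 <= r -> Koranyi r z ->
  Cmod a <= Cmod (1 - z i0)%cx / (8 * r) ->
  Koranyi (4 * r) (vadd z (vscal a (basis n i0))) /\
  Cmod (1 - vadd z (vscal a (basis n i0)) i0)%cx <= 2 * Cmod (1 - z i0)%cx.
Proof.
move=> r1 /koranyiE [hz hk] ha; have d2 := Cmod_one_sub_le2 hz; have d0 := Cmod_ge0 (1 - z i0)%cx.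
set d := Cmod (1 - z i0)%cx in hk ha d2 d0 *.
have {}ha : Cmod a * (8 * r) <= d by apply/Rle_div_r => //; lra.
have a0 := Cmod_ge0 a; have z1 : Cmod (z i0) <= 1.
  by apply: Cmod_square_le; [lra | have := Cnorm2_coord z i0; rewrite /ball in hz; lra].
have E : vadd z (vscal a (basis n i0)) i0 = (z i0 + a)%cx by rewrite /vadd /vscal /basis eqxx; ring.
have F : Cmod (1 - (z i0 + a))%cx <= d + Cmod a.
  have -> : (1 - (z i0 + a))%cx = ((1 - z i0) - a)%cx by ring.
  exact: Cmod_sub.
have ad : Cmod a <= d / 8 by nra.
have N : vnorm2 (vadd z (vscal a (basis n i0))) <= vnorm2 z + 3 * Cmod a.
  rewrite vnorm2_add_basis.
  have f1 : fst (z i0 * Cconj a)%cx <= Cmod a.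
    apply: Rle_trans (Rle_abs _) _; apply: Rle_trans (Cmod_fst _) _; rewrite Cmod_mul Cmod_conj; nra.
  rewrite -(Cmod_sqr a); nra.
rewrite /ball in hz; set s := vnorm2 z in hk hz N.
have s0 : 3 * Cmod a <= (1 - s) / 4 by nra.
split; last by rewrite E; lra.
apply/koranyiE; rewrite E; split; first by rewrite /ball; lra.
set s' := vnorm2 _ in N *.
have : r * (1 - s) <= r * (4 / 3 * (1 - s')) by apply: Rmult_le_compat_l; lra.
lra.
Qed.

(** Since [|z_j| ^ 2 <= 2 |1 - z_1|] in the ball, the cross term in [|z + a e_j| ^ 2] is of order
    [|a| |1 - z_1| ^ (1/2)]. This allows the larger radius of order [|1 - z_1| ^ (1/2)]. *)
Lemma koranyi_move_ej (r : R) (z : vec n) (a : C) (j : 'I_n) : 1 <= r -> Koranyi r z -> j != i0 ->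
  Cmod a <= sqrt (Cmod (1 - z i0)%cx) / (8 * r) ->
  Koranyi (4 * r) (vadd z (vscal a (basis n j))) /\ vadd z (vscal a (basis n j)) i0 = z i0.
Proof.
move=> r1 /koranyiE [hz hk] ji ha; have d0 := Cmod_ge0 (1 - z i0)%cx.
have zj := Cnorm2_coord_le hz ji.
set d := Cmod (1 - z i0)%cx in hk ha d0 zj *.
have {}ha : Cmod a * (8 * r) <= sqrt d by apply/Rle_div_r => //; lra.
have sd0 := sqrt_pos d; have sd := sqrt_sqrt d d0; set q := sqrt d in ha sd0 sd.
have a0 := Cmod_ge0 a.
have E : vadd z (vscal a (basis n j)) i0 = z i0.
  rewrite /vadd /vscal /basis; have -> : (nat_of_ord i0 == j) = (i0 == j) by [].
  by rewrite eq_sym (negbTE ji); ring.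
have zq : Cmod (z j) <= 3 / 2 * q.
  apply: Cmod_square_le; first lra.
  have -> : (3 / 2 * q) ^ 2 = 9 / 4 * (q * q) by field.
  rewrite sd; lra.
have za : Cmod (z j) * Cmod a <= 3 / 2 * q * Cmod a by apply: Rmult_le_compat_r.
have N : vnorm2 (vadd z (vscal a (basis n j))) <= vnorm2 z + 3 * (q * Cmod a) + Cmod a ^ 2.
  rewrite vnorm2_add_basis -Cmod_sqr.
  have f1 : fst (z j * Cconj a)%cx <= Cmod (z j) * Cmod a.
    by apply: Rle_trans (Rle_abs _) _; apply: Rle_trans (Cmod_fst _) _; rewrite Cmod_mul Cmod_conj; lra.
  lra.
have k1 : r * (q * Cmod a) <= d / 8 by rewrite -sd; nra.
have k2 : r * Cmod a ^ 2 <= d / 64.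
  have : (r * Cmod a) * Cmod a <= q / 8 * Cmod a by apply: Rmult_le_compat_r; lra.
  have : q * Cmod a <= d / 8 by rewrite -sd; nra.
  simpl; lra.
rewrite /ball in hz; set s := vnorm2 z in hk hz N; set s' := vnorm2 _ in N *.
have s0 : 3 * (q * Cmod a) + Cmod a ^ 2 <= (1 - s) / 4.
  apply: (Rmult_le_reg_l r); first lra.
  nra.
split=> //; apply/koranyiE; rewrite E; split; first by rewrite /ball -/s'; lra.
rewrite -/s'; have : r * (1 - s) <= r * (4 / 3 * (1 - s')) by apply: Rmult_le_compat_l; lra.
by rewrite -/d; lra.
Qed.

(** Koranyi regions are convex, because [|1 - z_1|] is convex and [1 - |z| ^ 2] is concave. *)
Lemma koranyi_segment (r t : R) (z z' : vec n) : 0 < r -> Koranyi r z -> Koranyi r z' -> 0 <= t <= 1 ->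
  Koranyi r (vadd z' (vscal (RtoC t) (vsub z z'))) /\
  Cmod (1 - vadd z' (vscal (RtoC t) (vsub z z')) i0)%cx <= Rmax (Cmod (1 - z i0)%cx) (Cmod (1 - z' i0)%cx).
Proof.
move=> r0 /koranyiE [hz hk] /koranyiE [hz' hk'] ht; set q := vadd _ _.
have N : vnorm2 q <= t * vnorm2 z + (1 - t) * vnorm2 z'.
  rewrite /vnorm2 -!sumR_scal -sumR_add; apply: sumR_le => i.
  rewrite /q /vadd /vscal /vsub; cx_unfold.
  move: (z i) (z' i) => [a b] [c d] /=.
  have : 0 <= t * (1 - t) by apply: Rmult_le_pos; lra.
  have := pow2_ge_0 (a - c); have := pow2_ge_0 (b - d); nra.
have M : Cmod (1 - q i0)%cx <= t * Cmod (1 - z i0)%cx + (1 - t) * Cmod (1 - z' i0)%cx.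
  have -> : (1 - q i0)%cx = (RtoC t * (1 - z i0) + RtoC (1 - t) * (1 - z' i0))%cx.
    by rewrite /q /vadd /vscal /vsub; cx_ring.
  by apply: Rle_trans (Cmod_add _ _) _; rewrite !Cmod_mul !Cmod_RtoC !Rabs_pos_eq; lra.
split; last first.
  apply: Rle_trans M _; have := Rmax_l (Cmod (1 - z i0)%cx) (Cmod (1 - z' i0)%cx).
  have := Rmax_r (Cmod (1 - z i0)%cx) (Cmod (1 - z' i0)%cx); nra.
rewrite /ball in hz hz'.
apply/koranyiE; split; first by rewrite /ball; case: (Rle_lt_dec t (1 / 2)) => ht2; nra.
have : r / 2 * (t * (1 - vnorm2 z) + (1 - t) * (1 - vnorm2 z')) <= r / 2 * (1 - vnorm2 q).
  by apply: Rmult_le_compat_l; lra.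
have : t * Cmod (1 - z i0)%cx <= t * (r / 2 * (1 - vnorm2 z)) by apply: Rmult_le_compat_l; lra.
have : (1 - t) * Cmod (1 - z' i0)%cx <= (1 - t) * (r / 2 * (1 - vnorm2 z')) by apply: Rmult_le_compat_l; lra.
lra.
Qed.

Lemma cauchy_basis (z : vec n) (i j : 'I_n) (rho m : R) : 0 < rho -> ball z ->
  (forall a, Cmod a < rho -> ball (vadd z (vscal a (basis n j))) /\
     Cmod (G (vadd z (vscal a (basis n j))) i) <= m) ->
  Cmod (dG z (basis n j) i) <= 4 * m / rho.
Proof.
move=> r0 hz H.
have z0 : vadd z (vscal 0 (basis n j)) = z by apply: vec_ext => k; rewrite /vadd /vscal; ring.
apply: (@cauchy_estimate (fun a => G (vadd z (vscal a (basis n j))) i)) => //.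
- by move=> a ha; eexists; apply: (line_cdiff G_diff); exact: (proj1 (H a ha)).
- by have := @line_cdiff n G dG G_diff z (basis n j) 0%cx i; rewrite z0; apply.
- by move=> a ha; exact: (proj2 (H a ha)).
Qed.

Hypothesis G1_bound : forall r, 1 <= r -> exists M, 0 <= M /\
  forall z, Koranyi r z -> Cmod (G z i0) <= M * Cmod (1 - z i0)%cx.
Hypothesis Gj_bound : forall r, 1 <= r -> exists M, 0 <= M /\
  forall j, j != i0 -> forall z, Koranyi r z -> Cmod (G z j) <= M * sqrt (Cmod (1 - z i0)%cx).

(** With [d = |1 - z_1|], [G] is of order [d] in its first component and [d ^ (1/2)] in the others.
    Cauchy's estimate divides by a radius of order [d] along [e_1] and [d ^ (1/2)] along the other
    [e_j], which gives the orders [1], [d ^ (1/2)], [d ^ (-1/2)] and [1]. *)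
Lemma derivative_bounds (r : R) : 1 <= r -> exists M, 0 <= M /\ forall z, Koranyi r z ->
  Cmod (dG z (basis n i0) i0) <= M /\
  forall j, j != i0 ->
    Cmod (dG z (basis n j) i0) <= M * sqrt (Cmod (1 - z i0)%cx) /\
    Cmod (dG z (basis n i0) j) <= M / sqrt (Cmod (1 - z i0)%cx) /\
    forall k, k != i0 -> Cmod (dG z (basis n j) k) <= M.
Proof.
move=> r1; case: (G1_bound (r := 4 * r)) => [|M1 [M10 H1]]; first lra.
case: (Gj_bound (r := 4 * r)) => [|M2 [M20 H2]]; first lra.
exists (64 * r * (M1 + M2)); split; first by apply: Rmult_le_pos; lra.
move=> z hz; have Bz := koranyi_ball hz.
have d0 := Cmod_gt0 (ball_coord1_neq1 Bz (i0 := i0)).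
set d := Cmod (1 - z i0)%cx in d0 *.
have q0 := sqrt_lt_R0 _ d0; have qq := sqrt_sqrt d (Rlt_le _ _ d0); set q := sqrt d in q0 qq *.
have rho1 : 0 < d / (8 * r) by apply: Rdiv_lt_0_compat; lra.
have rho2 : 0 < q / (8 * r) by apply: Rdiv_lt_0_compat; lra.
have s2 : forall x, x <= 2 * d -> sqrt x <= 2 * q.
  move=> x hx; rewrite -(sqrt_pow2 (2 * q)); last lra.
  by apply: sqrt_le_1_alt; simpl; nra.
have e1 : forall a, Cmod a < d / (8 * r) -> Koranyi (4 * r) (vadd z (vscal a (basis n i0))) /\
  Cmod (1 - vadd z (vscal a (basis n i0)) i0)%cx <= 2 * d.
  by move=> a ha; apply: koranyi_move_e1 => //; rewrite -/d; lra.
have ej : forall j a, j != i0 -> Cmod a < q / (8 * r) ->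
  Koranyi (4 * r) (vadd z (vscal a (basis n j))) /\ vadd z (vscal a (basis n j)) i0 = z i0.
  by move=> j a ji ha; apply: koranyi_move_ej => //; rewrite -/d -/q; lra.
split.
  apply: Rle_trans (@cauchy_basis z i0 i0 (d / (8 * r)) (M1 * (2 * d)) rho1 Bz _) _.
    move=> a /e1 [K1 K2]; split; first exact: koranyi_ball K1.
    by apply: Rle_trans (H1 _ K1) _; apply: Rmult_le_compat_l.
  have -> : 4 * (M1 * (2 * d)) / (d / (8 * r)) = 64 * r * M1 by field; lra.
  by apply: Rmult_le_compat_l; lra.
move=> j ji; split; [|split].
- apply: Rle_trans (@cauchy_basis z i0 j (q / (8 * r)) (M1 * d) rho2 Bz _) _.
    move=> a /(ej j a ji) [K1 K2]; split; first exact: koranyi_ball K1.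
    by apply: Rle_trans (H1 _ K1) _; rewrite K2 -/d; lra.
  have -> : 4 * (M1 * d) / (q / (8 * r)) = 32 * r * M1 * q by rewrite -qq; field; lra.
  apply: Rmult_le_compat_r; first lra.
  have : 0 <= r * M1 by apply: Rmult_le_pos; lra.
  have : 0 <= r * M2 by apply: Rmult_le_pos; lra.
  lra.
- apply: Rle_trans (@cauchy_basis z j i0 (d / (8 * r)) (M2 * (2 * q)) rho1 Bz _) _.
    move=> a /e1 [K1 K2]; split; first exact: koranyi_ball K1.
    by apply: Rle_trans (H2 _ ji _ K1) _; apply: Rmult_le_compat_l => //; exact: s2.
  have -> : 4 * (M2 * (2 * q)) / (d / (8 * r)) = 64 * r * M2 / q by rewrite -qq; field; lra.
  apply: Rmult_le_compat_r; first exact/Rlt_le/Rinv_0_lt_compat.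
  by apply: Rmult_le_compat_l; lra.
- move=> k ki; apply: Rle_trans (@cauchy_basis z k j (q / (8 * r)) (M2 * q) rho2 Bz _) _.
    move=> a /(ej j a ji) [K1 K2]; split; first exact: koranyi_ball K1.
    by apply: Rle_trans (H2 _ ki _ K1) _; rewrite K2 -/d -/q; lra.
  have -> : 4 * (M2 * q) / (q / (8 * r)) = 32 * r * M2 by field; lra.
  have : 0 <= r * M1 by apply: Rmult_le_pos; lra.
  have : 0 <= r * M2 by apply: Rmult_le_pos; lra.
  lra.
Qed.

(** Integration of the derivative bounds along the segment, which stays in the region by convexity.
    The factor [sqrt b] on the full displacement is the gain from the small tangential derivatives
    of [G_1]. *)
Lemma G1_lipschitz (r : R) : 1 <= r -> exists A, 0 <= A /\ forall z z' b,
  Koranyi r z -> Koranyi r z' -> Cmod (1 - z i0)%cx <= b -> Cmod (1 - z' i0)%cx <= b ->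
  Cmod (G z i0 - G z' i0)%cx <= A * (Cmod (z i0 - z' i0)%cx + sqrt b * norm1 (vsub z z')).
Proof.
move=> r1; case: (derivative_bounds r1) => M [M0 HM]; exists M; split=> // z z' b hz hz' hb hb'.
set h := vsub z z'.
have line1 : vadd z' (vscal (0 + 1) h) = z.
  by apply: vec_ext => j; rewrite /h /vadd /vscal /vsub; ring.
have line0 : vadd z' (vscal 0 h) = z' by apply: vec_ext => j; rewrite /vadd /vscal; ring.
have seg0 : forall t, (0 + RtoC t * 1)%cx = RtoC t by move=> t; ring.
have := @mean_value_ineq (fun a => G (vadd z' (vscal a h)) i0)
   (fun a => dG (vadd z' (vscal a h)) h i0) 0 1 (M * (Cmod (z i0 - z' i0)%cx + sqrt b * norm1 h)).
rewrite line0 line1; apply=> t ht; rewrite seg0.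
  by apply: (line_cdiff G_diff); apply: (@koranyi_ball r); apply: (proj1 (koranyi_segment _ hz hz' ht)); lra.
have [kq mq] := @koranyi_segment r t z z' ltac:(lra) hz hz' ht; rewrite -/h in kq mq.
set q := vadd _ _ in kq mq *.
have {}mq : Cmod (1 - q i0)%cx <= b by apply: Rle_trans mq _; apply: Rmax_lub.
have [D1 D2] := HM q kq.
rewrite Cmod_mul Cmod1 Rmult_1_r.
apply: Rle_trans (clinear_expand h i0 (dG_linear G_diff (koranyi_ball kq))) _.
have -> : M * (Cmod (z i0 - z' i0)%cx + sqrt b * norm1 h) =
  \big[Rplus/0]_(j < n) ((if j == i0 then M * Cmod (z i0 - z' i0)%cx else 0) + M * sqrt b * Cmod (h j)).
  rewrite sumR_add sumR_scal -/(norm1 h) -big_mkcond big_pred1_eq; ring.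
apply: sumR_le => j; have hj := Cmod_ge0 (h j); have sb := sqrt_pos b.
have Mb : 0 <= M * sqrt b * Cmod (h j) by apply: Rmult_le_pos => //; apply: Rmult_le_pos.
case: eqP => [->|/eqP ji].
  have -> : h i0 = (z i0 - z' i0)%cx by [].
  have : Cmod (z i0 - z' i0)%cx * Cmod (dG q (basis n i0) i0) <= Cmod (z i0 - z' i0)%cx * M.
    by apply: Rmult_le_compat_l => //; exact: Cmod_ge0.
  have : 0 <= M * sqrt b * Cmod (z i0 - z' i0)%cx.
    by apply: Rmult_le_pos; [apply: Rmult_le_pos | exact: Cmod_ge0].
  lra.
have [D3 _] := D2 j ji.
have : Cmod (dG q (basis n j) i0) <= M * sqrt b.
  by apply: Rle_trans D3 _; apply: Rmult_le_compat_l => //; apply: sqrt_le_1_alt.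
nra.
Qed.

End Generator.

(** * Asymptotics along slices *)

Lemma div_sqrt_small (K e : R) : 0 <= K -> 0 < e ->
  exists x1, 1 <= x1 /\ forall x, x1 <= x -> K / sqrt x <= e.
Proof.
move=> K0 e0; exists (Rmax 1 ((K / e) ^ 2)); split; first exact: Rmax_l.
move=> x hx; have h1 := Rle_trans _ _ _ (Rmax_l _ _) hx; have h2 := Rle_trans _ _ _ (Rmax_r _ _) hx.
have s0 : 0 < sqrt x by apply: sqrt_lt_R0; lra.
apply/Rle_div_l => //; rewrite Rmult_comm; apply/Rle_div_l => //.
rewrite -(sqrt_pow2 (K / e)); first exact: sqrt_le_1_alt.
by apply: Rdiv_le_0_compat.
Qed.

Section Asymptotics.
Variables (n : nat) (i0 : 'I_n) (G : vec n -> vec n) (dG : vec n -> vec n -> vec n).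
Hypothesis i0_0 : nat_of_ord i0 = 0%N.
Hypothesis G_diff : forall z, ball z -> is_cderiv G z (dG z).
Hypothesis G_gen : inf_generator G.
Hypothesis G1_bound : forall r, 1 <= r -> exists M, 0 <= M /\
  forall z, Koranyi r z -> Cmod (G z i0) <= M * Cmod (1 - z i0)%cx.
Hypothesis Gj_bound : forall r, 1 <= r -> exists M, 0 <= M /\
  forall j, j != i0 -> forall z, Koranyi r z -> Cmod (G z j) <= M * sqrt (Cmod (1 - z i0)%cx).

(** On the slice [1 - |z| ^ 2 = |t| ^ 2 Re w] and [|t| |w + 1 + |c| ^ 2| = 2], so the Koranyi
    condition of aperture 2 is precisely the hypothesis on [w]. For fixed [c] and [Im w] it holds
    once [Re w] is large. *)
Lemma slice_koranyi (c : vec n) (w : C) : c i0 = 0%cx -> 0 < fst w ->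
  Cmod (w + RtoC (1 + vnorm2 c))%cx <= 2 * fst w -> Koranyi 2 (slice c (tau c w)).
Proof.
move=> c0 w0 hw; apply/(koranyiE i0_0); split; first exact: (slice_ball i0_0).
have t0 := tau_neq0 (c := c) w0; have tp := Cmod_gt0 t0.
have := @siegel_re n i0 c (slice c (tau c w)) c0.
rewrite (slice_i0 i0_0) // (defect_slice i0_0) // vnorm2_zero (siegel_slice_tau i0_0) //.
have -> : (1 - (1 - tau c w))%cx = tau c w by ring.
move=> /(_ t0) E; have -> : 1 - vnorm2 (slice c (tau c w)) = Cnorm2 (tau c w) * fst w by lra.
rewrite -Cmod_sqr.
have E2 : Cmod (tau c w) * Cmod (w + RtoC (1 + vnorm2 c))%cx = 2.
  rewrite /tau Cmod_div; last exact: tau_denom_neq0.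
  have := Cmod_gt0 (tau_denom_neq0 (c := c) w0) => d0.
  by rewrite Cmod_RtoC Rabs_pos_eq; [field; lra | lra].
have : 2 <= Cmod (tau c w) * (2 * fst w) by rewrite -{1}E2; apply: Rmult_le_compat_l; lra.
nra.
Qed.

Lemma vzero_i0 : (@vzero n) i0 = 0%cx. Proof. by []. Qed.

Lemma inner_vzero (u : vec n) : inner u vzero = 0%cx.
Proof. by rewrite /inner big1 // => i _; rewrite /vzero; cx_ring. Qed.

Lemma inner_bound (u c : vec n) (m : R) : c i0 = 0%cx -> (forall i, i != i0 -> Cmod (u i) <= m) ->
  Cmod (inner u c) <= m * norm1 c.
Proof.
move=> c0 H; apply: (Rle_trans _ (\big[Rplus/0]_(i < n) (Cmod (u i) * Cmod (c i)))).
  rewrite /inner; apply: (big_ind2 (fun a b => Cmod a <= b)); first by rewrite Cmod0; lra.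
  - by move=> a b a' b' h1 h2; apply: Rle_trans (Cmod_add _ _) _; lra.
  - by move=> i _; rewrite Cmod_mul Cmod_conj; lra.
rewrite /norm1 -sumR_scal; apply: sumR_le => i; case: (eqVneq i i0) => [->|ii].
  by rewrite c0 Cmod0; lra.
by apply: Rmult_le_compat_r; [exact: Cmod_ge0 | exact: H].
Qed.

(** The point [z_1 = (x - 1) / (x + 1)], [z'' = 0], whose Siegel coordinate is [x]. *)
Definition radial (x : R) : vec n := slice vzero (tau (@vzero n) (RtoC x)).
(** As [1 - z_1 = 2 / (x + 1)] there, this is the real part of [G_1 / (1 - z_1)]. *)
Definition radial_rate (x : R) : R := fst (G (radial x) i0) * ((x + 1) / 2).

Lemma tau_radial (x : R) : 0 < x -> tau (@vzero n) (RtoC x) = RtoC (2 / (x + 1)).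
Proof.
by move=> x0; rewrite /tau vnorm2_zero; apply C_ext; cx_unfold; field; nra.
Qed.

Lemma radial_koranyi (x : R) : 1 <= x -> Koranyi 2 (radial x).
Proof.
move=> x1; apply: slice_koranyi => //=; first lra.
rewrite vnorm2_zero; have -> : (RtoC x + RtoC (1 + 0))%cx = RtoC (x + 1) by cx_ring.
by rewrite Cmod_RtoC Rabs_pos_eq; lra.
Qed.

Lemma radial_i0 (x : R) : 0 < x -> (1 - radial x i0)%cx = RtoC (2 / (x + 1)).
Proof. by move=> x0; rewrite /radial (slice_i0 i0_0) // tau_radial //; ring. Qed.

(** With [W = w + 1 + |c| ^ 2 = 2 / (1 - z_1)], the field is [(W ^ 2 / 2 - |c| ^ 2 W) G_1(z) - W
    <G(z), c>]. After division by [x] the coefficient of [G_1] is [(x + 1) / 2] up to a bounded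
    error, and the last term is of order [x ^ (-1/2)]. Replacing [z] by [radial x] costs [x] times
    the anisotropic Lipschitz bound, again of order [x ^ (-1/2)]. *)
Lemma slice_field_asymptotic (c : vec n) (y : R) : c i0 = 0%cx ->
  exists K x0, 0 <= K /\ 1 <= x0 /\ forall x, x0 <= x ->
    Rabs (fst (slice_field i0 G c (x, y)) / x - radial_rate x) <= K / sqrt x.
Proof.
move=> c0.
case: (G1_bound (r := 2)) => [|M [M0 HM]]; first lra.
case: (Gj_bound (r := 2)) => [|M2 [M20 HM2]]; first lra.
case: (G1_lipschitz i0_0 G_diff G1_bound Gj_bound (r := 2)) => [|A [A0 HA]]; first lra.
set e := vnorm2 c; have e0 : 0 <= e by exact: vnorm2_ge0.
set k1 := 1 + e + Rabs y; have y0 := Rabs_pos y.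
have k11 : 1 <= k1 by rewrite /k1; lra.
set nc := norm1 c; have nc0 : 0 <= nc by exact: norm1_ge0.
set nb := norm1 (basis n 0); have nb0 : 0 <= nb by exact: norm1_ge0.
pose N1 := 2 * nc + 2 * k1 * nb.
have kb : 0 <= k1 * nb by apply: Rmult_le_pos; lra.
have N10 : 0 <= N1 by rewrite /N1; lra.
(* The first two summands come from [T1], the third from [T2], the last from [T3]; the threshold
   [k1] makes [W] comparable to [x]. *)
exists (8 * A * k1 + 8 * A * N1 + 8 * k1 * M + 4 * M2 * nc), k1.
split.
  have := Rmult_le_pos _ _ A0 N10; have := Rmult_le_pos _ _ M20 nc0.
  have : 0 <= A * k1 by apply: Rmult_le_pos; lra.
  have : 0 <= k1 * M by apply: Rmult_le_pos; lra.
  lra.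
split=> // x hx.
have x1 : 1 <= x by lra.
set w : C := (x, y); have w0 : 0 < fst w by rewrite /=; lra.
set W := (w + RtoC (1 + e))%cx.
have W0 : W <> 0%cx by exact: tau_denom_neq0.
have Wlow : x + 1 <= Cmod W.
  apply: Rle_trans (Rle_trans _ _ _ (Rle_abs _) (Cmod_fst _)); rewrite /W /w; cx_unfold; lra.
set eta : C := (1 + e, y).
have We : W = (RtoC x + eta)%cx by rewrite /W /w /eta; cx_ring.
have eta1 : Cmod eta <= k1.
  by apply: Rle_trans (Cmod_le_fst_snd _) _; rewrite /= Rabs_pos_eq; rewrite /k1; lra.
have Wup : Cmod W <= 2 * x.
  by rewrite We; apply: Rle_trans (Cmod_add _ _) _; rewrite Cmod_RtoC Rabs_pos_eq; lra.
set t := tau c w; set t0 := tau (@vzero n) (RtoC x).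
have tW : (t * W)%cx = RtoC 2 by rewrite /t /tau -/e -/W; field.
have tn : t <> 0%cx by exact: tau_neq0.
have tm : Cmod t = 2 / Cmod W.
  by rewrite /t /tau Cmod_div // Cmod_RtoC Rabs_pos_eq //; lra.
have tb : Cmod t <= 2 / x.
  rewrite tm; apply: Rmult_le_compat_l; first lra.
  by apply: Rinv_le_contravar; lra.
set z := slice c t; set z0 := radial x.
have Kz : Koranyi 2 z by apply: slice_koranyi.
have Kz0 : Koranyi 2 z0 by exact: radial_koranyi.
have zi0 : (1 - z i0)%cx = t by rewrite /z (slice_i0 i0_0) //; ring.
have z0i0 : (1 - z0 i0)%cx = RtoC (2 / (x + 1)) by apply: radial_i0; lra.
have m0 : Cmod (RtoC (2 / (x + 1))) = 2 / (x + 1).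
  by rewrite Cmod_RtoC Rabs_pos_eq //; apply/Rlt_le/Rdiv_lt_0_compat; lra.
have m0b : 2 / (x + 1) <= 2 / x.
  by apply: Rmult_le_compat_l; [lra | apply: Rinv_le_contravar; lra].
set u1 := G z i0; set u0 := G z0 i0.
set ip := inner (G z) c.
have QE : slice_field i0 G c w = ((W * W * RtoC (/ 2) - RtoC e * W) * u1 - W * ip)%cx.
  rewrite /slice_field /dsiegel -/t -/z zi0 -/ip -/u1 {1}/z (inner_slice i0_0) // -/e.
  have two := RtoC2_neq0.
  have WE : W = (RtoC 2 / t)%cx by rewrite -tW; field.
  have h2 : RtoC (/ 2) = Cinv (RtoC 2) by apply C_ext; cx_unfold; field.
  by rewrite WE h2; field.
set a := (W * W * RtoC (/ 2) - RtoC e * W)%cx in QE.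
set xi := RtoC (/ x).
(* Three errors: the change of point, the change of coefficient, and the tangential part of [G]. *)
have dec : fst (slice_field i0 G c w) / x - radial_rate x =
   fst (a * xi * (u1 - u0) + (a * xi - RtoC ((x + 1) / 2)) * u0 - W * xi * ip)%cx.
  rewrite QE /radial_rate -/z0 -/u0 /xi; cx_unfold; field; lra.
set q := / sqrt x.
have sx0 : 0 < sqrt x by apply: sqrt_lt_R0; lra.
have q0 : 0 < q by exact: Rinv_0_lt_compat.
have qq : q * q = / x by rewrite /q -Rinv_mult sqrt_sqrt //; lra.
have q1 : q <= 1.
  rewrite /q -Rinv_1; apply: Rinv_le_contravar; first lra.
  by rewrite -sqrt_1; apply: sqrt_le_1_alt; lra.
have ix0 : 0 < / x by apply: Rinv_0_lt_compat; lra.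
have sq2 : sqrt (2 / x) <= 2 * q.
  rewrite -(sqrt_pow2 (2 * q)); last lra.
  apply: sqrt_le_1_alt; have -> : (2 * q) ^ 2 = 4 * (q * q) by ring.
  by rewrite qq /Rdiv; lra.
have xix : x * / x = 1 by field; lra.
have mxi : Cmod xi = / x by rewrite /xi Cmod_RtoC Rabs_pos_eq //; lra.
have ba : Cmod (a * xi)%cx <= 4 * x.
  rewrite Cmod_mul mxi; apply/Rle_div_l; first lra.
  rewrite /a; apply: Rle_trans (Cmod_sub _ _) _; rewrite !Cmod_mul !Cmod_RtoC !Rabs_pos_eq; try lra.
  have : Cmod W * Cmod W <= 2 * x * (2 * x) by apply: Rmult_le_compat; try lra; exact: Cmod_ge0.
  have : e * Cmod W <= x * (2 * x) by apply: Rmult_le_compat; rewrite /k1 in hx; lra.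
  lra.
have bb : Cmod (a * xi - RtoC ((x + 1) / 2))%cx <= 4 * k1.
  have -> : (a * xi - RtoC ((x + 1) / 2))%cx =
     (eta - RtoC (e + / 2) + xi * RtoC (/ 2) * (eta * eta - RtoC (2 * e) * eta))%cx.
    rewrite /a We /xi; apply C_ext; cx_unfold; field; lra.
  apply: Rle_trans (Cmod_add _ _) _.
  have b1 : Cmod (eta - RtoC (e + / 2))%cx <= k1 + k1.
    apply: Rle_trans (Cmod_sub _ _) _; rewrite Cmod_RtoC Rabs_pos_eq; rewrite /k1 in eta1 *; lra.
  have b2 : Cmod (xi * RtoC (/ 2) * (eta * eta - RtoC (2 * e) * eta))%cx <= 2 * k1.
    rewrite !Cmod_mul mxi Cmod_RtoC Rabs_pos_eq; last lra.
    have b3 : Cmod (eta * eta - RtoC (2 * e) * eta)%cx <= 3 * k1 * k1.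
      apply: Rle_trans (Cmod_sub _ _) _; rewrite !Cmod_mul Cmod_RtoC Rabs_pos_eq; last lra.
      have : Cmod eta * Cmod eta <= k1 * k1 by apply: Rmult_le_compat => //; exact: Cmod_ge0.
      have : 2 * e * Cmod eta <= 2 * k1 * k1.
        by apply: Rmult_le_compat => //; [lra | exact: Cmod_ge0 | rewrite /k1; lra].
      lra.
    have b4 : / x * k1 <= 1 by rewrite -xix Rmult_comm; apply: Rmult_le_compat_r; lra.
    have : / x * / 2 * Cmod (eta * eta - RtoC (2 * e) * eta)%cx <= / x * / 2 * (3 * k1 * k1).
      by apply: Rmult_le_compat_l => //; lra.
    have : / x * k1 * k1 <= 1 * k1 by apply: Rmult_le_compat_r; lra.
    lra.
  lra.
have bu0 : Cmod u0 <= M * (2 / x).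
  by apply: Rle_trans (HM _ Kz0) _; rewrite z0i0 m0; apply: Rmult_le_compat_l.
have bip : Cmod ip <= M2 * (2 * q) * nc.
  apply: inner_bound => // i ii; apply: Rle_trans (HM2 i ii z Kz) _; apply: Rmult_le_compat_l => //.
  by apply: Rle_trans sq2; apply: sqrt_le_1_alt; rewrite zi0.
have dt : Cmod (t - RtoC (2 / (x + 1)))%cx <= 2 * k1 * (q * q) * (q * q).
  have x1n : RtoC (x + 1) <> 0%cx by case; lra.
  have -> : (t - RtoC (2 / (x + 1)))%cx = (RtoC 2 * (RtoC (x + 1) - W) / (W * RtoC (x + 1)))%cx.
    have -> : RtoC (2 / (x + 1)) = (RtoC 2 / RtoC (x + 1))%cx by apply C_ext; cx_unfold; field; nra.
    by rewrite /t /tau -/e -/W; field.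
  have dW : Cmod (RtoC (x + 1) - W)%cx <= k1.
    apply: Rle_trans (Cmod_le_fst_snd _) _; rewrite /W /w; cx_unfold.
    have -> : x + 1 + - (x + (1 + e)) = - e by ring.
    have -> : 0 + - (y + 0) = - y by ring.
    rewrite !Rabs_Ropp (Rabs_pos_eq e) // /k1; lra.
  rewrite Cmod_div; last first.
    by apply: Cmod_neq0; rewrite Cmod_mul; apply: Rmult_lt_0_compat; [lra | exact: Cmod_gt0].
  rewrite !Cmod_mul !Cmod_RtoC (Rabs_pos_eq 2) ?(Rabs_pos_eq (x + 1)); try lra.
  have Wx : x * x <= Cmod W * (x + 1) by apply: Rmult_le_compat; lra.
  apply/Rle_div_l; first by apply: Rmult_lt_0_compat; lra.
  have : 2 * k1 * (q * q) * (q * q) * (x * x) <= 2 * k1 * (q * q) * (q * q) * (Cmod W * (x + 1)).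
    apply: Rmult_le_compat_l => //; rewrite qq; repeat apply: Rmult_le_pos; lra.
  have -> : 2 * k1 * (q * q) * (q * q) * (x * x) = 2 * k1 by rewrite qq; field; lra.
  lra.
have qq1 : q * q <= 1 by nra.
have dz : norm1 (vsub z z0) <= N1 * (q * q).
  have -> : vsub z z0 = vadd (vscal t c) (vscal (RtoC (2 / (x + 1)) - t) (basis n 0)).
    apply: vec_ext => i; rewrite /vsub /z /z0 /radial tau_radial; last lra.
    by rewrite /slice /vadd /vscal /vsub /vzero; ring.
  apply: Rle_trans (norm1_add _ _) _; rewrite !norm1_scal -/nc -/nb (Cmod_subC _ t).
  have : Cmod t * nc <= 2 / x * nc by apply: Rmult_le_compat_r.
  have : Cmod (t - RtoC (2 / (x + 1)))%cx * nb <= 2 * k1 * (q * q) * (q * q) * nb by apply: Rmult_le_compat_r.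
  have p0 : 0 <= 2 * k1 * nb * (q * q).
    by apply: Rmult_le_pos; [apply: Rmult_le_pos; lra | rewrite qq; lra].
  have : 2 * k1 * nb * (q * q) * (q * q) <= 2 * k1 * nb * (q * q) * 1 by apply: Rmult_le_compat_l.
  by rewrite /N1 /Rdiv -qq; lra.
have bd : Cmod (u1 - u0)%cx <= A * (2 * k1 * (q * q) * q + 2 * q * (N1 * (q * q))).
  have hb1 : Cmod (1 - z i0)%cx <= 2 / x by rewrite zi0.
  have hb2 : Cmod (1 - z0 i0)%cx <= 2 / x by rewrite z0i0 m0.
  apply: Rle_trans (HA z z0 (2 / x) Kz Kz0 hb1 hb2) _.
  apply: Rmult_le_compat_l => //; apply: Rplus_le_compat.
    have -> : (z i0 - z0 i0)%cx = ((1 - z0 i0) - (1 - z i0))%cx by ring.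
    rewrite zi0 z0i0 Cmod_subC; apply: Rle_trans dt _.
    apply: Rmult_le_compat_l; last by nra.
    by rewrite qq; apply: Rmult_le_pos; lra.
  by apply: Rmult_le_compat => //; [exact: sqrt_pos | exact: norm1_ge0].
rewrite -/w dec; apply: Rle_trans (Cmod_fst _) _.
apply: Rle_trans (Cmod_sub _ _) _.
have T1 : Cmod (a * xi * (u1 - u0))%cx <= (8 * A * k1 + 8 * A * N1) * q.
  rewrite Cmod_mul.
  have : Cmod (a * xi)%cx * Cmod (u1 - u0)%cx <= 4 * x * (A * (2 * k1 * (q * q) * q + 2 * q * (N1 * (q * q)))).
    by apply: Rmult_le_compat => //; exact: Cmod_ge0.
  have -> : 4 * x * (A * (2 * k1 * (q * q) * q + 2 * q * (N1 * (q * q)))) = (x * (q * q)) * ((8 * A * k1 + 8 * A * N1) * q) by ring.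
  rewrite qq xix; lra.
have T2 : Cmod ((a * xi - RtoC ((x + 1) / 2)) * u0)%cx <= 8 * k1 * M * q.
  rewrite Cmod_mul.
  have : Cmod (a * xi - RtoC ((x + 1) / 2))%cx * Cmod u0 <= 4 * k1 * (M * (2 / x)).
    by apply: Rmult_le_compat => //; exact: Cmod_ge0.
  have -> : 4 * k1 * (M * (2 / x)) = 8 * k1 * M * (q * q) by rewrite qq; field; lra.
  have kM : 0 <= 8 * k1 * M by apply: Rmult_le_pos; lra.
  have : 8 * k1 * M * (q * q) <= 8 * k1 * M * q by apply: Rmult_le_compat_l => //; nra.
  lra.
have T3 : Cmod (W * xi * ip)%cx <= 4 * M2 * nc * q.
  rewrite !Cmod_mul mxi.
  have : Cmod W * / x * Cmod ip <= 2 * (M2 * (2 * q) * nc).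
    apply: Rmult_le_compat => //; [| exact: Cmod_ge0 |].
      by apply: Rmult_le_pos; [exact: Cmod_ge0 | lra].
    by apply/Rle_div_l; lra.
  lra.
have := Cmod_add (a * xi * (u1 - u0))%cx ((a * xi - RtoC ((x + 1) / 2)) * u0)%cx.
rewrite /Rdiv -/q; lra.
Qed.

Lemma slice_field_param (z : vec n) : ball z ->
  slice_field i0 G (slice_param i0 z) (siegel i0 (slice_param i0 z) z) =
  dsiegel i0 (slice_param i0 z) z (G z).
Proof.
move=> hz; have [_ [_ E]] := siegel_param i0_0 hz.
by rewrite /slice_field E (slice_paramE i0_0 hz).
Qed.

(** The ratio is nonincreasing in [x], and far out it is within any [e] of [radial_rate], which is
    at least [- M]. The speed of approach depends on the slice, but [M] does not. *)
Lemma slice_field_lower_bound : exists M, forall c w, c i0 = 0%cx -> 0 < fst w ->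
  - M * fst w <= fst (slice_field i0 G c w).
Proof.
case: (G1_bound (r := 2)) => [|M [M0 HM]]; first lra.
exists M => c [x y] c0 x0; have {}x0 : 0 < x by exact: x0.
suff H : - M <= fst (slice_field i0 G c (x, y)) / x by apply/Rle_div_r.
apply: le_epsilon => e e0.
case: (slice_field_asymptotic y c0) => K [x1 [K0 [x11 HK]]].
case: (div_sqrt_small K0 e0) => x2 [x21 Hx2].
pose X := Rmax x (Rmax x1 x2).
have h1 : x <= X by exact: Rmax_l.
have h2 : x1 <= X by apply: Rle_trans (Rmax_l _ _) (Rmax_r _ _).
have h3 : x2 <= X by apply: Rle_trans (Rmax_r _ _) (Rmax_r _ _).
have := slice_field_ratio_decreasing i0_0 G_diff y G_gen c0 x0 h1.
have := HK X h2; have := Hx2 X h3 => q1 q2 q3.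
have : Rabs (radial_rate X) <= M.
  rewrite /radial_rate Rabs_mult (Rabs_pos_eq ((X + 1) / 2)); last lra.
  have := HM _ (radial_koranyi (x := X) ltac:(lra)); rewrite radial_i0; last lra.
  rewrite Cmod_RtoC Rabs_pos_eq; last by apply/Rlt_le/Rdiv_lt_0_compat; lra.
  move=> q4; have := Rle_trans _ _ _ (Cmod_fst _) q4 => q5.
  have : Rabs (fst (G (radial X) i0)) * ((X + 1) / 2) <= M * (2 / (X + 1)) * ((X + 1) / 2).
    by apply: Rmult_le_compat_r => //; lra.
  by have -> : M * (2 / (X + 1)) * ((X + 1) / 2) = M by field; lra.
move: q2 => /Rabs_le_between q2 /Rabs_le_between; lra.
Qed.

(** Every point lies on its own slice, where [uB] and its derivative along [G] are minus the real
    parts of the Siegel coordinate and of the slice field. *)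
Lemma generator_BRNP : BRNP G.
Proof.
case: slice_field_lower_bound => M HM; exists M => z hz.
have [E1 [E2 _]] := siegel_param i0_0 hz.
eexists; split; first exact: (du_siegel i0_0 _ hz).
have := HM _ _ (slice_param_i0 i0 z) E2; rewrite slice_field_param // E1; lra.
Qed.

(** * The dilation on the central slice *)

Section Dilation.
Variable beta : R.
Hypothesis beta_dil : is_dilation G beta.

Lemma dilation_lower (w : C) : 0 < fst w -> - beta * fst w <= fst (slice_field i0 G vzero w).
Proof.
move=> w0; have [ub _] := beta_dil.
have c0 : @vzero n i0 = 0%cx by [].
pose z := slice (@vzero n) (tau (@vzero n) w); have hz : ball z by exact: (slice_ball i0_0).
have sp : slice_param i0 z = vzero.
  apply: vec_ext => i; rewrite /slice_param; case: eqP => // /eqP ii.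
  rewrite /z (slice_i i0_0) // (slice_i0 i0_0) //.
  have t0 := tau_neq0 (c := @vzero n) w0; rewrite /vzero in t0 *; field.
  by have -> // : (1 - (1 - tau (fun _ : 'I_n => 0%cx) w))%cx = tau (fun _ : 'I_n => 0%cx) w by ring.
have sE : siegel i0 vzero z = w by exact: siegel_slice_tau.
have [E1 _] := siegel_param i0_0 hz; have := du_siegel i0_0 (G z) hz; have := slice_field_param hz.
rewrite sp sE in E1 *; move=> E3 du.
have : - (- fst (dsiegel i0 vzero z (G z)) / uB z) <= beta by apply: ub; exists z, (- fst (dsiegel i0 vzero z (G z))).
rewrite -E3 (_ : uB z = - fst w); last lra.
have -> : - (- fst (slice_field i0 G vzero w) / - fst w) = - (fst (slice_field i0 G vzero w) / fst w) by field; lra.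
move=> h; apply/Rle_div_r => //; lra.
Qed.

Lemma dilation_approx (e : R) : 0 < e -> exists c w, c i0 = 0%cx /\ 0 < fst w /\
  fst (slice_field i0 G c w) / fst w < - beta + e.
Proof.
move=> e0; apply: NNPP => N; have [_ lub] := beta_dil.
suff : beta <= beta - e by lra.
apply: lub => y [z [l [hz [du ->]]]].
rewrite (du_unique i0_0 hz du); have [E1 [E2 _]] := siegel_param i0_0 hz.
rewrite -(slice_field_param hz) (_ : uB z = - fst (siegel i0 (slice_param i0 z) z)); last lra.
set w := siegel _ _ _ in E2 *; set c := slice_param _ _.
have -> : - (- fst (slice_field i0 G c w) / - fst w) = - (fst (slice_field i0 G c w) / fst w) by field; lra.
apply: Rnot_lt_le => h; apply: N; exists c, w; split; first exact: slice_param_i0.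
by split=> //; lra.
Qed.

Definition excess (w : C) : C := (slice_field i0 G vzero w + RtoC beta * w)%cx.

Lemma slice_field0 (w : C) : slice_field i0 G vzero w =
  (RtoC 2 * G (slice vzero (tau (@vzero n) w)) i0 / (tau (@vzero n) w * tau (@vzero n) w))%cx.
Proof.
rewrite /slice_field /dsiegel !inner_vzero (slice_i0 i0_0) //.
set t := tau (@vzero n) w; have -> : (1 - (1 - t))%cx = t by ring.
by rewrite /Cdiv; ring.
Qed.

Lemma excess_diff (w : C) : 0 < fst w -> exists d, cdiff excess w d.
Proof.
move=> w0.
have [d1 H1] : exists d, cdiff (tau (@vzero n)) w d.
  eexists; apply: cdiff_div (cdiff_const _ _) (cdiff_add (cdiff_id _) (cdiff_const _ _)).
  exact: tau_denom_neq0.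
have H2 := cdiff_comp H1 (line_cdiff G_diff i0 (slice_ball i0_0 (vzero_i0) w0)).
have t0 := tau_neq0 (c := @vzero n) w0.
eexists; apply: cdiff_add; last exact: cdiff_scal (cdiff_id _).
apply: (cdiff_ext (F := fun w => (RtoC 2 * G (slice vzero (tau (@vzero n) w)) i0 / (tau (@vzero n) w * tau (@vzero n) w))%cx)).
  by move=> v; rewrite slice_field0.
apply: (@cdiff_div (fun w => RtoC 2 * G (slice vzero (tau (@vzero n) w)) i0)%cx (fun w => tau (@vzero n) w * tau (@vzero n) w)%cx).
- by apply: Cmod_neq0; rewrite Cmod_mul; have := Cmod_gt0 t0; nra.
- exact: cdiff_scal H2.
- exact: (cdiff_mul H1 H1).
Qed.

Lemma excess_fst (w : C) : fst (excess w) = fst (slice_field i0 G vzero w) + beta * fst w.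
Proof. by rewrite /excess; set q := slice_field _ _ _ _; cx_unfold; ring. Qed.

Lemma excess_ge0 (w : C) : 0 < fst w -> 0 <= fst (excess w).
Proof. by move=> w0; have := dilation_lower w0; rewrite excess_fst; lra. Qed.

(** Some slice has a ratio below [- beta + e / 3] at one point, hence at all later abscissas with
    the same [y]. Two comparisons with [radial_rate], from that slice and to the central one, cost
    [e / 3] each for large [x]. *)
Lemma excess_radial (e : R) : 0 < e -> exists x0, 0 < x0 /\
  forall x, x0 <= x -> fst (excess (x, 0)) <= e * x.
Proof.
move=> e0; case: (dilation_approx (e := e / 3)) => [|c [[x1 y] [c0 [x10 H1]]]]; first lra.
have {}x10 : 0 < x1 by exact: x10.
have {}H1 : fst (slice_field i0 G c (x1, y)) / x1 < - beta + e / 3 by exact: H1.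
case: (slice_field_asymptotic y c0) => K [x2 [K0 [x21 HK]]].
case: (slice_field_asymptotic (c := vzero) 0 vzero_i0) => K' [x3 [K0' [x31 HK']]].
case: (div_sqrt_small (e := e / 3) K0) => [|x4 [x41 Hx4]]; first lra.
case: (div_sqrt_small (e := e / 3) K0') => [|x5 [x51 Hx5]]; first lra.
exists (x1 + x2 + x3 + x4 + x5); split; first lra.
move=> x hx.
have := slice_field_ratio_decreasing i0_0 G_diff y G_gen c0 x10 (x' := x) ltac:(lra).
have := HK x ltac:(lra); have := HK' x ltac:(lra); have := Hx4 x ltac:(lra); have := Hx5 x ltac:(lra).
move=> q1 q2 /Rabs_le_between q3 /Rabs_le_between q4 q5.
have : fst (slice_field i0 G vzero (x, 0)) / x <= - beta + e by lra.
have xp : 0 < x by lra.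
move=> /(Rle_div_l _ _ _ xp); rewrite excess_fst /fst; lra.
Qed.

Lemma excess_sublinear (M e : R) : 0 <= M -> 0 < e -> exists x1, 0 < x1 /\
  forall w, x1 <= fst w -> Rabs (snd w) <= M * fst w -> Cmod (excess w) <= e * fst w.
Proof.
move=> M0 e0; have eM := exp_pos M.
have Me : 0 <= M * exp M by apply: Rmult_le_pos; lra.
have B0 : 0 < 1 + M * exp M by lra.
(* This cancels the constant of [halfplane_sublinear] down to [e / 2]; the other half absorbs the
   value [m] at the base point once [x >= 2 * m / e]. *)
case: (excess_radial (e := e / (2 * (1 + M * exp M)))) => [|x0 [x00 H0]].
  by apply: Rdiv_lt_0_compat; lra.
pose h' w := epsilon (inhabits 0%cx) (cdiff excess w).
have Hh : forall w, 0 < fst w -> cdiff excess w (h' w).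
  by move=> w w0; exact: (epsilon_spec (inhabits 0%cx) (cdiff excess w) (excess_diff w0)).
set m := Cmod (excess (x0, 0)); have m0 : 0 <= m by exact: Cmod_ge0.
exists (Rmax x0 (2 * m / e)); split; first by apply: Rlt_le_trans x00 (Rmax_l _ _).
move=> [x y]; rewrite -[fst (x, y)]/x -[snd (x, y)]/y => hx hy.
have hx1 := Rle_trans _ _ _ (Rmax_l _ _) hx; have hx2 := Rle_trans _ _ _ (Rmax_r _ _) hx.
have ep : 0 <= e / (2 * (1 + M * exp M)) by apply/Rlt_le/Rdiv_lt_0_compat; lra.
have := @halfplane_sublinear excess h' x0 x y M _ Hh excess_ge0 x00 hx1 ep hy H0.
rewrite -/m.
have -> : (1 + M * exp M) * (e / (2 * (1 + M * exp M))) * x = e / 2 * x by field; lra.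
have : 2 * m <= x * e by apply/Rle_div_l.
lra.
Qed.

(** With [t = 1 - a] and [w = 2 / t - 1], the difference equals [t ^ 2 / 2] times [excess w + beta].
    Non-tangential approach to 1 in the disc means that [w] tends to infinity within a sector, where
    [excess w] is of smaller order than [1 / |t|]. *)
Lemma G1_axis (M e : R) : 1 <= M -> 0 < e -> exists delta, 0 < delta /\ forall a : C,
  Cmod (1 - a)%cx < delta -> Cmod (1 - a)%cx <= M * (1 - Cmod a) -> 0 < Cmod (1 - a)%cx ->
  Cmod (G (slice vzero (1 - a)%cx) i0 - RtoC beta * (a - 1))%cx <= e * Cmod (1 - a)%cx.
Proof.
move=> M1 e0; case: (excess_sublinear (M := 4 * M) (e := e / 4)) => [||x1 [x10 Hx]]; try lra.
have b0 := Rabs_pos beta.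
(* The first bound forces [Re w >= x1], as [1 / |t| <= M Re w]; the second makes the contribution of
   [beta] at most [e / 2] times [|t|]. *)
exists (Rmin (/ (M * x1)) (e / (Rabs beta + 1))); split.
  apply: Rmin_pos; first by apply: Rinv_0_lt_compat; apply: Rmult_lt_0_compat; lra.
  by apply: Rdiv_lt_0_compat; lra.
move=> a ha hM ta.
have h1 := Rlt_le_trans _ _ _ ha (Rmin_l _ _); have h2 := Rlt_le_trans _ _ _ ha (Rmin_r _ _).
set t := (1 - a)%cx in ha hM ta h1 h2 *; have tn := Cmod_neq0 ta.
have a0 := Cmod_ge0 a.
have a1 : Cmod a < 1 by apply: Rnot_le_lt => h; nra.
have t2 : Cmod t <= 2 by apply: Rle_trans (Cmod_sub _ _) _; rewrite Cmod1; lra.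
pose w := (RtoC 2 / t - 1)%cx.
have tw : tau (@vzero n) w = t.
  rewrite /tau vnorm2_zero /w; have -> : RtoC (1 + 0) = 1%cx by cx_ring.
  have -> : (RtoC 2 / t - 1 + 1)%cx = (RtoC 2 / t)%cx by ring.
  by have two := RtoC2_neq0; field.
have it : / Cmod t * Cmod t = 1 by field; lra.
have it0 : 0 < / Cmod t by exact: Rinv_0_lt_compat.
have wm : Cmod w <= 4 * / Cmod t.
  rewrite /w; apply: Rle_trans (Cmod_sub _ _) _; rewrite Cmod_div // Cmod1 Cmod_RtoC Rabs_pos_eq; last lra.
  have : 1 <= 2 * / Cmod t by rewrite -it Rmult_comm; apply: Rmult_le_compat_r; lra.
  rewrite /Rdiv; lra.
have wr : / Cmod t <= M * fst w.
  have D := Cnorm2_gt0 tn.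
  have -> : fst w = (1 - Cnorm2 a) * / Cmod t * / Cmod t.
    have -> : (1 - Cnorm2 a) * / Cmod t * / Cmod t = (1 - Cnorm2 a) / Cmod t ^ 2 by field; lra.
    rewrite Cmod_sqr /w; move: D; rewrite /t; cx_unfold => D; field; lra.
  rewrite -Cmod_sqr.
  have : 1 <= M * (1 - Cmod a ^ 2) * / Cmod t.
    rewrite -it Rmult_comm; apply: Rmult_le_compat_r; first lra.
    apply: Rle_trans hM _; apply: Rmult_le_compat_l; first lra; nra.
  nra.
have w0 : 0 < fst w by apply: (Rmult_lt_reg_l M); lra.
have xw : x1 <= fst w.
  apply: (Rmult_le_reg_l M); first lra.
  apply: Rle_trans wr; rewrite -(Rinv_inv (M * x1)).
  by apply: Rinv_le_contravar; lra.
have yw : Rabs (snd w) <= 4 * M * fst w by apply: Rle_trans (Cmod_snd _) _; lra.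
have Ew := Hx w xw yw.
have fw : fst w <= 4 * / Cmod t by apply: Rle_trans (Rle_trans _ _ _ (Rle_abs _) (Cmod_fst _)) wm.
have -> : (G (slice vzero t) i0 - RtoC beta * (a - 1))%cx = (t * t * RtoC (/ 2) * (excess w + RtoC beta))%cx.
  rewrite /excess slice_field0 tw; have two := RtoC2_neq0.
  have h3 : RtoC (/ 2) = Cinv (RtoC 2) by apply C_ext; cx_unfold; field.
  have -> : (a - 1)%cx = (- t)%cx by rewrite /t; ring.
  by rewrite h3 /w; field.
rewrite !Cmod_mul Cmod_RtoC Rabs_pos_eq; last lra.
have B : Cmod (excess w + RtoC beta)%cx <= e * / Cmod t + Rabs beta.
  apply: Rle_trans (Cmod_add _ _) _; rewrite Cmod_RtoC.
  have : e / 4 * fst w <= e / 4 * (4 * / Cmod t) by apply: Rmult_le_compat_l; lra.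
  lra.
have tt : 0 <= Cmod t * Cmod t * / 2 by nra.
apply: Rle_trans (Rmult_le_compat_l _ _ _ tt B) _.
have -> : Cmod t * Cmod t * / 2 * (e * / Cmod t + Rabs beta) = / 2 * Cmod t * (e * (/ Cmod t * Cmod t) + Cmod t * Rabs beta) by field; lra.
rewrite it Rmult_1_r.
have : Cmod t * (Rabs beta + 1) < e by apply/Rlt_div_r => //; lra.
nra.
Qed.

End Dilation.
End Asymptotics.

(** * Restricted K-limits *)

Lemma Cmod_Csqrt (a : C) : Cmod (Csqrt a) = sqrt (Cmod a).
Proof.
rewrite {1}/Cmod; f_equal; rewrite /Csqrt.
have /Rabs_le_between h := Cmod_fst a.
set s := (if _ then _ else _); have ss : s ^ 2 = 1 by rewrite /s; case: Rlt_dec => ? /=; ring.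
transitivity (sqrt ((Cmod a + fst a) / 2) ^ 2 + s ^ 2 * sqrt ((Cmod a - fst a) / 2) ^ 2).
  by rewrite /Cnorm2 /=; ring.
by rewrite ss !pow2_sqrt; lra.
Qed.

Section KLimits.
Variables (n : nat) (i0 : 'I_n).
Hypothesis i0_0 : nat_of_ord i0 = 0%N.

(** Restricted approach in uniform form: [M] is the non-tangential aperture for [z_1], and [delta]
    bounds both [|1 - z_1|] and the ratio that tends to 0. The slice of parameter 0 supplies the
    projection [(z_1, 0)]. *)
Definition near_e1 (M delta : R) (z : vec n) : Prop :=
  ball z /\ Cmod (1 - z i0)%cx < delta /\ Cmod (1 - z i0)%cx <= M * (1 - Cmod (z i0)) /\
  vnorm2 (vsub z (slice (@vzero n) (1 - z i0)%cx)) <= delta * (1 - Cnorm2 (z i0)).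

Lemma axisE (z : vec n) (i : 'I_n) : slice (@vzero n) (1 - z i0)%cx i = if i == i0 then z i0 else 0%cx.
Proof.
case: eqP => [->|/eqP ii]; first by rewrite (slice_i0 i0_0) //; ring.
by rewrite (slice_i i0_0) // /vzero; ring.
Qed.

Lemma vnorm2_axis (z : vec n) :
  vnorm2 z = Cnorm2 (z i0) + vnorm2 (vsub z (slice (@vzero n) (1 - z i0)%cx)).
Proof.
have -> : Cnorm2 (z i0) = \big[Rplus/0]_(i < n) (if i == i0 then Cnorm2 (z i0) else 0).
  by rewrite -big_mkcond big_pred1_eq.
rewrite /vnorm2 -sumR_add; apply: eq_bigr => i _; rewrite /vsub axisE.
by case: eqP => [->|_]; cx_unfold; ring.
Qed.

(** The restricted condition gives [1 - |z| ^ 2 >= (1 - |z_1| ^ 2) / 2], which turns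
    non-tangentiality of [z_1] into a Koranyi condition for [z] and for its projection. *)
Lemma near_koranyi (M delta : R) (z : vec n) : 1 <= M -> delta <= / 2 -> near_e1 M delta z ->
  Koranyi (4 * M) z /\ Koranyi (4 * M) (slice (@vzero n) (1 - z i0)%cx).
Proof.
move=> M1 d2 [hz [h1 [h2 h3]]].
have z0 := Cmod_ge0 (z i0); have t0 := Cmod_gt0 (ball_coord1_neq1 hz (i0 := i0)).
have z1 : Cmod (z i0) < 1 by apply: Rnot_le_lt => h; nra.
have zz : 1 - Cmod (z i0) <= 1 - Cnorm2 (z i0) by rewrite -Cmod_sqr; nra.
have v := vnorm2_axis z.
have E0 : slice (@vzero n) (1 - z i0)%cx i0 = z i0 by rewrite axisE eqxx.
have N0 : vnorm2 (slice (@vzero n) (1 - z i0)%cx) = Cnorm2 (z i0).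
  rewrite vnorm2_axis E0.
  have -> : vsub (slice (@vzero n) (1 - z i0)%cx) (slice (@vzero n) (1 - z i0)%cx) = (vzero : vec n).
    by apply: vec_ext => i; rewrite /vsub /vzero; ring.
  by rewrite vnorm2_zero Rplus_0_r.
have K1 : M * (1 - Cmod (z i0)) <= M * (1 - Cnorm2 (z i0)) by apply: Rmult_le_compat_l; lra.
have K0 : 0 <= M * (1 - Cnorm2 (z i0)) by lra.
split; apply/(koranyiE i0_0); split=> //.
- have : M * ((1 - Cnorm2 (z i0)) / 2) <= M * (1 - vnorm2 z) by apply: Rmult_le_compat_l; nra.
  lra.
- by rewrite /ball N0; lra.
- by rewrite E0 N0; lra.
Qed.

(** Cauchy's estimate along [e_1] runs over discs of radius proportional to [|1 - z_1|]; moving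
    within one leaves [z''] unchanged and only enlarges [M] and [delta] by a factor. *)
Lemma near_move (M delta : R) (z : vec n) (a : C) : 1 <= M -> delta <= / 8 -> near_e1 M delta z ->
  Cmod a < Cmod (1 - z i0)%cx / (4 * M) ->
  near_e1 (4 * M) (4 * delta) (vadd z (vscal a (basis n i0))).
Proof.
move=> M1 d8 [hz [h1 [h2 h3]]] ha; set z' := vadd _ _.
have E : z' i0 = (z i0 + a)%cx by rewrite /z' /vadd /vscal /basis eqxx; ring.
have a0 := Cmod_ge0 a; have {}ha : Cmod a * (4 * M) < Cmod (1 - z i0)%cx by apply/Rlt_div_r => //; lra.
have z0 := Cmod_ge0 (z i0).
have a4 : Cmod a <= Cmod (1 - z i0)%cx / 4 by nra.
have aM : Cmod a <= (1 - Cmod (z i0)) / 4 by apply: (Rmult_le_reg_r (4 * M)); nra.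
have d1 : Cmod (1 - z' i0)%cx <= Cmod (1 - z i0)%cx + Cmod a.
  rewrite E; have -> : (1 - (z i0 + a))%cx = ((1 - z i0) - a)%cx by ring.
  exact: Cmod_sub.
have d2 : Cmod (z' i0) <= Cmod (z i0) + Cmod a by rewrite E; exact: Cmod_add.
have z0' := Cmod_ge0 (z' i0).
have t0 := Cmod_gt0 (ball_coord1_neq1 hz (i0 := i0)).
have P : vsub z' (slice (@vzero n) (1 - z' i0)%cx) = vsub z (slice (@vzero n) (1 - z i0)%cx).
  apply: vec_ext => i; rewrite /vsub !axisE; case: eqP => [->|ii]; first by ring.
  rewrite /z' /vadd /vscal /basis; have -> : (nat_of_ord i == i0) = false; last by ring.
  by apply/eqP => /val_inj.
have zl : Cmod (z i0) < 1 by nra.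
have zl' : Cmod (z' i0) < 1 by lra.
have q1 : 1 - Cnorm2 (z i0) <= 2 * (1 - Cmod (z i0)) by rewrite -Cmod_sqr; nra.
have q2 : 1 - Cmod (z' i0) <= 1 - Cnorm2 (z' i0) by rewrite -Cmod_sqr; nra.
have dp : 0 < delta by lra.
have V : vnorm2 (vsub z' (slice (@vzero n) (1 - z' i0)%cx)) <= 4 * delta * (1 - Cnorm2 (z' i0)).
  rewrite P; apply: Rle_trans h3 _.
  have : delta * (1 - Cnorm2 (z i0)) <= delta * (4 * (1 - Cnorm2 (z' i0))) by apply: Rmult_le_compat_l; lra.
  lra.
split; [|split; [lra|split=> //]].
  rewrite /ball vnorm2_axis.
  have : 4 * delta * (1 - Cnorm2 (z' i0)) <= / 2 * (1 - Cnorm2 (z' i0)) by apply: Rmult_le_compat_r; lra.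
  lra.
apply: Rle_trans d1 _.
have : M * (1 - Cmod (z i0)) <= M * (4 / 3 * (1 - Cmod (z' i0))) by apply: Rmult_le_compat_l; lra.
have : 0 <= M * (1 - Cmod (z' i0)) by apply: Rmult_le_pos; lra.
lra.
Qed.

(** The aperture of the sequence, raised to at least 1, serves as [M]; the two conditions involving
    [delta] hold eventually. *)
Lemma K_lim_near (f : vec n -> C) (L : C) :
  (forall M e, 1 <= M -> 0 < e -> exists delta, 0 < delta /\
     forall z, near_e1 M delta z -> Cmod (f z - L)%cx <= e) -> K_lim f L.
Proof.
move=> H zs hb _ h2 h3 [M hM] e e0.
case: (H (Rmax 1 M) (e / 2) (Rmax_l _ _)) => [|delta [d0 Hd]]; first lra.
case: (h2 delta d0) => N1 HN1; case: (h3 delta d0) => N2 HN2.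
exists (Nat.max N1 N2) => k hk.
have k1 : (k >= N1)%coq_nat by lia.
have k2 : (k >= N2)%coq_nat by lia.
have {HN1} q1 := HN1 k k1; have {HN2} q2 := HN2 k k2; have {hM} q3 := hM k.
rewrite /Rdist !Rminus_0_r in q1 q2 *; rewrite !(coord1E i0_0) in q1 q2 q3.
have hz := hb k; set z := zs k in q1 q2 q3 hz *.
rewrite Rabs_pos_eq; last exact: Cmod_ge0.
rewrite Rabs_pos_eq in q2; last exact: Cmod_ge0.
apply: (Rle_lt_trans _ (e / 2)); last lra.
have zl : Cnorm2 (z i0) < 1 by have := Cnorm2_coord z i0; rewrite /ball in hz; lra.
have zm : Cmod (z i0) <= 1 by apply: Cmod_square_le; lra.
apply: Hd; split=> //; split; first by rewrite Cmod_subC.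
split.
  apply: Rle_trans q3 _; apply: Rmult_le_compat_r; first lra.
  exact: Rmax_r.
have <- : vsub z (vscal (z i0) (basis n 0)) = vsub z (slice (@vzero n) (1 - z i0)%cx).
  apply: vec_ext => i; rewrite /vsub axisE /vscal (basis0E i0_0).
  by case: eqP => _; ring.
by apply/Rle_div_l; [lra | exact: Rlt_le (Rle_lt_trans _ _ _ (Rle_abs _) q1)].
Qed.

End KLimits.

(** * Limits of the first component and of its derivatives *)

Section Conclusion.
Variables (n : nat) (i0 : 'I_n) (G : vec n -> vec n) (dG : vec n -> vec n -> vec n).
Hypothesis i0_0 : nat_of_ord i0 = 0%N.
Hypothesis G_diff : forall z, ball z -> is_cderiv G z (dG z).
Hypothesis G_gen : inf_generator G.
Hypothesis G1_bound : forall r, 1 <= r -> exists M, 0 <= M /\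
  forall z, Koranyi r z -> Cmod (G z i0) <= M * Cmod (1 - z i0)%cx.
Hypothesis Gj_bound : forall r, 1 <= r -> exists M, 0 <= M /\
  forall j, j != i0 -> forall z, Koranyi r z -> Cmod (G z j) <= M * sqrt (Cmod (1 - z i0)%cx).
Variable beta : R.
Hypothesis beta_dil : is_dilation G beta.

(** Comparison with the projection [(z_1, 0)]: restricted approach makes the distance to it small
    compared with [|1 - z_1| ^ (1/2)], and the Lipschitz bound for [G_1] has a second such factor,
    so the difference is small compared with [|1 - z_1|]. *)
Lemma G1_near (M e : R) : 1 <= M -> 0 < e -> exists delta, 0 < delta /\
  forall z, near_e1 i0 M delta z ->
    Cmod (G z i0 - RtoC beta * (z i0 - 1))%cx <= e * Cmod (1 - z i0)%cx.
Proof.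
move=> M1 e0.
case: (G1_axis i0_0 G_diff G_gen G1_bound Gj_bound beta_dil (M := M) (e := e / 2)) => [||d1 [d10 H1]]; try lra.
case: (G1_lipschitz i0_0 G_diff G1_bound Gj_bound (r := 4 * M)) => [|A [A0 HA]]; first lra.
have N0 := pos_INR n; have AN : 0 <= A * INR n by apply: Rmult_le_pos.
(* Chosen so that [A n s <= e / 2]. The bound [s ^ 2 / 2] on [delta] becomes [s ^ 2 |1 - z_1|] for
   the squared distance because [1 - |z_1| ^ 2 <= 2 |1 - z_1|]. *)
pose s := e / (2 * (A * INR n + 1)); have s0 : 0 < s by apply: Rdiv_lt_0_compat; lra.
have d20 : 0 < s ^ 2 / 2 by have := pow_lt s 2 s0; lra.
exists (Rmin (Rmin d1 (/ 2)) (s ^ 2 / 2)); split; first by repeat apply: Rmin_pos => //; lra.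
set delta := Rmin _ _ => z hz.
have q1 : delta <= d1 by apply: Rle_trans (Rmin_l _ _) (Rmin_l _ _).
have q2 : delta <= / 2 by apply: Rle_trans (Rmin_l _ _) (Rmin_r _ _).
have q3 : delta <= s ^ 2 / 2 by exact: Rmin_r.
have [K1 K2] := near_koranyi i0_0 M1 q2 hz; have [hb [h1 [h2 h3]]] := hz.
have t0 := Cmod_gt0 (ball_coord1_neq1 hb (i0 := i0)).
set t := Cmod (1 - z i0)%cx in h1 h2 t0 *.
have B1 := H1 (z i0) (Rlt_le_trans _ _ _ h1 q1) h2 t0.
set z0 := slice (@vzero n) (1 - z i0)%cx in K2 h3 B1.
have E0 : z0 i0 = z i0 by rewrite /z0 (axisE i0_0) eqxx.
have B2 := HA z z0 t K1 K2 (Rle_refl _); rewrite E0 in B2; have {}B2 := B2 (Rle_refl _).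
have -> : (G z i0 - RtoC beta * (z i0 - 1))%cx = ((G z i0 - G z0 i0) + (G z0 i0 - RtoC beta * (z i0 - 1)))%cx by ring.
apply: Rle_trans (Cmod_add _ _) _; rewrite -/t in B1.
suff : Cmod (G z i0 - G z0 i0)%cx <= e / 2 * t by lra.
apply: Rle_trans B2 _; have -> : (z i0 - z i0)%cx = 0%cx by ring.
rewrite Cmod0 Rplus_0_l.
have zm : Cmod (z i0) <= 1.
  by apply: Cmod_square_le; [lra | have := Cnorm2_coord z i0; rewrite /ball in hb; lra].
have q4 := one_sub_Cnorm2_le zm; rewrite -/t in q4.
have dp : 0 < delta by repeat apply: Rmin_pos => //; lra.
have q5 : vnorm2 (vsub z z0) <= s ^ 2 * t.
  apply: Rle_trans h3 _; apply: (Rle_trans _ (delta * (2 * t))); first by apply: Rmult_le_compat_l; lra.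
  have : delta * (2 * t) <= s ^ 2 / 2 * (2 * t) by apply: Rmult_le_compat_r; lra.
  lra.
have st0 := sqrt_pos t; have st := sqrt_sqrt t (Rlt_le _ _ t0).
have q6 : vnorm (vsub z z0) <= s * sqrt t.
  rewrite /vnorm -(sqrt_pow2 (s * sqrt t)); last by apply: Rmult_le_pos; lra.
  apply: sqrt_le_1_alt; apply: Rle_trans q5 _; rewrite Rpow_mult_distr pow2_sqrt; lra.
have q7 : norm1 (vsub z z0) <= INR n * (s * sqrt t).
  by apply: Rle_trans (norm1_le_vnorm _) _; apply: Rmult_le_compat_l.
have q8 : sqrt t * norm1 (vsub z z0) <= sqrt t * (INR n * (s * sqrt t)) by apply: Rmult_le_compat_l.
have {}q8 : sqrt t * norm1 (vsub z z0) <= INR n * s * t by rewrite -{2}st; lra.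
have : A * (sqrt t * norm1 (vsub z z0)) <= A * (INR n * s * t) by apply: Rmult_le_compat_l.
have q9 : A * INR n * s <= e / 2.
  have -> : e / 2 = (A * INR n + 1) * s by rewrite /s; field; lra.
  by apply: Rmult_le_compat_r; lra.
have : A * INR n * s * t <= e / 2 * t by apply: Rmult_le_compat_r; lra.
lra.
Qed.

(** Cauchy's estimate for [G_1 - beta (z_1 - 1)] on a disc of radius [t / (4 M)], where
    [t = |1 - z_1|] at most doubles; the factor [32 M] compensates [4 * 2 * 4 M]. *)
Lemma dG1_near (M e : R) : 1 <= M -> 0 < e -> exists delta, 0 < delta /\
  forall z, near_e1 i0 M delta z -> Cmod (dG z (basis n i0) i0 - RtoC beta)%cx <= e.
Proof.
move=> M1 e0; have e1 : 0 < e / (32 * M) by apply: Rdiv_lt_0_compat; lra.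
case: (G1_near (M := 4 * M) (e := e / (32 * M))) => [||d [d0 Hd]]; try lra.
exists (Rmin (d / 4) (/ 8)); split; first by apply: Rmin_pos; lra.
move=> z hz; set delta := Rmin _ _ in hz.
have dd := Rmin_l (d / 4) (/ 8); have d8 := Rmin_r (d / 4) (/ 8); rewrite -/delta in dd d8.
have hb : ball z by case: hz.
have t0 := Cmod_gt0 (ball_coord1_neq1 hb (i0 := i0)); set t := Cmod (1 - z i0)%cx in t0.
have z0 : vadd z (vscal 0 (basis n i0)) = z by apply: vec_ext => k; rewrite /vadd /vscal; ring.
have ei : forall a, vadd z (vscal a (basis n i0)) i0 = (z i0 + a)%cx.
  by move=> a; rewrite /vadd /vscal /basis eqxx; ring.
have mv : forall a, Cmod a < t / (4 * M) -> near_e1 i0 (4 * M) d (vadd z (vscal a (basis n i0))).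
  move=> a ha; have [p1 [p2 [p3 p4]]] := near_move i0_0 M1 d8 hz ha.
  split=> //; split; first lra; split=> //; apply: Rle_trans p4 _; apply: Rmult_le_compat_r; last lra.
  by have := Cnorm2_coord (vadd z (vscal a (basis n i0))) i0; rewrite /ball in p1; lra.
have line : forall a, ball (vadd z (vscal a (basis n i0))) ->
  cdiff (fun b => G (vadd z (vscal b (basis n i0))) i0 - RtoC beta * (z i0 + b - 1))%cx a
    (dG (vadd z (vscal a (basis n i0))) (basis n i0) i0 - RtoC beta)%cx.
  move=> a ha; apply: cdiff_sub; first exact: (line_cdiff G_diff).
  apply: cdiff_val.
    apply: cdiff_scal; apply: cdiff_sub (cdiff_const _ _).
    exact: cdiff_add (cdiff_const _ _) (cdiff_id _).
  by ring.
have := @cauchy_estimate (fun b => G (vadd z (vscal b (basis n i0))) i0 - RtoC beta * (z i0 + b - 1))%cx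
  (dG z (basis n i0) i0 - RtoC beta)%cx (t / (4 * M)) (e / (32 * M) * (2 * t)).
have -> : 4 * (e / (32 * M) * (2 * t)) / (t / (4 * M)) = e by field; lra.
apply.
- by apply: Rdiv_lt_0_compat; lra.
- by move=> a ha; eexists; apply: line; case: (mv a ha).
- by have := line 0%cx; rewrite z0; apply.
- move=> a ha; have := Hd _ (mv a ha); rewrite ei => h; apply: Rle_trans h _.
  apply: Rmult_le_compat_l; first lra.
  have -> : (1 - (z i0 + a))%cx = ((1 - z i0) - a)%cx by ring.
  apply: Rle_trans (Cmod_sub _ _) _; rewrite -/t.
  have : Cmod a * (4 * M) < t by apply/Rlt_div_r => //; lra.
  have := Cmod_ge0 a; nra.
Qed.

(** The tangential derivatives of [G_1] are of order [|1 - z_1| ^ (1/2)] in Koranyi regions, so they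
    tend to 0. *)
Lemma dGj_near (j : 'I_n) (M e : R) : j != i0 -> 1 <= M -> 0 < e -> exists delta, 0 < delta /\
  forall z, near_e1 i0 M delta z -> Cmod (dG z (basis n j) i0 - 0)%cx <= e.
Proof.
move=> ji M1 e0.
case: (derivative_bounds i0_0 G_diff G1_bound Gj_bound (r := 4 * M)) => [|B [B0 HB]]; first lra.
have s0 : 0 < e / (B + 1) by apply: Rdiv_lt_0_compat; lra.
exists (Rmin (/ 2) ((e / (B + 1)) ^ 2)); split; first by apply: Rmin_pos; [lra | exact: pow_lt].
set delta := Rmin _ _ => z hz.
have [K1 _] := near_koranyi i0_0 M1 (Rmin_l _ _) hz; have [hb [h1 _]] := hz.
have [_ /(_ j ji) [D _]] := HB z K1.
have -> : (dG z (basis n j) i0 - 0)%cx = dG z (basis n j) i0 by ring.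
apply: Rle_trans D _.
have : sqrt (Cmod (1 - z i0)%cx) <= e / (B + 1).
  rewrite -(sqrt_pow2 (e / (B + 1))); last lra.
  by apply: sqrt_le_1_alt; apply: Rlt_le; apply: Rlt_le_trans h1 (Rmin_r _ _).
move=> /(Rmult_le_compat_l _ _ _ B0) h; apply: Rle_trans h _.
have {2}-> : e = (B + 1) * (e / (B + 1)) by field; lra.
by apply: Rmult_le_compat_r; lra.
Qed.

End Conclusion.

Theorem theorem1p2 (n : nat) (G : vec n -> vec n) (dG : vec n -> vec n -> vec n) :
  (0 < n)%N ->
  inf_generator G ->
  (forall z : vec n, ball z -> is_cderiv G z (dG z)) ->
  bounded_on_Koranyi (fun z => Cmod (inner (G z) (basis n 0)) / Cmod (Csub (coord1 z) Cone)) ->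
  (forall j, (1 <= j < n)%N ->
     bounded_on_Koranyi (fun z => Cmod (inner (G z) (basis n j))
                                  / sqrt (Cmod (Csub (coord1 z) Cone)))) ->
  BRNP G /\
  forall beta : R, is_dilation G beta ->
    bounded_on_Koranyi (fun z => Cmod (inner (dG z (basis n 0)) (basis n 0))) /\
    (forall h k, (1 <= h < n)%N -> (1 <= k < n)%N ->
       bounded_on_Koranyi (fun z => Cmod (inner (dG z (basis n h)) (basis n k)))) /\
    (forall j, (1 <= j < n)%N ->
       bounded_on_Koranyi (fun z => Cmod (Cdiv (inner (dG z (basis n j)) (basis n 0))
                                               (Csqrt (Csub Cone (coord1 z)))))) /\
    (forall j, (1 <= j < n)%N ->
       bounded_on_Koranyi (fun z => Cmod (Cmul (Csqrt (Csub Cone (coord1 z)))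
                                               (inner (dG z (basis n 0)) (basis n j))))) /\
    K_lim (fun z => Cdiv (inner (G z) (basis n 0)) (Csub (coord1 z) Cone)) (RtoC beta) /\
    K_lim (fun z => inner (dG z (basis n 0)) (basis n 0)) (RtoC beta) /\
    (forall j, (1 <= j < n)%N ->
       K_lim (fun z => inner (dG z (basis n j)) (basis n 0)) Czero).
Proof.
move=> n0 G_gen G_diff H1 H2; pose i0 := Ordinal n0.
have i0_0 : nat_of_ord i0 = 0%N by [].
have ib0 : forall v : vec n, inner v (basis n 0) = v i0 by move=> v; exact: (inner_basis v i0).
have ij : forall j, (1 <= j < n)%N -> exists k : 'I_n, k != i0 /\ nat_of_ord k = j.
  move=> j /andP [j1 jn]; exists (Ordinal jn); split=> //.
  by apply/eqP => /(congr1 val) /= E; rewrite E in j1.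
have c1 : forall z : vec n, coord1 z = z i0 by exact: coord1E.
have tpos : forall z : vec n, ball z -> 0 < Cmod (1 - z i0)%cx.
  by move=> z /(ball_coord1_neq1 (i0 := i0)); exact: Cmod_gt0.
have G1_bound : forall r, 1 <= r -> exists M, 0 <= M /\
    forall z, Koranyi r z -> Cmod (G z i0) <= M * Cmod (1 - z i0)%cx.
  move=> r r1; case: (H1 r r1) => M HM; exists (Rmax 0 M); split; first exact: Rmax_l.
  move=> z hz; have t0 := tpos z (koranyi_ball hz); have := HM z hz.
  rewrite ib0 c1 Cmod_subC => h; apply/Rle_div_l => //.
  by apply: Rle_trans (Rle_trans _ _ _ (Rle_abs _) h) (Rmax_r _ _).
have Gj_bound : forall r, 1 <= r -> exists M, 0 <= M /\ forall j, j != i0 -> forall z, Koranyi r z ->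
    Cmod (G z j) <= M * sqrt (Cmod (1 - z i0)%cx).
  move=> r r1; apply: uniform_bound => [j x y xy H ji z hz|j].
    by apply: Rle_trans (H ji z hz) _; apply: Rmult_le_compat_r => //; exact: sqrt_pos.
  (* At [i0] the bound is vacuous and 0 is a placeholder. *)
  case: (eqVneq j i0) => [E|ji]; first by exists 0.
  have jr : (1 <= j < n)%N by rewrite ltn_ord andbT lt0n.
  case: (H2 j jr r r1) => M HM; exists M => _ z hz.
  have t0 := sqrt_lt_R0 _ (tpos z (koranyi_ball hz)); have := HM z hz.
  rewrite inner_basis c1 Cmod_subC => h; apply/Rle_div_l => //.
  exact: Rle_trans (Rle_abs _) h.
split; first exact: (generator_BRNP i0_0 G_diff G_gen G1_bound Gj_bound).
move=> beta beta_dil.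
have bnd : forall (f : vec n -> C) (P : R -> vec n -> Prop),
   (forall r, 1 <= r -> exists M, 0 <= M /\ forall z, Koranyi r z -> P M z) ->
   (forall M z, 0 <= M -> ball z -> P M z -> Cmod (f z) <= M) -> bounded_on_Koranyi (fun z => Cmod (f z)).
  move=> f P HP Hf r r1; case: (HP r r1) => M [M0 HM]; exists M => z hz.
  by rewrite Rabs_pos_eq; [apply: Hf => //; [exact: koranyi_ball hz | exact: HM] | exact: Cmod_ge0].
have D := derivative_bounds i0_0 G_diff G1_bound Gj_bound.
split; [|split; [|split; [|split; [|split; [|split]]]]].
- by apply: (bnd _ _ D) => M z M0 hz [h _]; rewrite ib0.
- move=> h k /ij [h' [hh <-]] /ij [k' [kk <-]].
  by apply: (bnd _ _ D) => M z M0 hz [_ /(_ h' hh) [_ [_ /(_ k' kk)]]]; rewrite inner_basis.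
- move=> j /ij [j' [jj <-]]; apply: (bnd _ _ D) => M z M0 hz [_ /(_ j' jj) [h _]].
  have s0 := sqrt_lt_R0 _ (tpos z hz).
  rewrite ib0 c1 Cmod_div ?Cmod_Csqrt; first by apply/Rle_div_l.
  by apply: Cmod_neq0; rewrite Cmod_Csqrt.
- move=> j /ij [j' [jj <-]]; apply: (bnd _ _ D) => M z M0 hz [_ /(_ j' jj) [_ [h _]]].
  have s0 := sqrt_lt_R0 _ (tpos z hz).
  rewrite inner_basis c1 Cmod_mul Cmod_Csqrt Rmult_comm.
  by apply/Rle_div_r.
- apply: (K_lim_near i0_0) => M e M1 e0.
  case: (G1_near i0_0 G_diff G_gen G1_bound Gj_bound beta_dil M1 e0) => d [d0 Hd].
  exists d; split=> // z hz; have hb : ball z by case: hz.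
  have t0 := tpos z hb; have zn : (z i0 - 1)%cx <> 0%cx by apply: Cmod_neq0; rewrite Cmod_subC.
  rewrite ib0 c1.
  have -> : (G z i0 / (z i0 - 1) - RtoC beta)%cx = ((G z i0 - RtoC beta * (z i0 - 1)) / (z i0 - 1))%cx by field.
  by rewrite Cmod_div // (Cmod_subC (z i0)); apply/Rle_div_l => //; exact: Hd.
- apply: (K_lim_near i0_0) => M e M1 e0.
  case: (dG1_near i0_0 G_diff G_gen G1_bound Gj_bound beta_dil M1 e0) => d [d0 Hd].
  by exists d; split=> // z hz; rewrite ib0; exact: Hd.
- move=> j /ij [j' [jj <-]]; apply: (K_lim_near i0_0) => M e M1 e0.
  case: (dGj_near i0_0 G_diff G1_bound Gj_bound jj M1 e0) => d [d0 Hd].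
  by exists d; split=> // z hz; rewrite ib0; exact: Hd.
Qed.
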